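(* Let $s>1$. There exists $\varepsilon_0=\varepsilon_0(s)\in(0,1)$ such that the following two assertions hold. (i) For every $\alpha>0$ there exist constants $c_\alpha\in(0,1)$ and $C_\alpha>0$ such that, for every $\varepsilon\in(0,\varepsilon_0]$ and every $u_0\in H^s(\mathbb T)$ with $\Pi_+u_0=u_0$ and $\|u_0\|_{H^s}=\varepsilon$, if $u$ denotes the solution of the half-wave equation $$i\partial_t u-|D|u=|u|^2u,\qquad u(0,\cdot)=u_0,$$ and $v$ denotes the solution of the (transported) cubic Szegő equation $$i\partial_t v-Dv=\Pi_+(|v|^2v),\qquad v(0,\cdot)=u_0,$$ then $$\|u(t)-v(t)\|_{H^s}\le C_\alpha\,\varepsilon^{3-\alpha}\qquad\text{for all } 0\le t\le \frac{c_\alpha}{\varepsilon^2}\log\frac1\varepsilon .$$ (ii) There exist constants $c>0$ and $C>0$ such that, for every $\varepsilon\in(0,\varepsilon_0]$ and every $u_0\in H^s(\mathbb T)$ with $\Pi_+u_0=u_0$ and $\|u_0\|_{H^s}=\varepsilon$, the solution $u$ of the half-wave equation with $u(0,\cdot)=u_0$ satisfies $$\|u(t)\|_{L^\infty}\le C\varepsilon\qquad\text{for all } 0\le t\le \frac{c}{\varepsilon^3}.$$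
   Context: $\mathbb T=\mathbb R/2\pi\mathbb Z$. For $u=\sum_{k\in\mathbb Z}u_ke^{ikx}$: $Du=\sum_k k\,u_ke^{ikx}$ (i.e. $D=-i\partial_x$), $|D|u=\sum_k|k|\,u_ke^{ikx}$, $\Pi_+u=\sum_{k\ge0}u_ke^{ikx}$, and $\|u\|_{H^s}^2=\sum_k(1+k^2)^s|u_k|^2$. Functions are complex valued. For every $s\ge\frac12$ and every $u_0\in H^s(\mathbb T)$, the half-wave equation $i\partial_tu-|D|u=|u|^2u$, $u(0)=u_0$, has a unique global solution $u\in C(\mathbb R,H^{1/2}(\mathbb T))$, and it belongs to $C(\mathbb R,H^s(\mathbb T))$. Similarly, for $u_0\in H^s(\mathbb T)$ with $\Pi_+u_0=u_0$, the equation $i\partial_tv-Dv=\Pi_+(|v|^2v)$, $v(0)=u_0$, has a unique global solution $v\in C(\mathbb R,H^s(\mathbb T))$ with $\Pi_+v(t)=v(t)$. These are the solutions meant in the statement. *)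

(* Defs.v *)
From HB Require Import structures.
From mathcomp Require Import all_boot all_order all_algebra.
From mathcomp Require Import all_classical all_reals all_analysis.
From mathcomp Require Import complex.

Set Implicit Arguments.
Unset Strict Implicit.
Unset Printing Implicit Defensive.

Import Order.TTheory GRing.Theory Num.Theory.
Import numFieldNormedType.Exports.

Local Open Scope classical_set_scope.
Local Open Scope ring_scope.
Local Open Scope complex_scope.

(* The modulus of a complex number, as an element of R. *)
Notation cmod := ComplexField.Normc.normc.

(* Functions on the torus R/2piZ are 2pi-periodic functions R -> R[i], taken as
   representatives of their a.e. classes. The library has no Lebesgue integral
   of complex-valued functions, so it is taken on real and imaginary parts. *)

Definition period (R : realType) : set R := `[0, 2 * pi]%classic.

Definition cexpi (R : realType) (x : R) : R[i] := cos x +i* sin x.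

Definition cintegral (R : realType) (A : set R) (f : R -> R[i]) : R[i] :=
  Rintegral lebesgue_measure A (fun x => complex.Re (f x)) +i*
  Rintegral lebesgue_measure A (fun x => complex.Im (f x)).

Definition fourier (R : realType) (f : R -> R[i]) (k : int) : R[i] :=
  ((2 * pi)^-1)%:C *
  cintegral (@period R) (fun x => f x * cexpi (- (k%:~R * x))).

Definition L2_torus (R : realType) (f : R -> R[i]) : Prop :=
  [/\ forall x, f (x + 2 * pi) = f x,
      measurable_fun [set: R] (fun x => complex.Re (f x)),
      measurable_fun [set: R] (fun x => complex.Im (f x)) &
      (\int[lebesgue_measure]_(x in @period R)
         ((cmod (f x)) ^+ 2)%R%:E < +oo)%E].

Definition Hnorm (R : realType) (s : R) (f : R -> R[i]) : \bar R :=
  ((\esum_(k in [set: int])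
      ((1 + (k%:~R : R) ^+ 2) `^ s * (cmod (fourier f k)) ^+ 2)%R%:E) `^ 2^-1)%E.

Definition in_H (R : realType) (s : R) (f : R -> R[i]) : Prop :=
  L2_torus f /\ (Hnorm s f < +oo)%E.

(* For periodic f the essential supremum over R is the one over a period. *)
Definition Linfty_norm (R : realType) (f : R -> R[i]) : \bar R :=
  Lnorm lebesgue_measure +oo%E (fun x : R => (cmod (f x))%:E).

(* Fourier multipliers act on sequences of Fourier coefficients, since Du and
   |D|u need not be functions when u has low regularity. *)

Definition mulD (R : realType) (a : int -> R[i]) (k : int) : R[i] :=
  k%:~R * a k.

Definition mulabsD (R : realType) (a : int -> R[i]) (k : int) : R[i] :=
  `|k|%:~R * a k.

Definition Pi_plus (R : realType) (a : int -> R[i]) (k : int) : R[i] :=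
  if 0 <= k then a k else 0.

(* Pi_+ f = f *)
Definition Hardy (R : realType) (f : R -> R[i]) : Prop :=
  Pi_plus (fourier f) = fourier f.

Definition cubic (R : realType) (f : R -> R[i]) (x : R) : R[i] :=
  `|f x| ^+ 2 * f x.

(* u belongs to C(R, H^s) *)
Definition continuous_H (R : realType) (s : R) (u : R -> R -> R[i]) : Prop :=
  (forall t, in_H s (u t)) /\
  (forall t, Hnorm s (u r \- u t) @[r --> t] --> 0%E).

(* a is the sequence of Fourier coefficients of the distribution
   (d/dt u)(t, .). *)
Definition is_time_derivative (R : realType) (u : R -> R -> R[i]) (t : R)
    (a : int -> R[i]) : Prop :=
  forall k : int,
    is_derive t 1 (fun r : R => complex.Re (fourier (u r) k)) (complex.Re (a k))
    /\
    is_derive t 1 (fun r : R => complex.Im (fourier (u r) k)) (complex.Im (a k)).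

(* i u_t - |D| u = |u|^2 u, in the sense of distributions on the torus for
   each t: for u in C(R, H^s) with s > 1/2, |u|^2 u is continuous in time with
   values in H^s, so this is the same as the equation in C(R, H^(s-1)). *)
Definition half_wave_equation (R : realType) (u : R -> R -> R[i]) : Prop :=
  forall t : R, exists2 ut : int -> R[i], is_time_derivative u t ut &
    forall k : int,
      'i%C * ut k - mulabsD (fourier (u t)) k = fourier (cubic (u t)) k.

(* i v_t - D v = Pi_+ (|v|^2 v) *)
Definition szego_equation (R : realType) (v : R -> R -> R[i]) : Prop :=
  forall t : R, exists2 vt : int -> R[i], is_time_derivative v t vt &
    forall k : int,
      'i%C * vt k - mulD (fourier (v t)) k =
      Pi_plus (fourier (cubic (v t))) k.

Definition half_wave_solution (R : realType) (s : R) (u0 : R -> R[i])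
    (u : R -> R -> R[i]) : Prop :=
  [/\ continuous_H s u, half_wave_equation u &
      u 0 = u0 %[ae lebesgue_measure in [set: R]]].

Definition szego_solution (R : realType) (s : R) (u0 : R -> R[i])
    (v : R -> R -> R[i]) : Prop :=
  [/\ continuous_H s v, forall t, Hardy (v t), szego_equation v &
      v 0 = u0 %[ae lebesgue_measure in [set: R]]].

(* Main.v *)
(* A function on the torus is traced through its truncated Fourier coefficients,
   which solve the equations up to an error that is small in H^s, uniformly on
   compact time intervals; it then suffices to bound trigonometric polynomials,
   with constants independent of their degree.

   The Szego flow has a Lax pair: it conjugates the Hankel matrix
   (v_(j + k))_(j, k) by unitaries, hence preserves its trace norm, which
   dominates the Wiener norm of v and, for s > 1, is dominated by the H^s norm.
   Write u = p + q with p and q the parts of nonnegative and of negative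
   frequencies. Then p solves the Szego equation up to terms containing q, while
   q, which vanishes at time 0, is forced by the nonresonant part of |p|^2 p;
   subtracting from q the normal form of that part leaves an equation for a
   quantity of size e^3 whose forcing has size e^5. On times c / e^3 a bootstrap
   keeps the trace norm of u of size e and the Wiener norm of q below e^2, which
   is (ii). On that time scale the H^s norm grows at most like
   exp(A e^2 t), by tame estimates, and so does the difference u - v starting
   from e^3; for t <= (c_alpha / e^2) log(1 / e) the exponential is at most
   e^(- alpha), which is (i). *)
Require Import Defs.
From HB Require Import structures.
From mathcomp Require Import all_boot all_order all_algebra.
From mathcomp Require Import all_classical all_reals all_analysis.
From mathcomp Require Import complex.
From mathcomp Require Import measurable_realfun ess_sup_inf polyrcf.
From mathcomp Require Import zify ring lra.
Set Implicit Arguments.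
Unset Strict Implicit.
Unset Printing Implicit Defensive.
Import Order.TTheory GRing.Theory Num.Theory.
Import numFieldNormedType.Exports.
Local Open Scope classical_set_scope.
Local Open Scope ring_scope.
Local Open Scope complex_scope.

(** * Complex numbers and trigonometric polynomials *)

(** On times e^-3 Gronwall tolerates a linear rate of order e^3 only. For q even the term 2 |p|^2 q,
    of rate e^2, is therefore too large; it is removed by a second normal form, except for the mean
    of |p|^2. That mean is real, so what it leaves rotates the phase of q and keeps its norm. The
    term p^2 conj q has no negative frequencies and drops out, and the remaining cubic terms are at
    least quadratic in q, with one factor measured in the Wiener norm. For the same reason the size
    of p cannot come from Gronwall and has to come from the conservation law. The norms are not
    differentiable, and D is not bounded uniformly in the degree. Growth is therefore measured by
    upper derivatives along Euler steps, in a frame moving by translations, which preserve every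
    norm used; on each half line of frequencies |D| is D or -D. The trace norm is defined by duality
    with finite contractions, so that the Lax pair enters only to first order: 1 + hA is an isometry
    up to h^2 when A is skew-adjoint. *)

Section Modulus.
Context {R : realType}.
Implicit Types z w : R[i].

Lemma cmod_ge0 z : 0 <= cmod z.
Proof. by case: z => a b /=; exact: sqrtr_ge0. Qed.

Lemma cmodM z w : cmod (z * w) = cmod z * cmod w.
Proof. exact: ComplexField.Normc.normcM. Qed.

Lemma cmodD z w : cmod (z + w) <= cmod z + cmod w.
Proof. exact: le_normcD. Qed.

Lemma cmodN z : cmod (- z) = cmod z.
Proof. exact: normcN. Qed.

Lemma cmodB z w : cmod (z - w) <= cmod z + cmod w.
Proof. by rewrite -(cmodN w); exact: cmodD. Qed.

Lemma cmod0 : cmod (0 : R[i]) = 0.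
Proof. exact: ComplexField.Normc.normc0. Qed.

Lemma cmod1 : cmod (1 : R[i]) = 1.
Proof. exact: ComplexField.Normc.normc1. Qed.

Lemma cmod_conj z : cmod (z^*)%C = cmod z.
Proof. by case: z => a b /=; rewrite sqrrN. Qed.

Lemma cmod_real (x : R) : cmod x%:C = `|x|.
Proof. by rewrite /= expr0n /= addr0 sqrtr_sqr. Qed.

Lemma cmodi : cmod ('i : R[i]) = 1.
Proof. by rewrite /= expr0n /= expr1n add0r sqrtr1. Qed.

Lemma sqr_cmod z : cmod z ^+ 2 = complex.Re z ^+ 2 + complex.Im z ^+ 2.
Proof. by case: z => a b /=; rewrite sqr_sqrtr // addr_ge0 ?sqr_ge0. Qed.

Lemma Re_le_cmod z : `|complex.Re z| <= cmod z.
Proof.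
rewrite -(@ler_pXn2r _ 2) ?nnegrE ?cmod_ge0 ?normr_ge0// sqr_cmod.
by rewrite real_normK ?num_real// lerDl sqr_ge0.
Qed.

Lemma Im_le_cmod z : `|complex.Im z| <= cmod z.
Proof.
rewrite -(@ler_pXn2r _ 2) ?nnegrE ?cmod_ge0 ?normr_ge0// sqr_cmod.
by rewrite real_normK ?num_real// lerDr sqr_ge0.
Qed.

Lemma cmod_le_ReIm z : cmod z <= `|complex.Re z| + `|complex.Im z|.
Proof.
rewrite [X in cmod X <= _]complexE (le_trans (cmodD _ _))//.
by rewrite cmodM cmodi mul1r !cmod_real.
Qed.

Lemma cmod_eq0 z : cmod z = 0 -> z = 0.
Proof. exact: ComplexField.Normc.eq0_normc. Qed.

Lemma cmod_sum (I : Type) (r : seq I) (P : pred I) (F : I -> R[i]) :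
  cmod (\sum_(i <- r | P i) F i) <= \sum_(i <- r | P i) cmod (F i).
Proof.
elim/big_rec2: _ => [|i y x _ h]; first by rewrite cmod0.
by rewrite (le_trans (cmodD _ _))// lerD2l.
Qed.

Lemma cexpi0 : cexpi 0 = 1 :> R[i].
Proof. by rewrite /cexpi cos0 sin0. Qed.

Lemma cexpiD (x y : R) : cexpi (x + y) = cexpi x * cexpi y.
Proof.
by rewrite /cexpi cosD sinD; apply/eqP; rewrite eq_complex /= eqxx /= addrC eqxx.
Qed.

Lemma cmod_cexpi (x : R) : cmod (cexpi x) = 1.
Proof. by rewrite /cexpi /= cos2Dsin2 sqrtr1. Qed.

Lemma conj_cexpi (x : R) : (cexpi x)^*%C = cexpi (- x).
Proof. by rewrite /cexpi cosN sinN. Qed.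

Lemma conj_sum (I : Type) (r : seq I) (P : pred I) (F : I -> R[i]) :
  ((\sum_(i <- r | P i) F i)^*)%C = \sum_(i <- r | P i) ((F i)^*)%C.
Proof. exact: raddf_sum. Qed.

End Modulus.

(** * Sums of finitely supported families over the integers *)

Section SumsOverInt.

Definition intball (n : nat) : seq int :=
  [seq i%:Z - n%:Z | i <- iota 0 n.*2.+1].

Lemma mem_intball n k : (k \in intball n) = (`|k| <= n)%N.
Proof.
apply/mapP/idP => [[j]|kn].
  by rewrite mem_iota => /andP[_ /=]; rewrite add0n => h -> ; lia.
by exists (absz (k + n%:Z)); [rewrite mem_iota /=; lia | lia].
Qed.

Lemma intball_uniq n : uniq (intball n).
Proof. by rewrite map_inj_uniq ?iota_uniq// => i j; lia. Qed.

Definition supported (V : nmodType) (n : nat) (f : int -> V) :=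
  forall k : int, (n < `|k|)%N -> f k = 0.

Definition finsupp_int (V : nmodType) (f : int -> V) := exists n, supported n f.

(** Total by convention: a family of infinite support sums to 0. Hence additivity and comparison
    below ask for finite support. *)
Definition zsum (V : nmodType) (f : int -> V) : V :=
  \sum_(k \in [set: int]) f k.

Lemma supported_le (V : nmodType) (n m : nat) (f : int -> V) :
  (n <= m)%N -> supported n f -> supported m f.
Proof. by move=> nm fn k mk; apply: fn; lia. Qed.

Lemma zsumE (V : nmodType) (n : nat) (f : int -> V) : supported n f ->
  zsum f = \sum_(k <- intball n) f k.
Proof.
move=> fn; rewrite /zsum (fsbigE (intball n)) ?intball_uniq//.
  by apply: eq_bigl => k; rewrite in_setT.
by move=> k _; rewrite mem_intball -ltnNge; exact: fn.
Qed.

Lemma eq_zsum (V : nmodType) (f g : int -> V) : f =1 g -> zsum f = zsum g.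
Proof. by move=> fg; apply: eq_fsbigr => k _; exact: fg. Qed.

Lemma zsum_reindex (V : nmodType) (h : int -> int) (f : int -> V) :
  bijective h -> zsum f = zsum (fun k => f (h k)).
Proof. by move=> hb; exact: reindex_fsbigT. Qed.

Lemma zsum_shift (V : nmodType) (j : int) (f : int -> V) :
  zsum f = zsum (fun k => f (k + j)).
Proof.
by apply: zsum_reindex; exists (fun k => k - j) => k; rewrite ?addrK ?subrK.
Qed.

Lemma zsum_opp (V : nmodType) (f : int -> V) : zsum f = zsum (fun k => f (- k)).
Proof. by apply: zsum_reindex; exists (fun k => - k) => k; rewrite opprK. Qed.

Lemma zsum_rev (V : nmodType) (j : int) (f : int -> V) :
  zsum f = zsum (fun k => f (j - k)).
Proof. by apply: zsum_reindex; exists (fun k => j - k) => k; lia. Qed.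

Lemma finsupp_int2 (V W : nmodType) (f : int -> V) (g : int -> W) :
  finsupp_int f -> finsupp_int g -> exists2 n, supported n f & supported n g.
Proof.
move=> [n fn] [m gm]; exists (n + m)%N; [apply: supported_le fn|apply: supported_le gm].
  exact: leq_addr.
exact: leq_addl.
Qed.

Lemma zsumD (V : nmodType) (f g : int -> V) : finsupp_int f -> finsupp_int g ->
  zsum (fun k => f k + g k) = zsum f + zsum g.
Proof.
move=> ff gf; have [n fn gn] := finsupp_int2 ff gf.
rewrite (zsumE fn) (zsumE gn) (@zsumE _ n) ?big_split// => k kn.
by rewrite fn// gn// addr0.
Qed.

Lemma zsum_exchange (V : nmodType) (n : nat) (F : int -> int -> V) :
  (forall k l, (n < `|k|)%N || (n < `|l|)%N -> F k l = 0) ->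
  zsum (fun k => zsum (F k)) = zsum (fun l => zsum (F ^~ l)).
Proof.
move=> F0.
have F1 k : supported n (F k) by move=> l ln; rewrite F0// ln orbT.
have F2 l : supported n (F ^~ l) by move=> k kn; rewrite F0// kn.
rewrite (@zsumE _ n); last first.
  by move=> k kn; apply: fsbig1 => l _; rewrite F0// kn.
rewrite [RHS](@zsumE _ n); last first.
  by move=> k kn; apply: fsbig1 => l _; rewrite F0// kn orbT.
under eq_bigr do rewrite (zsumE (F1 _)).
by under [RHS]eq_bigr do rewrite (zsumE (F2 _)); rewrite exchange_big.
Qed.

Lemma zsum_ge0 (R : numDomainType) (f : int -> R) :
  (forall k, 0 <= f k) -> 0 <= zsum f.
Proof. by move=> f0; apply: fsumr_ge0. Qed.

Lemma ler_zsum (R : numDomainType) (f g : int -> R) : finsupp_int f -> finsupp_int g ->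
  (forall k, f k <= g k) -> zsum f <= zsum g.
Proof.
move=> ff gf fg; have [n fn gn] := finsupp_int2 ff gf.
by rewrite (zsumE fn) (zsumE gn); apply: ler_sum.
Qed.

Lemma cmod_zsum (R : realType) (f : int -> R[i]) : finsupp_int f ->
  cmod (zsum f) <= zsum (fun k => cmod (f k)).
Proof.
move=> [n fn]; rewrite (zsumE fn) (@zsumE _ n); first exact: cmod_sum.
by move=> k kn; rewrite fn// cmod0.
Qed.

(** A nonzero factor preserves the support in an integral domain, so the identity survives the
    convention that infinite supports sum to 0. *)
Lemma mulr_zsumr (R : idomainType) a (f : int -> R) :
  a * zsum f = zsum (fun k => a * f k).
Proof. exact: mulr_fsumr. Qed.

Lemma mulr_zsuml (R : idomainType) a (f : int -> R) :
  zsum f * a = zsum (fun k => f k * a).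
Proof. exact: mulr_fsuml. Qed.

Lemma finsupp_comp (V W : nmodType) (f : int -> V) (g : int -> W) :
  (forall k, f k = 0 -> g k = 0) -> finsupp_int f -> finsupp_int g.
Proof. by move=> fg [n fn]; exists n => k /fn /fg. Qed.

Lemma zsum_delta (V : nmodType) (j : int) (f : int -> V) :
  (forall k, k != j -> f k = 0) -> zsum f = f j.
Proof.
move=> f0; rewrite (@zsumE _ `|j|%N); last by move=> k kj; apply: f0; lia.
rewrite (bigD1_seq j) ?intball_uniq ?mem_intball//= big1_seq ?addr0//.
by move=> k /andP[kj _]; exact: f0.
Qed.

End SumsOverInt.

(** * Trigonometric polynomials as a commutative ring, and Fourier multipliers *)

Fact tp_key : unit. Proof. exact: tt. Qed.

(** Laurent polynomials in e^(ix). The support bound is only a proposition, so polynomials of all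
    degrees form one ring, as degree-free estimates require. *)
Record trigpoly (R : realType) := Trigpoly {
  tcoef :> int -> R[i];
  tcoef_finsupp : finsupp_int tcoef }.

HB.instance Definition _ (R : realType) := gen_eqMixin (trigpoly R).
HB.instance Definition _ (R : realType) := gen_choiceMixin (trigpoly R).

Section TrigPolyRing.
Context {R : realType}.
Local Notation tp := (trigpoly R).
Implicit Types a b c : tp.

Lemma tpP a b : (forall k, a k = b k) -> a = b.
Proof.
case: a b => [f ff] [g gf] /= /funext e; rewrite e in ff *.
by congr Trigpoly; exact: Prop_irrelevance.
Qed.

Lemma tp_supp a : exists n, supported n a.
Proof. exact: tcoef_finsupp. Qed.
Hint Resolve tcoef_finsupp : core.

Lemma tp_add_finsupp a b : finsupp_int (fun k => a k + b k).
Proof.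
have [n an bn] := finsupp_int2 (tcoef_finsupp a) (tcoef_finsupp b).
by exists n => k kn; rewrite an// bn// addr0.
Qed.
Definition tp_add a b := Trigpoly (tp_add_finsupp a b).

Lemma tp_opp_finsupp a : finsupp_int (fun k => - a k).
Proof. by apply: finsupp_comp (tcoef_finsupp a) => k ->; rewrite oppr0. Qed.
Definition tp_opp a := Trigpoly (tp_opp_finsupp a).

Lemma tp_zero_finsupp : finsupp_int (fun=> 0 : R[i]).
Proof. by exists 0. Qed.
Definition tp_zero := Trigpoly tp_zero_finsupp.

Lemma tp_mul_supported a b n m : supported n a -> supported m b ->
  supported (n + m) (fun k => zsum (fun l => a l * b (k - l))).
Proof.
move=> an bm k kn; apply: fsbig1 => l _.
have [ln|ln] := ltnP n `|l|%N; first by rewrite an// mul0r.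
by rewrite bm ?mulr0//; lia.
Qed.

Lemma tp_mul_finsupp a b : finsupp_int (fun k => zsum (fun l => a l * b (k - l))).
Proof.
have [n an] := tp_supp a; have [m bm] := tp_supp b.
by exists (n + m)%N; exact: tp_mul_supported.
Qed.
(* Locked, so that unification never compares bodies of products. *)
Definition tp_mul : tp -> tp -> tp :=
  locked_with tp_key (fun a b => Trigpoly (tp_mul_finsupp a b)).

Lemma tp_mulE_coef a b k : tp_mul a b k = zsum (fun l => a l * b (k - l)).
Proof. by rewrite /tp_mul unlock. Qed.

Lemma tcst_finsupp (z : R[i]) : finsupp_int (fun k => if k == 0 then z else 0).
Proof. by exists 0 => k; case: eqP => // ->. Qed.
Definition tcst z := Trigpoly (tcst_finsupp z).

Fact tp_addA : associative tp_add.
Proof. by move=> a b c; apply: tpP => k /=; rewrite addrA. Qed.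
Fact tp_addC : commutative tp_add.
Proof. by move=> a b; apply: tpP => k /=; rewrite addrC. Qed.
Fact tp_add0 : left_id tp_zero tp_add.
Proof. by move=> a; apply: tpP => k /=; rewrite add0r. Qed.
Fact tp_addN : left_inverse tp_zero tp_opp tp_add.
Proof. by move=> a; apply: tpP => k /=; rewrite addNr. Qed.

HB.instance Definition _ := GRing.isZmodule.Build tp
  tp_addA tp_addC tp_add0 tp_addN.

Lemma conv_finsupp a (f : int -> R[i]) : finsupp_int (fun l => a l * f l).
Proof. by apply: finsupp_comp (tcoef_finsupp a) => k ->; rewrite mul0r. Qed.

Fact tp_mulC : commutative tp_mul.
Proof.
move=> a b; apply: tpP => k; rewrite !tp_mulE_coef (zsum_rev k); apply: eq_zsum => l.
by rewrite subKr mulrC.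
Qed.

Fact tp_mulA : associative tp_mul.
Proof.
move=> a b c; apply: tpP => k; rewrite !tp_mulE_coef.
have [n an] := tp_supp a; have [m bm] := tp_supp b.
under [RHS]eq_zsum do rewrite tp_mulE_coef mulr_zsuml.
rewrite [RHS](@zsum_exchange _ (n + m)); last first.
  move=> l j lj; have [jn|jn] := ltnP n `|j|%N; first by rewrite an// !mul0r.
  by rewrite bm ?mulr0 ?mul0r//; lia.
apply: eq_zsum => j; rewrite tp_mulE_coef mulr_zsumr [RHS](zsum_shift j).
apply: eq_zsum => l; rewrite mulrA addrK; congr (_ * _); congr (c _); lia.
Qed.

Fact tp_mul1 : left_id (tcst 1) tp_mul.
Proof.
move=> a; apply: tpP => k; rewrite tp_mulE_coef (@zsum_delta _ 0) /=.
  by rewrite ?eqxx mul1r subr0.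
by move=> l /negPf ->; rewrite mul0r.
Qed.

Fact tp_mulDl : left_distributive tp_mul tp_add.
Proof.
move=> a b c; apply: tpP => k; rewrite /= !tp_mulE_coef -zsumD; try exact: conv_finsupp.
by apply: eq_zsum => l; rewrite mulrDl.
Qed.

Fact tp_one_neq0 : tcst 1 != 0 :> tp.
Proof.
apply/eqP => /(congr1 (fun a : tp => a 0)) /= /eqP.
by rewrite oner_eq0.
Qed.

HB.instance Definition _ := GRing.Zmodule_isComNzRing.Build tp
  tp_mulA tp_mulC tp_mul1 tp_mulDl tp_one_neq0.

Lemma tpDE a b k : (a + b) k = a k + b k. Proof. by []. Qed.
Lemma tpNE a k : (- a) k = - a k. Proof. by []. Qed.
Lemma tpBE a b k : (a - b) k = a k - b k. Proof. by []. Qed.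
Lemma tpME a b k : (a * b) k = zsum (fun l => a l * b (k - l)).
Proof. exact: tp_mulE_coef. Qed.
Lemma tcstE z k : tcst z k = if k == 0 then z else 0. Proof. by []. Qed.

Lemma tp_sumE (I : Type) (r : seq I) (F : I -> tp) k :
  (\sum_(i <- r) F i) k = \sum_(i <- r) F i k.
Proof. exact: (big_morph (fun a : tp => a k)). Qed.

Lemma tcstME z a k : (tcst z * a) k = z * a k.
Proof.
rewrite tpME (@zsum_delta _ 0); first by rewrite tcstE eqxx subr0.
by move=> l /negPf h; rewrite tcstE h mul0r.
Qed.

Lemma tcstD z w : tcst (z + w) = tcst z + tcst w.
Proof. by apply: tpP => k; rewrite tpDE !tcstE; case: ifP; rewrite ?addr0. Qed.

Lemma tcstN z : tcst (- z) = - tcst z.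
Proof. by apply: tpP => k; rewrite tpNE !tcstE; case: ifP; rewrite ?oppr0. Qed.

Lemma tcstM z w : tcst (z * w) = tcst z * tcst w.
Proof. by apply: tpP => k; rewrite tcstME !tcstE; case: ifP; rewrite ?mulr0. Qed.

Lemma tcst1 : tcst 1 = 1. Proof. by []. Qed.
Lemma tcst0 : tcst 0 = 0.
Proof. by apply: tpP => k; rewrite tcstE; case: ifP. Qed.

Lemma supportedM a b n m : supported n a -> supported m b -> supported (n + m) (a * b).
Proof.
move=> an bm k kn; rewrite tpME; exact: tp_mul_supported an bm k kn.
Qed.

Lemma tmul_finsupp (m : int -> R[i]) a : finsupp_int (fun k => m k * a k).
Proof. by apply: finsupp_comp (tcoef_finsupp a) => k ->; rewrite mulr0. Qed.
Definition tmult : (int -> R[i]) -> tp -> tp :=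
  locked_with tp_key (fun m a => Trigpoly (tmul_finsupp m a)).

Lemma tmultE m a k : tmult m a k = m k * a k.
Proof. by rewrite /tmult unlock. Qed.
Lemma tmultD m a b : tmult m (a + b) = tmult m a + tmult m b.
Proof. by apply: tpP => k; rewrite !(tmultE, tpDE) mulrDr. Qed.
Lemma tmultN m a : tmult m (- a) = - tmult m a.
Proof. by apply: tpP => k; rewrite !(tmultE, tpNE) mulrN. Qed.
Lemma tmultB m a b : tmult m (a - b) = tmult m a - tmult m b.
Proof. by rewrite tmultD tmultN. Qed.
Lemma tmultZ m z a : tmult m (tcst z * a) = tcst z * tmult m a.
Proof. by apply: tpP => k; rewrite !(tmultE, tcstME) mulrCA. Qed.
Lemma tmult_comp m m' a : tmult m (tmult m' a) = tmult (fun k => m k * m' k) a.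
Proof. by apply: tpP => k; rewrite !tmultE mulrA. Qed.
Lemma eq_tmult m m' a : (forall k, a k != 0 -> m k = m' k) -> tmult m a = tmult m' a.
Proof.
by move=> e; apply: tpP => k; rewrite !tmultE; have [->|/e ->] := eqVneq (a k) 0;
  rewrite ?mulr0.
Qed.

(** Coefficients of the complex conjugate function: conjugation sends e^(ikx) to e^(-ikx). *)
Definition tbar_def a (k : int) : R[i] := ((a (- k))^*)%C.
Lemma tbar_finsupp a : finsupp_int (tbar_def a).
Proof.
have [n an] := tp_supp a; exists n => k kn.
by rewrite /tbar_def an ?abszN// conjc0.
Qed.
Definition tbar : tp -> tp := locked_with tp_key (fun a => Trigpoly (tbar_finsupp a)).

Lemma tbarE a k : tbar a k = ((a (- k))^*)%C.
Proof. by rewrite /tbar unlock. Qed.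
Lemma tbarD a b : tbar (a + b) = tbar a + tbar b.
Proof. by apply: tpP => k; rewrite !(tpDE, tbarE) rmorphD. Qed.
Lemma tbarN a : tbar (- a) = - tbar a.
Proof. by apply: tpP => k; rewrite !(tpNE, tbarE) rmorphN. Qed.
Lemma tbarK a : tbar (tbar a) = a.
Proof. by apply: tpP => k; rewrite !tbarE opprK conjcK. Qed.
Lemma tbar_cst z : tbar (tcst z) = tcst (z^*)%C.
Proof. by apply: tpP => k; rewrite tbarE !tcstE oppr_eq0; case: ifP; rewrite ?conjc0. Qed.
Lemma tbarM a b : tbar (a * b) = tbar a * tbar b.
Proof.
apply: tpP => k; rewrite tbarE !tpME zsum_opp.
have [n an] := tp_supp a.
rewrite (@zsumE _ n) ?(@zsumE _ n); last first.
- by move=> l ln; rewrite an ?abszN// mul0r.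
- by move=> l ln; rewrite tbarE an ?abszN// conjc0 mul0r.
by rewrite conj_sum; apply: eq_bigr => l _; rewrite rmorphM !tbarE opprD.
Qed.

Definition tD := tmult (fun k => k%:~R).
Definition tpos := tmult (fun k => if 0 <= k then 1 else 0).
Definition tneg := tmult (fun k => if 0 <= k then 0 else 1).
(** The inverse of 0 is 0, so the mean is discarded: [tD] and [tinvD] are inverse to each other up
    to the coefficient at 0. *)
Definition tinvD := tmult (fun k => (k%:~R)^-1).
(** Translation of the function by [x], that is, the group generated by iD. *)
Definition tmod (x : R) := tmult (fun k => cexpi (k%:~R * x)).

Lemma tpos_tneg a : tpos a + tneg a = a.
Proof.
by apply: tpP => k; rewrite tpDE /tpos /tneg !tmultE; case: ifP;
  rewrite ?mul1r ?mul0r ?addr0 ?add0r.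
Qed.

Lemma tposE a k : tpos a k = if 0 <= k then a k else 0.
Proof. by rewrite /tpos tmultE; case: ifP; rewrite ?mul1r ?mul0r. Qed.
Lemma tnegE a k : tneg a k = if 0 <= k then 0 else a k.
Proof. by rewrite /tneg tmultE; case: ifP; rewrite ?mul1r ?mul0r. Qed.

Lemma tDM a b : tD (a * b) = tD a * b + a * tD b.
Proof.
apply: tpP => k; rewrite /tD tpDE !(tmultE, tpME) mulr_zsumr -zsumD; try exact: conv_finsupp.
by apply: eq_zsum => l; rewrite !tmultE rmorphB /=; ring.
Qed.

Lemma tDbar a : tD (tbar a) = - tbar (tD a).
Proof.
apply: tpP => k; rewrite tpNE /tD !(tbarE, tmultE) rmorphM -mulNr; congr (_ * _).
by rewrite rmorph_int mulrNz opprK.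
Qed.

End TrigPolyRing.
#[export] Hint Resolve tcoef_finsupp : core.

(** * Wiener and Sobolev norms *)

Section CauchySchwarz.
Context {R : realType} (I : Type) (r : seq I).
Implicit Types x y : I -> R.

Lemma sum_sqr_ge0 x : 0 <= \sum_(i <- r) x i ^+ 2.
Proof. by apply: sumr_ge0 => i _; rewrite sqr_ge0. Qed.

Lemma cauchy_schwarz_sqr x y :
  (\sum_(i <- r) x i * y i) ^+ 2 <=
  (\sum_(i <- r) x i ^+ 2) * (\sum_(i <- r) y i ^+ 2).
Proof.
set A := \sum_(i <- r) x i ^+ 2; set B := \sum_(i <- r) y i ^+ 2.
set S := \sum_(i <- r) x i * y i.
have A0 : 0 <= A by exact: sum_sqr_ge0.
have B0 : 0 <= B by exact: sum_sqr_ge0.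
have E u v : \sum_(i <- r) (u * x i - v * y i) ^+ 2 =
    u ^+ 2 * A + (- (u * v + u * v)) * S + v ^+ 2 * B.
  rewrite /A /S /B !mulr_sumr -!big_split /=.
  by apply: eq_bigr => i _; ring.
have [B1|] := ltP 0 B.
  (* The quadratic form at [(B, S)] equals [B * (A * B - S ^+ 2)]. The case [0 < A] is symmetric,
     and for [A = B = 0] the pair [(1, S)] gives [0 <= - 2 S^2]. *)
  have := sum_sqr_ge0 (fun i => B * x i - S * y i); rewrite E => h.
  have {h} : 0 <= B * (A * B - S ^+ 2) by lra.
  by rewrite pmulr_rge0// subr_ge0.
move=> B1; have {B0 B1} B0 : B = 0 by apply/eqP; rewrite eq_le B1 B0.
have [A1|] := ltP 0 A.
  have := sum_sqr_ge0 (fun i => S * x i - A * y i); rewrite E => h.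
  have {h} : 0 <= A * (A * B - S ^+ 2) by lra.
  by rewrite pmulr_rge0// subr_ge0.
move=> A1; have {A0 A1} A0 : A = 0 by apply/eqP; rewrite eq_le A1 A0.
have := sum_sqr_ge0 (fun i => 1 * x i - S * y i); rewrite E A0 B0 mulr0.
by have := sqr_ge0 S; lra.
Qed.

Lemma cauchy_schwarz x y :
  \sum_(i <- r) x i * y i <=
  Num.sqrt (\sum_(i <- r) x i ^+ 2) * Num.sqrt (\sum_(i <- r) y i ^+ 2).
Proof.
rewrite -sqrtrM ?sum_sqr_ge0// (le_trans (ler_norm _))//.
by rewrite -sqrtr_sqr ler_wsqrtr// cauchy_schwarz_sqr.
Qed.

Lemma minkowski_sqrt x y :
  Num.sqrt (\sum_(i <- r) (x i + y i) ^+ 2) <=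
  Num.sqrt (\sum_(i <- r) x i ^+ 2) + Num.sqrt (\sum_(i <- r) y i ^+ 2).
Proof.
rewrite -[leRHS]ger0_norm ?addr_ge0 ?sqrtr_ge0// -sqrtr_sqr ler_wsqrtr//.
rewrite sqrrD !sqr_sqrtr ?sum_sqr_ge0//.
under eq_bigr do rewrite sqrrD.
by rewrite !big_split /= lerD2r lerD2l mulr2n lerD ?cauchy_schwarz.
Qed.

End CauchySchwarz.

Fact norm_key : unit. Proof. exact: tt. Qed.

Section SequenceNorms.
Context {R : realType}.
Local Notation tp := (trigpoly R).
Implicit Types a b c : tp.

Lemma finsupp_cmod a : finsupp_int (fun k => cmod (a k)).
Proof. by apply: finsupp_comp (tcoef_finsupp a) => k ->; rewrite cmod0. Qed.

Lemma finsupp_cmod2 a : finsupp_int (fun k => cmod (a k) ^+ 2).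
Proof. by apply: finsupp_comp (tcoef_finsupp a) => k ->; rewrite cmod0 expr0n. Qed.

(* The norms are locked to keep unification from comparing their bodies. *)
Definition wiener a : R :=
  locked_with norm_key (fun a : tp => zsum (fun k => cmod (a k))) a.
Definition ell2 a : R :=
  locked_with norm_key (fun a : tp => Num.sqrt (zsum (fun k => cmod (a k) ^+ 2))) a.

Lemma wiener_zsum a : wiener a = zsum (fun k => cmod (a k)).
Proof. by rewrite /wiener unlock. Qed.

Lemma ell2_zsum a : ell2 a = Num.sqrt (zsum (fun k => cmod (a k) ^+ 2)).
Proof. by rewrite /ell2 unlock. Qed.

Definition sobw (s : R) (k : int) : R := (1 + k%:~R ^+ 2) `^ (s / 2).
Definition sobolev s a : R := ell2 (tmult (fun k => (sobw s k)%:C) a).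

Lemma wienerE n a : supported n a -> wiener a = \sum_(k <- intball n) cmod (a k).
Proof. by move=> an; rewrite wiener_zsum (@zsumE _ n)// => k /an ->; rewrite cmod0. Qed.

Lemma ell2E n a : supported n a ->
  ell2 a = Num.sqrt (\sum_(k <- intball n) cmod (a k) ^+ 2).
Proof.
move=> an; rewrite ell2_zsum (@zsumE _ n)// => k /an ->.
by rewrite cmod0 expr0n.
Qed.

Lemma wiener_ge0 a : 0 <= wiener a.
Proof. by rewrite wiener_zsum; apply: zsum_ge0 => k; exact: cmod_ge0. Qed.

Lemma ell2_ge0 a : 0 <= ell2 a. Proof. by rewrite ell2_zsum sqrtr_ge0. Qed.

Lemma sobolev_ge0 s a : 0 <= sobolev s a. Proof. exact: ell2_ge0. Qed.

Lemma wiener_le a b : (forall k, cmod (a k) <= cmod (b k)) -> wiener a <= wiener b.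
Proof.
by move=> ab; rewrite !wiener_zsum; apply: ler_zsum => //; exact: finsupp_cmod.
Qed.

Lemma ell2_le a b : (forall k, cmod (a k) <= cmod (b k)) -> ell2 a <= ell2 b.
Proof.
move=> ab; rewrite !ell2_zsum; apply: ler_wsqrtr; apply: ler_zsum; try exact: finsupp_cmod2.
by move=> k; rewrite lerXn2r// nnegrE cmod_ge0.
Qed.

Lemma sobw_ge0 s k : 0 <= sobw s k. Proof. exact: powR_ge0. Qed.

Lemma cmod_sobw s k : cmod (sobw s k)%:C = sobw s k.
Proof. by rewrite cmod_real ger0_norm ?sobw_ge0. Qed.

Lemma sobolev_le s a b : (forall k, cmod (a k) <= cmod (b k)) -> sobolev s a <= sobolev s b.
Proof. by move=> ab; apply: ell2_le => k; rewrite !tmultE !cmodM ler_wpM2l ?cmod_ge0. Qed.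

Lemma cmod_le_wiener a k : cmod (a k) <= wiener a.
Proof.
have [n an] := tp_supp a; rewrite (@wienerE (n + `|k|)%N); last by apply: supported_le an; lia.
have kn : k \in intball (n + `|k|)%N by rewrite mem_intball; lia.
rewrite (bigD1_seq k) ?intball_uniq//=.
by rewrite lerDl sumr_ge0// => i _; exact: cmod_ge0.
Qed.

Lemma tp_supp2 a b : exists2 n, supported n a & supported n b.
Proof. exact: finsupp_int2. Qed.

Lemma supportedD a b n : supported n a -> supported n b -> supported n (a + b).
Proof. by move=> an bn k kn; rewrite tpDE an// bn// addr0. Qed.

Lemma supportedN a n : supported n a -> supported n (- a).
Proof. by move=> an k kn; rewrite tpNE an// oppr0. Qed.

Lemma supported_mult m a n : supported n a -> supported n (tmult m a).
Proof. by move=> an k kn; rewrite tmultE an// mulr0. Qed.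

Lemma supported_bar a n : supported n a -> supported n (tbar a).
Proof. by move=> an k kn; rewrite tbarE an ?abszN// conjc0. Qed.

Lemma wienerD a b : wiener (a + b) <= wiener a + wiener b.
Proof.
have [n an bn] := tp_supp2 a b.
rewrite (wienerE (supportedD an bn)) (wienerE an) (wienerE bn) -big_split /=.
by apply: ler_sum => k _; exact: cmodD.
Qed.

Lemma ell2D a b : ell2 (a + b) <= ell2 a + ell2 b.
Proof.
have [n an bn] := tp_supp2 a b.
rewrite (ell2E (supportedD an bn)) (ell2E an) (ell2E bn).
apply: le_trans (minkowski_sqrt _ _ _); apply: ler_wsqrtr; apply: ler_sum => k _.
by rewrite lerXn2r ?nnegrE ?addr_ge0 ?cmod_ge0 ?cmodD.
Qed.

Lemma sobolevD s a b : sobolev s (a + b) <= sobolev s a + sobolev s b.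
Proof. by rewrite /sobolev tmultD ell2D. Qed.

Lemma wienerZ z a : wiener (tcst z * a) = cmod z * wiener a.
Proof.
by rewrite !wiener_zsum mulr_zsumr; apply: eq_zsum => k; rewrite tcstME cmodM.
Qed.

Lemma ell2Z z a : ell2 (tcst z * a) = cmod z * ell2 a.
Proof.
rewrite -[in RHS](ger0_norm (cmod_ge0 z)) !ell2_zsum -sqrtr_sqr -sqrtrM ?sqr_ge0// mulr_zsumr.
by congr Num.sqrt; apply: eq_zsum => k; rewrite tcstME cmodM exprMn.
Qed.

Lemma sobolevZ s z a : sobolev s (tcst z * a) = cmod z * sobolev s a.
Proof. by rewrite /sobolev tmultZ ell2Z. Qed.

Lemma tmono_finsupp (j : int) : finsupp_int (fun k => if k == j then 1 : R[i] else 0).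
Proof. by exists `|j|%N => k; case: eqP => // ->; rewrite ltnn. Qed.
Definition tmono j : tp := Trigpoly (tmono_finsupp j).

Lemma tmonoME j a k : (tmono j * a) k = a (k - j).
Proof.
rewrite tpME (@zsum_delta _ j) /= ?eqxx ?mul1r// => l /negPf ->.
by rewrite mul0r.
Qed.

(** A product is a superposition of frequency shifts of one factor, and shifts preserve the Wiener
    and [ell2] norms. Young's inequality and submultiplicativity then reduce to the triangle
    inequality. *)
Lemma tp_mulE n a b : supported n a ->
  a * b = \sum_(l <- intball n) tcst (a l) * (tmono l * b).
Proof.
move=> an; apply: tpP => k; rewrite tpME tp_sumE (@zsumE _ n).
  by apply: eq_bigr => l _; rewrite tcstME tmonoME.
by move=> l ln; rewrite an// mul0r.
Qed.

Lemma wiener_mono j a : wiener (tmono j * a) = wiener a.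
Proof.
rewrite !wiener_zsum [RHS](zsum_shift (- j)); apply: eq_zsum => k.
by rewrite tmonoME.
Qed.

Lemma ell2_mono j a : ell2 (tmono j * a) = ell2 a.
Proof.
rewrite !ell2_zsum; congr Num.sqrt; rewrite [RHS](zsum_shift (- j)); apply: eq_zsum => k.
by rewrite tmonoME.
Qed.

Lemma ell2_0 : ell2 0 = 0.
Proof. by rewrite -(mul0r (0 : tp)) -tcst0 ell2Z cmod0 mul0r. Qed.

Lemma wiener0 : wiener 0 = 0.
Proof. by rewrite -(mul0r (0 : tp)) -tcst0 wienerZ cmod0 mul0r. Qed.

Lemma young a b : ell2 (a * b) <= wiener a * ell2 b.
Proof.
have [n an] := tp_supp a; rewrite (tp_mulE _ an) (wienerE an) mulr_suml.
elim/big_rec2: _ => [|l y x _ h]; first by rewrite ell2_0.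
by rewrite (le_trans (ell2D _ _))// lerD// ell2Z ell2_mono.
Qed.

Lemma wienerM a b : wiener (a * b) <= wiener a * wiener b.
Proof.
have [n an] := tp_supp a; rewrite (tp_mulE _ an) (wienerE an) mulr_suml.
elim/big_rec2: _ => [|l y x _ h]; first by rewrite wiener0.
by rewrite (le_trans (wienerD _ _))// lerD// wienerZ wiener_mono.
Qed.

Lemma tabs_finsupp a : finsupp_int (fun k => (cmod (a k))%:C).
Proof. by apply: finsupp_comp (tcoef_finsupp a) => k ->; rewrite cmod0. Qed.
(** Passing to the moduli of the coefficients lets a pointwise inequality between weights be carried
    through a convolution. *)
Definition tabs a : tp := Trigpoly (tabs_finsupp a).

Lemma cmod_tabs a k : cmod (tabs a k) = cmod (a k).
Proof. by rewrite cmod_real ger0_norm ?cmod_ge0. Qed.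

Lemma wiener_tabs a : wiener (tabs a) = wiener a.
Proof. by rewrite !wiener_zsum; apply: eq_zsum => k; rewrite cmod_tabs. Qed.

Lemma ell2_tabs a : ell2 (tabs a) = ell2 a.
Proof.
by rewrite !ell2_zsum; congr Num.sqrt; apply: eq_zsum => k; rewrite cmod_tabs.
Qed.

Lemma tabsM a b k :
  (tabs a * tabs b) k = (zsum (fun l => cmod (a l) * cmod (b (k - l))))%:C.
Proof.
have [n an] := tp_supp a.
rewrite tpME (@zsumE _ n) ?(@zsumE _ n); last first.
- by move=> l /an; rewrite /= => ->; rewrite cmod0 mul0r.
- by move=> l /an; rewrite /= => ->; rewrite cmod0 mul0r.
by rewrite rmorph_sum; apply: eq_bigr => l _; rewrite rmorphM.
Qed.

(** With k = l + (k - l), the square [(x + y)^2] is at most 4 times the larger of [x^2] and [y^2];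
    the power s/2 turns 4 into [2 ^ s]. *)
Lemma sobw_le s (k l : int) : 0 <= s ->
  sobw s k <= 2 `^ s * (sobw s l + sobw s (k - l)).
Proof.
move=> s0; set x : R := l%:~R; set y : R := (k - l)%:~R.
have kE : k%:~R = x + y by rewrite /x /y -intrD addrC subrK.
rewrite /sobw -/x -/y kE.
have s2 : 0 <= s / 2 by rewrite divr_ge0.
have p0 (z : R) : 0 <= (1 + z ^+ 2) `^ (s / 2) by exact: powR_ge0.
have four : 2 `^ s = 4 `^ (s / 2) :> R.
  rewrite (_ : 4 = 2 `^ 2) -?powRrM; first by congr (_ `^ _); field.
  by rewrite powR_mulrn// -natrX.
have [xy|xy] := leP (x ^+ 2) (y ^+ 2).
- apply: (@le_trans _ _ (2 `^ s * (1 + y ^+ 2) `^ (s / 2))); last first.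
    by rewrite ler_wpM2l ?powR_ge0// lerDr.
  rewrite four -powRM//; last by rewrite addr_ge0// sqr_ge0.
  rewrite ge0_ler_powR ?nnegrE//; [nra|nra|].
  by have := sqr_ge0 (x - y); rewrite sqrrB sqrrD; lra.
- apply: (@le_trans _ _ (2 `^ s * (1 + x ^+ 2) `^ (s / 2))); last first.
    by rewrite ler_wpM2l ?powR_ge0// lerDl.
  rewrite four -powRM//; last by rewrite addr_ge0// sqr_ge0.
  rewrite ge0_ler_powR ?nnegrE//; [nra|nra|].
  by have := sqr_ge0 (x - y); rewrite sqrrB sqrrD; lra.
Qed.

(** The weight at [k] is distributed over the two factors by [sobw_le]. In each resulting
    convolution of moduli, Young's inequality puts the weighted factor in [ell2] and the other one
    in the Wiener norm. *)
Lemma sobolevM s a b : 0 <= s ->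
  sobolev s (a * b) <= 2 `^ s * (wiener a * sobolev s b + sobolev s a * wiener b).
Proof.
move=> s0; pose w := tmult (fun k => (sobw s k)%:C).
have K0 : 0 <= 2 `^ s :> R by exact: powR_ge0.
have -> : wiener a * sobolev s b + sobolev s a * wiener b =
  wiener (tabs a) * ell2 (tabs (w b)) + wiener (tabs b) * ell2 (tabs (w a)).
  by rewrite !wiener_tabs !ell2_tabs [wiener b * _]mulrC.
apply: (@le_trans _ _ (ell2 (tcst (2 `^ s)%:C *
    (tabs a * tabs (w b) + tabs (w a) * tabs b)))); last first.
  rewrite ell2Z cmod_real ger0_norm// ler_wpM2l//.
  by rewrite (le_trans (ell2D _ _))// [tabs (w a) * _]mulrC lerD// young.
apply: ell2_le => k; rewrite tmultE tcstME tpDE !tabsM -rmorphD -rmorphM.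
rewrite cmodM cmod_sobw cmod_real [leRHS]ger0_norm; last first.
  by rewrite mulr_ge0// addr_ge0// zsum_ge0// => l; rewrite mulr_ge0 ?cmod_ge0.
have fr (f : int -> R[i]) (g : int -> R) : finsupp_int f ->
    finsupp_int (fun l => cmod (f l) * g l).
  by move=> ff; apply: finsupp_comp ff => l ->; rewrite cmod0 mul0r.
rewrite -zsumD; try exact: fr.
apply: (@le_trans _ _ (sobw s k * zsum (fun l => cmod (a l) * cmod (b (k - l))))).
  rewrite ler_wpM2l ?sobw_ge0// tpME.
  apply: le_trans (cmod_zsum (conv_finsupp _ _)) _.
  apply: ler_zsum; first by apply: finsupp_comp (conv_finsupp a (fun l => b (k - l))) =>
    l ->; rewrite cmod0.
    exact: fr.
  by move=> l; rewrite cmodM.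
rewrite !mulr_zsumr; apply: ler_zsum.
- by apply: finsupp_comp (finsupp_cmod a) => l ->; rewrite mul0r mulr0.
- apply: finsupp_comp (tcoef_finsupp a) => l al.
  by rewrite !tmultE al !(mulr0, cmod0, mul0r, addr0).
move=> l; rewrite !tmultE !cmodM !cmod_sobw.
have h := sobw_le k l s0.
have ab0 : 0 <= cmod (a l) * cmod (b (k - l)) by rewrite mulr_ge0 ?cmod_ge0.
by have := ler_wpM2r ab0 h; rewrite -!mulrA; lra.
Qed.

Lemma wiener_bar a : wiener (tbar a) = wiener a.
Proof.
rewrite !wiener_zsum [RHS]zsum_opp; apply: eq_zsum => k.
by rewrite tbarE cmod_conj.
Qed.

Lemma sobolev_bar s a : sobolev s (tbar a) = sobolev s a.
Proof.
rewrite /sobolev !ell2_zsum; congr Num.sqrt; rewrite [RHS]zsum_opp; apply: eq_zsum => k.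
by rewrite !tmultE !cmodM !cmod_sobw tbarE cmod_conj /sobw mulrNz sqrrN.
Qed.

Lemma wiener_mult_le m a : (forall k, cmod (m k) <= 1) -> wiener (tmult m a) <= wiener a.
Proof.
move=> m1; apply: wiener_le => k; rewrite tmultE cmodM.
by rewrite -[leRHS]mul1r ler_wpM2r ?cmod_ge0.
Qed.

Lemma sobolev_mult_le s m a : (forall k, cmod (m k) <= 1) ->
  sobolev s (tmult m a) <= sobolev s a.
Proof.
move=> m1; apply: sobolev_le => k; rewrite tmultE cmodM.
by rewrite -[leRHS]mul1r ler_wpM2r ?cmod_ge0.
Qed.

Lemma cmod_pos_mult k : cmod (if 0 <= k :> int then 1 else 0 : R[i]) <= 1.
Proof. by case: ifP; rewrite ?cmod1 ?cmod0. Qed.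
Lemma cmod_neg_mult k : cmod (if 0 <= k :> int then 0 else 1 : R[i]) <= 1.
Proof. by case: ifP; rewrite ?cmod1 ?cmod0. Qed.
Lemma cmod_invD_mult (k : int) : cmod ((k%:~R)^-1 : R[i]) <= 1.
Proof.
have [->|k0] := eqVneq k 0; first by rewrite invr0 cmod0.
rewrite ComplexField.Normc.normcV.
have -> : k%:~R = (k%:~R : R)%:C by rewrite rmorph_int.
rewrite cmod_real invf_le1 ?normr_gt0 ?intr_eq0//.
by rewrite -intr_norm (ler_int R 1); lia.
Qed.
Lemma cmod_tmod_mult (x : R) (k : int) : cmod (cexpi (k%:~R * x)) <= 1.
Proof. by rewrite cmod_cexpi. Qed.

(** The interface of all later estimates, met by [hankel_norm] and by [wiener + lam * sobolev]. In a
    product only one factor is measured by [X], so growth rates depend on Wiener norms alone.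
    Conjugation and translation carry no constant: applied back and forth, they are isometries. *)
Record tame (K : R) (X : tp -> R) : Prop := Tame {
  tame_K : 1 <= K;
  tame_ge0 : forall a, 0 <= X a;
  tameD : forall a b, X (a + b) <= X a + X b;
  tameZ : forall z a, X (tcst z * a) <= cmod z * X a;
  tameM : forall a b, X (a * b) <= K * (wiener a * X b + X a * wiener b);
  tame_bar : forall a, X (tbar a) <= X a;
  tame_pos : forall a, X (tpos a) <= K * X a;
  tame_neg : forall a, X (tneg a) <= K * X a;
  tame_invD : forall a, X (tinvD a) <= K * X a;
  tame_mod : forall x a, X (tmod x a) <= X a;
  tame_wiener : forall a, wiener a <= K * X a }.

(** The two summands satisfy the product and multiplier estimates separately, so [lam] does not
    enter the constant. The Wiener norm is a summand in order that [tame_wiener] hold however small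
    [lam] is. *)
Lemma tame_wiener_sobolev (s lam : R) : 0 <= s -> 0 <= lam ->
  tame (2 `^ s) (fun a => wiener a + lam * sobolev s a).
Proof.
move=> s0 l0.
have K1 : 1 <= 2 `^ s :> R.
  by rewrite -[leLHS](powRr0 2) ler_powR// ler1n.
have K0 : 0 <= 2 `^ s :> R by exact: le_trans K1.
have X0 a : 0 <= wiener a + lam * sobolev s a.
  by rewrite addr_ge0 ?wiener_ge0// mulr_ge0// sobolev_ge0.
have XK a b : wiener b + lam * sobolev s b <= wiener a + lam * sobolev s a ->
    wiener b + lam * sobolev s b <= 2 `^ s * (wiener a + lam * sobolev s a).
  by move/le_trans; apply; rewrite ler_peMl.
have mult m a : (forall k, cmod (m k) <= 1) ->
    wiener (tmult m a) + lam * sobolev s (tmult m a) <= wiener a + lam * sobolev s a.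
  by move=> m1; rewrite lerD ?wiener_mult_le// ler_wpM2l// sobolev_mult_le.
split => //.
- move=> a b; rewrite addrACA -mulrDr lerD ?wienerD// ler_wpM2l//.
  exact: sobolevD.
- by move=> z a; rewrite wienerZ sobolevZ mulrDr [lam * (_ * _)]mulrCA.
- move=> a b.
  have := wienerM a b; have := sobolevM a b s0.
  have := wiener_ge0 a; have := wiener_ge0 b.
  set A := wiener a; set B := wiener b; set S := sobolev s a; set T := sobolev s b.
  move=> B0 A0 h1 h2.
  have AB0 : 0 <= A * B by rewrite mulr_ge0.
  have h3 := ler_wpM2l l0 h1.
  have h4 : A * B <= 2 `^ s * (A * B) by rewrite ler_peMl.
  rewrite (_ : 2 `^ s * _ = 2 `^ s * (A * B) + 2 `^ s * (A * B) +
    lam * (2 `^ s * (A * T + S * B))); last by ring.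
  by lra.
- by move=> a; rewrite wiener_bar sobolev_bar.
- by move=> a; apply: XK; apply: mult => k; exact: cmod_pos_mult.
- by move=> a; apply: XK; apply: mult => k; exact: cmod_neg_mult.
- by move=> a; apply: XK; apply: mult => k; exact: cmod_invD_mult.
- by move=> x a; apply: mult => k; exact: cmod_tmod_mult.
- move=> a; apply: le_trans (ler_peMl (X0 a) K1).
  by rewrite lerDl mulr_ge0// sobolev_ge0.
Qed.

End SequenceNorms.

(** * Trace norms of Hankel matrices *)

Section Contractions.
Context {R : realType}.
Local Notation C := R[i].

Definition sqnorm m (x : 'cV[C]_m) : R := \sum_i cmod (x i 0) ^+ 2.

Definition opnorm_le m n (c : R) (A : 'M[C]_(m, n)) : Prop :=
  forall x, sqnorm (A *m x) <= c ^+ 2 * sqnorm x.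

Lemma sqnorm_ge0 m (x : 'cV[C]_m) : 0 <= sqnorm x.
Proof. by apply: sumr_ge0 => j _; rewrite sqr_ge0. Qed.

Lemma opnorm_leM m n p c d (A : 'M[C]_(m, n)) (B : 'M[C]_(n, p)) :
  opnorm_le c A -> opnorm_le d B -> opnorm_le (c * d) (A *m B).
Proof.
move=> Ac Bd x; rewrite -mulmxA (le_trans (Ac _))// exprMn -[leRHS]mulrA.
by rewrite ler_wpM2l ?sqr_ge0.
Qed.

Lemma sqnormZ m (z : C) (x : 'cV[C]_m) : sqnorm (z *: x) = cmod z ^+ 2 * sqnorm x.
Proof. by rewrite /sqnorm mulr_sumr; apply: eq_bigr => j _; rewrite mxE cmodM exprMn. Qed.

Lemma opnorm_leZ m n c z (A : 'M[C]_(m, n)) :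
  opnorm_le c A -> opnorm_le (cmod z * c) (z *: A).
Proof.
move=> Ac x; rewrite -scalemxAl sqnormZ exprMn -[leRHS]mulrA.
by rewrite ler_wpM2l ?sqr_ge0.
Qed.

Lemma opnorm_le_trans m n c d (A : 'M[C]_(m, n)) :
  0 <= c -> c <= d -> opnorm_le c A -> opnorm_le d A.
Proof.
move=> c0 cd Ac x; rewrite (le_trans (Ac x))// ler_wpM2r ?sqnorm_ge0//.
by rewrite lerXn2r// nnegrE (le_trans c0).
Qed.

(** Cauchy-Schwarz in each row with weights [cmod (A j k)]: the row sums give one factor [c], and
    the column sums, after exchanging summations, give the other. *)
Lemma schur_test m n c (A : 'M[C]_(m, n)) : 0 <= c ->
  (forall j, \sum_k cmod (A j k) <= c) -> (forall k, \sum_j cmod (A j k) <= c) ->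
  opnorm_le c A.
Proof.
move=> c0 Ar Ac x; rewrite /sqnorm.
have row j : cmod ((A *m x) j 0) ^+ 2 <= c * \sum_k cmod (A j k) * cmod (x k 0) ^+ 2.
  rewrite mxE; apply: (@le_trans _ _ ((\sum_k cmod (A j k) * cmod (x k 0)) ^+ 2)).
    rewrite lerXn2r// ?nnegrE ?cmod_ge0//.
      by apply: sumr_ge0 => k _; rewrite mulr_ge0 ?cmod_ge0.
    by rewrite (le_trans (cmod_sum _ _ _))// ler_sum// => k _; rewrite cmodM.
  have := cauchy_schwarz_sqr (index_enum 'I_n) (fun k => Num.sqrt (cmod (A j k)))
    (fun k => Num.sqrt (cmod (A j k)) * cmod (x k 0)).
  under eq_bigr do rewrite mulrA -expr2 sqr_sqrtr ?cmod_ge0//.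
  under [in X in _ <= X -> _]eq_bigr do rewrite sqr_sqrtr ?cmod_ge0//.
  move=> /le_trans; apply.
  under [in X in _ * X]eq_bigr do rewrite exprMn sqr_sqrtr ?cmod_ge0//.
  rewrite ler_wpM2r//; apply: sumr_ge0 => k _.
  by rewrite mulr_ge0 ?cmod_ge0// sqr_ge0.
apply: (le_trans (ler_sum _ (fun j _ => row j))).
rewrite -mulr_sumr exchange_big /= expr2 -mulrA ler_wpM2l// mulr_sumr.
apply: ler_sum => k _; rewrite -mulr_suml ler_wpM2r ?sqr_ge0//.
Qed.

Lemma opnorm_le1_entry m n (K : 'M[C]_(m, n)) k :
  opnorm_le 1 K -> \sum_j cmod (K j k) ^+ 2 <= 1.
Proof.
move=> /(_ (delta_mx k 0)); rewrite -colE expr1n mul1r.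
have -> : sqnorm (delta_mx k 0) = 1.
  rewrite /sqnorm (bigD1 k)//= mxE !eqxx cmod1 expr1n big1 ?addr0// => j jk.
  by rewrite mxE (negPf jk) cmod0 expr0n.
by rewrite /sqnorm; under eq_bigr do rewrite mxE.
Qed.

Lemma sqnorm_col_mx m n (x : 'cV[C]_m) (y : 'cV[C]_n) :
  sqnorm (col_mx x y) = sqnorm x + sqnorm y.
Proof.
rewrite /sqnorm big_split_ord /=; congr (_ + _); apply: eq_bigr => j _.
  by rewrite col_mxEu.
by rewrite col_mxEd.
Qed.

Lemma opnorm_le1_pad m d (K : 'M[C]_m) :
  opnorm_le 1 K -> opnorm_le 1 (block_mx K 0 0 (0 : 'M[C]_d)).
Proof.
move=> K1 x; rewrite -(vsubmxK x) mul_block_col !mul0mx !addr0 !sqnorm_col_mx.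
have := K1 (usubmx x); rewrite !expr1n !mul1r.
have -> : sqnorm (0 : 'cV[C]_d) = 0.
  by rewrite /sqnorm big1// => j _; rewrite mxE cmod0 expr0n.
by rewrite addr0 => /le_trans; apply; rewrite lerDl sqnorm_ge0.
Qed.

Lemma opnorm_le0_eq0 m n (A : 'M[C]_(m, n)) : opnorm_le 0 A -> A = 0.
Proof.
move=> A0; apply/matrixP => j k; rewrite mxE.
have := A0 (delta_mx k 0); rewrite -colE expr0n mul0r /sqnorm => h.
apply: cmod_eq0; apply/eqP; rewrite -sqrf_eq0.
have e0 i' : 0 <= cmod (col k A i' 0) ^+ 2 by rewrite sqr_ge0.
rewrite eq_le sqr_ge0 andbT; apply: le_trans h.
by rewrite (bigD1 j)//= mxE lerDl sumr_ge0.
Qed.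

Definition skew_adjoint m (A : 'M[C]_m) := forall j k, A j k = - ((A k j)^*)%C.

(** The cross term Re <x, A x> vanishes, so the squared length changes only by [h^2 |A x|^2]. This
    is the infinitesimal form of the unitarity of exp(hA). *)
Lemma skew_opnorm m (c h : R) (A : 'M[C]_m) : skew_adjoint A -> opnorm_le c A ->
  opnorm_le (1 + h ^+ 2 * c ^+ 2) (1%:M + h%:C *: A).
Proof.
move=> skA Ac x; rewrite mulmxDl mul1mx -scalemxAl.
set y := A *m x.
have cross : \sum_j complex.Re (((x j 0)^*)%C * y j 0) = 0.
  pose S := \sum_j ((x j 0)^*)%C * y j 0.
  have SE : S = \sum_j \sum_k ((x j 0)^*)%C * (A j k * x k 0).
    by apply: eq_bigr => j _; rewrite mxE mulr_sumr.
  have Sc : (S^*)%C = - S.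
    rewrite SE [in LHS]exchange_big conj_sum -sumrN; apply: eq_bigr => j _.
    rewrite conj_sum -sumrN; apply: eq_bigr => k _.
    by rewrite skA !(rmorphM, rmorphN) /= !conjcK; ring.
  have -> : \sum_j complex.Re (((x j 0)^*)%C * y j 0) = complex.Re S.
    by rewrite (raddf_sum (@complex.Re R : Rcomplex R -> R)).
  by case: S Sc {SE} => u v /= [] /eqP; rewrite -subr_eq0 opprK -mulr2n mulrn_eq0 => /eqP.
have E : sqnorm (x + h%:C *: y) = sqnorm x + h ^+ 2 * sqnorm y.
  transitivity (\sum_j (cmod (x j 0) ^+ 2 + h ^+ 2 * cmod (y j 0) ^+ 2 +
      (h *+ 2) * complex.Re (((x j 0)^*)%C * y j 0))).
    apply: eq_bigr => j _; rewrite 2!mxE !sqr_cmod.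
    by case: (x j 0) => a b; case: (y j 0) => d e /=; ring.
  by rewrite !big_split /= -!mulr_sumr cross mulr0 addr0.
rewrite E.
have := Ac x; rewrite -/y => hy; have h2 := sqr_ge0 h.
have hc : 0 <= h ^+ 2 * c ^+ 2 by rewrite mulr_ge0 ?sqr_ge0.
have := ler_wpM2l h2 hy; have := sqnorm_ge0 x.
set u := h ^+ 2 * c ^+ 2 in hc *; rewrite mulrA -/u => x0 h3.
have : 0 <= u * sqnorm x by rewrite mulr_ge0.
have : 0 <= u ^+ 2 * sqnorm x by rewrite mulr_ge0 ?sqr_ge0.
by rewrite sqrrD expr1n mul1r mulr2n; lra.
Qed.

End Contractions.

Section NuclearNorm.
Context {R : realType}.
Local Notation C := R[i].
Local Notation tp := (trigpoly R).
Implicit Types a b : tp.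

Definition hankel (f : int -> C) m : 'M[C]_m := \matrix_(j, k) f (j%:Z + k%:Z).
Definition toeplitz (f : int -> C) m : 'M[C]_m := \matrix_(j, k) f (j%:Z - k%:Z).

(** The trace norm of the infinite Hankel matrix by duality: its finite corners are paired with
    contractions. *)
Definition nuclear_set a : set R :=
  [set y | exists m (K : 'M[C]_m), opnorm_le 1 K /\ y = cmod (\tr (K *m hankel a m))].

Definition nuclear a : R := locked_with norm_key (fun a => sup (nuclear_set a)) a.

Lemma nuclear_sup a : nuclear a = sup (nuclear_set a).
Proof. by rewrite /nuclear unlock. Qed.

Lemma trK_hankel m (K : 'M[C]_m) a :
  \tr (K *m hankel a m) = \sum_j \sum_k K k j * a (j%:Z + k%:Z).
Proof.
rewrite /mxtrace exchange_big /=; apply: eq_bigr => k _; rewrite mxE.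
by apply: eq_bigr => j _; rewrite mxE addrC.
Qed.

Lemma opnorm_le1_0 m : opnorm_le 1 (0 : 'M[C]_m).
Proof.
move=> x; rewrite mul0mx expr1n mul1r (le_trans _ (sqnorm_ge0 x))//.
by rewrite /sqnorm big1// => j _; rewrite mxE cmod0 expr0n.
Qed.

Lemma nuclear_set_neq0 a : nuclear_set a !=set0.
Proof. by exists (cmod (\tr ((0 : 'M[C]_0) *m hankel a 0))), 0, 0; split => //;
  exact: opnorm_le1_0. Qed.

Lemma sum_le_zsum (g : int -> R) m (j : int) : finsupp_int g -> (forall l, 0 <= g l) ->
  \sum_(k < m) g (j + k%:Z) <= zsum g.
Proof.
move=> [n gn] g0; rewrite (zsum_shift j) (@zsumE _ (n + m + `|j|)%N); last first.
  by move=> k kn; apply: gn; lia.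
rewrite -(big_mkord xpredT (fun k => g (j + k%:Z))) /index_iota subn0.
rewrite -(big_map (fun k : nat => k%:Z) xpredT (fun l => g (j + l))).
set u := [seq _ | _ <- _]; set v := intball _.
rewrite [leRHS](bigID (mem u)) /= -[leLHS]addr0 lerD ?sumr_ge0//.
rewrite le_eqVlt; apply/orP; left; apply/eqP; rewrite -[RHS]big_filter.
under [RHS]eq_bigr do rewrite addrC.
apply: perm_big; apply: uniq_perm.
- by rewrite map_inj_uniq ?iota_uniq// => ? ?; lia.
- by rewrite filter_uniq// intball_uniq.
move=> l; rewrite mem_filter; apply/idP/andP => [lu|[]//]; split => //.
by move: lu => /mapP[k]; rewrite mem_iota mem_intball => /andP[_ km] ->; lia.
Qed.

(* The row of index j of the Hankel matrix has norm at most (1+j^2)^(-s/2) ||a||_s,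
   which is summable exactly when s > 1. *)
Lemma hankel_test_le s m (K : 'M[C]_m) a : 0 <= s -> opnorm_le 1 K ->
  cmod (\tr (K *m hankel a m)) <=
  (\sum_(j < m) (sobw s j%:Z)^-1) * sobolev s a.
Proof.
move=> s0 K1; rewrite trK_hankel (le_trans (cmod_sum _ _ _))// mulr_suml.
apply: ler_sum => j _; rewrite (le_trans (cmod_sum _ _ _))//.
under eq_bigr do rewrite cmodM.
rewrite (le_trans (cauchy_schwarz _ _ _))//.
rewrite -[leRHS]mul1r ler_pM ?sqrtr_ge0//.
  by rewrite -sqrtr1 ler_wsqrtr// opnorm_le1_entry.
have w0 : 0 < sobw s j%:Z by rewrite /sobw powR_gt0// ltr_wpDr ?sqr_ge0.
rewrite ler_pdivlMl// /sobolev ell2_zsum.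
have -> : sobw s j%:Z = Num.sqrt (sobw s j%:Z ^+ 2) by rewrite sqrtr_sqr ger0_norm// ltW.
rewrite -sqrtrM ?sqr_ge0// ler_wsqrtr// mulr_sumr.
apply: (@le_trans _ _ (\sum_(k < m) cmod (tmult (fun k => (sobw s k)%:C) a (j%:Z + k%:Z)) ^+ 2)).
  apply: ler_sum => k _; rewrite tmultE cmodM exprMn ler_wpM2r ?sqr_ge0// lerXn2r ?nnegrE
    ?sobw_ge0 ?cmod_ge0//.
  rewrite cmod_sobw ge0_ler_powR ?nnegrE ?divr_ge0//; try by rewrite addr_ge0// sqr_ge0.
  rewrite lerD2l lerXn2r ?nnegrE ?ler0z ?ler_int//; lia.
pose g l := cmod (tmult (fun k => (sobw s k)%:C) a l) ^+ 2.
apply: (@sum_le_zsum g m j%:Z); first exact: finsupp_cmod2.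
by move=> l; rewrite sqr_ge0.
Qed.

(** Comparison of a sum of [y^(- sigma - 1)] with an integral, in telescoping form:
    [ln (y / x) = - ln (1 - 1 / y) >= 1 / y], whence [(y / x)^sigma >= 1 + sigma / y]. *)
Lemma powR_telescope (sigma x : R) : 0 < sigma -> 0 < x ->
  sigma * ((x + 1) `^ (sigma + 1))^-1 <= (x `^ sigma)^-1 - ((x + 1) `^ sigma)^-1.
Proof.
move=> s0 x0; set y := x + 1; have y0 : 0 < y by rewrite addr_gt0.
have xy0 : 0 < x / y by rewrite divr_gt0.
have h1 : 1 + sigma / y <= (y / x) `^ sigma.
  rewrite /powR gt_eqF ?divr_gt0// (le_trans _ (expR_ge1Dx _))// lerD2l ler_pM2l//.
  rewrite -[y / x]invf_div lnV ?posrE// lerNr.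
  have := @le_ln1Dx R (- y^-1); rewrite (_ : 1 + - y^-1 = x / y).
    by apply; rewrite ltrN2 invf_lt1// /y; lra.
  by rewrite /y; field; lra.
have yp : 0 < y `^ sigma by rewrite powR_gt0.
have xp : 0 < x `^ sigma by rewrite powR_gt0.
have E : (x `^ sigma)^-1 = (y / x) `^ sigma / y `^ sigma.
  have -> : y `^ sigma = (y / x) `^ sigma * x `^ sigma.
    by rewrite -powRM ?divr_ge0 ?ltW// divfK// gt_eqF.
  by rewrite invfM mulrA mulfV ?mul1r// gt_eqF// powR_gt0// divr_gt0.
rewrite E -[X in _ - X]mul1r -mulrBl powRD; last by apply/implyP => _; rewrite gt_eqF.
rewrite powRr1 ?(ltW y0)// (_ : sigma * _ = sigma / y * (y `^ sigma)^-1); last first.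
  by rewrite invfM; ring.
by rewrite ler_pM2r ?invr_gt0//; lra.
Qed.

Lemma sum_inv_sobw_le (s : R) : 1 < s ->
  exists2 c, 0 < c & forall m, \sum_(j < m) (sobw s j%:Z)^-1 <= c.
Proof.
move=> s1; set sg := s - 1; have sg0 : 0 < sg by rewrite subr_gt0.
(* The factor [2 ^ (s / 2)] pays for [(j + 1)^2 <= 2 (1 + j^2)], and [1 / sg] comes from the
   telescoping bound; the 1 added to [d] is the term [j = 0]. *)
set d := 2 `^ (s / 2) / sg.
have d0 : 0 < d by rewrite divr_gt0// powR_gt0.
exists (1 + d); first by rewrite addr_gt0.
have w0 (j : nat) : 0 <= (sobw s j%:Z)^-1 by rewrite invr_ge0 sobw_ge0.
have main m : \sum_(j < m.+1) (sobw s j%:Z)^-1 <= 1 + d * (1 - (m.+1%:R `^ sg)^-1).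
  elim: m => [|m IH].
    rewrite big_ord_recl big_ord0 powR1 invr1 subrr mulr0 !addr0.
    by rewrite /sobw expr0n addr0 powR1 invr1.
  rewrite big_ord_recr /=.
  have h := powR_telescope sg0 (ltr0Sn R m).
  suff {IH} : (sobw s m.+1%:Z)^-1 <= d * (sg * ((m.+1%:R + 1) `^ (sg + 1))^-1).
    have := ler_wpM2l (ltW d0) h; rewrite -natr1 in IH *.
    by rewrite -[m.+2%:R]natr1 -[in X in _ -> _ -> _ <= X]natr1; lra.
  rewrite /d mulrA divfK ?gt_eqF// subrK.
  have p0 : 0 < (m.+1%:R + 1 : R) by rewrite addr_gt0.
  have w1 : 0 < sobw s m.+1 by rewrite /sobw powR_gt0// ltr_wpDr ?sqr_ge0.
  rewrite -invf_div lef_pV2 ?posrE ?divr_gt0 ?powR_gt0//.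
  rewrite ler_pdivrMr ?powR_gt0// /sobw -powRM ?addr_ge0 ?sqr_ge0//.
  have -> : s = 2 * (s / 2) by field.
  rewrite powRrM powR_mulrn ?(ltW p0)// (_ : 2 * (s / 2) / 2 = s / 2); last by field.
  apply: ge0_ler_powR; rewrite ?nnegrE.
  - by rewrite divr_ge0// ltW// (lt_trans _ s1).
  - exact: sqr_ge0.
  - by rewrite mulr_ge0// addr_ge0// sqr_ge0.
  - by have := sqr_ge0 (m.+1%:R - 1 : R); rewrite -[(m.+1%:~R : R)]/(m.+1%:R : R); nra.
case=> [|m]; first by rewrite big_ord0 addr_ge0// ltW.
rewrite (le_trans (main m))// lerD2l -[leRHS]mulr1 ler_wpM2l ?(ltW d0)//.
Qed.

Lemma tr_pad m d (K : 'M[C]_m) a :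
  \tr (block_mx K 0 0 (0 : 'M[C]_d) *m hankel a (m + d)) = \tr (K *m hankel a m).
Proof.
rewrite -[hankel a (m + d)]submxK mulmx_block mxtrace_block !mul0mx !addr0 mxtrace0 addr0.
by congr (\tr (_ *m _)); apply/matrixP => j k; rewrite !mxE.
Qed.

(* K is padded with zeros. *)
Lemma nuclear_test a c m0 :
  (forall m (K : 'M[C]_m), (m0 <= m)%N -> opnorm_le 1 K ->
     cmod (\tr (K *m hankel a m)) <= c) ->
  forall m (K : 'M[C]_m), opnorm_le 1 K -> cmod (\tr (K *m hankel a m)) <= c.
Proof.
move=> H m K K1; rewrite -(tr_pad m0); apply: H; first exact: leq_addl.
exact: opnorm_le1_pad.
Qed.

(** This gives the supremum [nuclear] its meaning; 2 stands for any exponent above 1, since [a] is a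
    polynomial. *)
Lemma nuclear_set_has_ubound a : has_ubound (nuclear_set a).
Proof.
have [c c0 hc] := @sum_inv_sobw_le 2 (ltr1n R 2).
exists (c * sobolev 2 a) => _ [m [K [K1 ->]]].
rewrite (le_trans (@hankel_test_le 2 m K a (ler0n _ _) K1))//.
by rewrite ler_wpM2r ?sobolev_ge0.
Qed.

Lemma nuclear_ub a m (K : 'M[C]_m) : opnorm_le 1 K ->
  cmod (\tr (K *m hankel a m)) <= nuclear a.
Proof.
by move=> K1; rewrite nuclear_sup; apply: ub_le_sup; [exact: nuclear_set_has_ubound|exists m, K].
Qed.

(** The threshold [m0] allows test matrices larger than the degree of [a], where the factorizations
    of Hankel matrices are exact. *)
Lemma nuclear_le a c m0 :
  (forall m (K : 'M[C]_m), (m0 <= m)%N -> opnorm_le 1 K ->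
     cmod (\tr (K *m hankel a m)) <= c) -> nuclear a <= c.
Proof.
move=> H; rewrite nuclear_sup; apply: ge_sup; first exact: nuclear_set_neq0.
by move=> _ [m [K [K1 ->]]]; exact: (nuclear_test H K1).
Qed.

Lemma nuclear_ge0 a : 0 <= nuclear a.
Proof.
have h := nuclear_ub a (@opnorm_le1_0 0).
exact: le_trans (cmod_ge0 _) h.
Qed.

Lemma nuclear_ubZ a m (c : R) (B : 'M[C]_m) : 0 <= c -> opnorm_le c B ->
  cmod (\tr (B *m hankel a m)) <= c * nuclear a.
Proof.
move=> c0 Bc; have [c1|c1] := ltP 0 c; last first.
  have c2 : c = 0 by apply/eqP; rewrite eq_le c0 c1.
  rewrite c2 in Bc *; rewrite (opnorm_le0_eq0 Bc) mul0mx mxtrace0 cmod0.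
  by rewrite mul0r.
rewrite -ler_pdivrMl// -[c^-1]ger0_norm ?invr_ge0// -cmod_real -cmodM.
rewrite -mxtraceZ scalemxAl; apply: nuclear_ub.
have := @opnorm_leZ _ _ _ _ (c^-1)%:C _ Bc.
by rewrite cmod_real ger0_norm ?invr_ge0// mulVf// gt_eqF.
Qed.

Lemma hankelD a b m : hankel (a + b) m = hankel a m + hankel b m.
Proof. by apply/matrixP => j k; rewrite !mxE. Qed.

Lemma hankelZ z a m : hankel (tcst z * a) m = z *: hankel a m.
Proof. by apply/matrixP => j k; rewrite !mxE tcstME. Qed.

Lemma nuclearD a b : nuclear (a + b) <= nuclear a + nuclear b.
Proof.
apply: (@nuclear_le _ _ 0) => m K _ K1; rewrite hankelD mulmxDr mxtraceD.
by rewrite (le_trans (cmodD _ _))// lerD ?nuclear_ub.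
Qed.

Lemma nuclearZ z a : nuclear (tcst z * a) <= cmod z * nuclear a.
Proof.
apply: (@nuclear_le _ _ 0) => m K _ K1; rewrite hankelZ -scalemxAr mxtraceZ.
by rewrite cmodM ler_wpM2l ?cmod_ge0 ?nuclear_ub.
Qed.

Lemma nuclear_sobolev s : 1 < s ->
  exists2 c, 0 < c & forall a, nuclear a <= c * sobolev s a.
Proof.
move=> s1; have [c c0 hc] := sum_inv_sobw_le s1; exists c => // a.
apply: (@nuclear_le _ _ 0) => m K _ K1.
have s0 : 0 <= s by lra.
rewrite (le_trans (@hankel_test_le s m K a s0 K1))//.
by rewrite ler_wpM2r ?sobolev_ge0.
Qed.

(** Schur's test sees only the moduli of the entries. Asking for domination rather than equality,
    here and in the two variants below, also covers truncated and conjugated matrices. *)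
Lemma opnorm_toeplitz m (A : 'M[C]_m) a :
  (forall j k, cmod (A j k) <= cmod (a (j%:Z - k%:Z))) -> opnorm_le (wiener a) A.
Proof.
move=> Aa; apply: schur_test => [|j|k]; first exact: wiener_ge0.
- rewrite (le_trans (ler_sum _ (fun k _ => Aa j k)))// -wiener_bar wiener_zsum.
  rewrite (le_trans _ (@sum_le_zsum (fun k => cmod (tbar a k)) m (- j%:Z) _ _))//.
  + by apply: ler_sum => k _; rewrite tbarE cmod_conj opprD opprK.
  + exact: finsupp_cmod.
  + by move=> k; exact: cmod_ge0.
- rewrite (le_trans (ler_sum _ (fun j _ => Aa j k)))// wiener_zsum.
  rewrite (le_trans _ (@sum_le_zsum (fun k => cmod (a k)) m (- k%:Z) _ _))//.
  + by apply: ler_sum => j _; rewrite addrC.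
  + exact: finsupp_cmod.
  + by move=> j; exact: cmod_ge0.
Qed.

Lemma opnorm_toeplitz_tr m (A : 'M[C]_m) a :
  (forall j k, cmod (A j k) <= cmod (a (k%:Z - j%:Z))) -> opnorm_le (wiener a) A.
Proof.
move=> Aa; rewrite -wiener_bar; apply: opnorm_toeplitz => j k.
by rewrite tbarE cmod_conj opprB.
Qed.

Lemma opnorm_hankel m (A : 'M[C]_m) a :
  (forall j k, cmod (A j k) <= cmod (a (j%:Z + k%:Z))) -> opnorm_le (wiener a) A.
Proof.
move=> Aa; apply: schur_test => [|j|k]; first exact: wiener_ge0.
- rewrite (le_trans (ler_sum _ (fun k _ => Aa j k)))// wiener_zsum.
  apply: (@sum_le_zsum (fun k => cmod (a k)) m j%:Z) => [|l].
    exact: finsupp_cmod.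
  exact: cmod_ge0.
- rewrite (le_trans (ler_sum _ (fun j _ => Aa j k)))// wiener_zsum.
  under eq_bigr do rewrite addrC.
  apply: (@sum_le_zsum (fun k => cmod (a k)) m k%:Z) => [|l].
    exact: finsupp_cmod.
  exact: cmod_ge0.
Qed.

Lemma zsum_nonneg (V : nmodType) m (f : int -> V) :
  (forall k : int, m%:Z <= k -> f k = 0) ->
  zsum (fun k => if 0 <= k then f k else 0) = \sum_(t < m) f t%:Z.
Proof.
move=> f0; rewrite /zsum (fsbigE [seq k%:Z | k <- iota 0 m]).
- under eq_bigl do rewrite in_setT.
  by rewrite big_map -(big_mkord xpredT (fun t => f t%:Z)) /index_iota subn0.
- by rewrite map_inj_uniq ?iota_uniq// => ? ?; lia.
- by [].
- move=> k _; case: ifP => // k0 kn; apply: f0; apply: contraNT kn => km.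
  by apply/mapP; exists `|k|%N; rewrite ?mem_iota; lia.
Qed.

Lemma zsum_split (V : nmodType) m (f : int -> V) :
  (forall k : int, (m <= `|k|)%N -> f k = 0) ->
  zsum f = \sum_(t < m) f t%:Z + \sum_(t < m) (if t == 0 :> nat then 0 else f (- t%:Z)).
Proof.
move=> f0; have fs : finsupp_int f by exists m => k km; apply: f0; lia.
rewrite -(zsum_nonneg (f := f)); last by move=> k km; apply: f0; lia.
rewrite -(@zsum_nonneg _ _ (fun k => if k == 0 then 0 else f (- k))); last first.
  by move=> k km; case: eqP => // _; apply: f0; lia.
rewrite [X in _ + X]zsum_opp -zsumD.
- apply: eq_zsum => k; rewrite opprK oppr_eq0 oppr_ge0; have [->|k0] := eqVneq k 0.
    by rewrite lexx addr0.
  by case: (ltrgtP 0 k) k0 => //= *; rewrite ?addr0 ?add0r//.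
- by apply: finsupp_comp fs => k ->; case: ifP.
- by apply: finsupp_comp fs => k; rewrite opprK => ->; do 2!case: ifP => //.
Qed.

(* Splitting the convolution (a b)(j + k) = sum_t a(j - t) b(t + k) at t = 0
   puts one factor in Hankel position and the other in Toeplitz position. *)
Lemma hankelM a b m n : supported n a -> supported n b -> (n < m)%N ->
  hankel (a * b) m = toeplitz a m *m hankel b m +
    hankel a m *m \matrix_(l, k) (if l == 0 :> nat then 0 else b (k%:Z - l%:Z)).
Proof.
move=> an bn nm; apply/matrixP => j k; rewrite !mxE tpME (zsum_rev j%:Z).
have lm := ltn_ord j; have km := ltn_ord k.
rewrite (@zsum_split _ m); last first.
  move=> t tm; have [tp|tn] := leP 0 t; last by rewrite an ?mul0r//; lia.
  by rewrite [b _]bn ?mulr0//; lia.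
congr (_ + _); apply: eq_bigr => t _; rewrite !mxE.
  by congr (a _ * b _); lia.
by case: ifP => // _; [rewrite mulr0 | congr (a _ * b _); lia].
Qed.

(** The trace norm is an ideal norm: by [hankelM] the Hankel matrix of a product is Toeplitz times
    Hankel plus Hankel times Toeplitz, and the Toeplitz factors are bounded by Wiener norms. *)
Lemma nuclearM a b : nuclear (a * b) <= wiener a * nuclear b + nuclear a * wiener b.
Proof.
have [n an bn] := tp_supp2 a b.
apply: (@nuclear_le _ _ n.+1) => m K nm K1; rewrite (hankelM an bn nm).
rewrite mulmxDr mxtraceD (le_trans (cmodD _ _))// lerD//.
  rewrite mulmxA; apply: nuclear_ubZ; first exact: wiener_ge0.
  rewrite -[wiener a]mul1r; apply: opnorm_leM => //.
  by apply: opnorm_toeplitz => j k; rewrite mxE.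
rewrite mulmxA mxtrace_mulC mulmxA mulrC; apply: nuclear_ubZ; first exact: wiener_ge0.
rewrite -[wiener b]mulr1; apply: opnorm_leM => //.
by apply: opnorm_toeplitz_tr => j k; rewrite mxE; case: ifP; rewrite ?cmod0 ?cmod_ge0.
Qed.

Lemma nuclear_hankel a b : (forall m, hankel a m = hankel b m) -> nuclear a = nuclear b.
Proof.
move=> ab; rewrite !nuclear_sup; congr sup; apply/seteqP; split => y [m [K [K1 ->]]];
  by exists m, K; rewrite ab.
Qed.

End NuclearNorm.

(** * The symmetrized trace norm is tame *)

Section NuclearTame.
Context {R : realType}.
Local Notation C := R[i].
Local Notation tp := (trigpoly R).
Implicit Types a b p : tp.

(** The conjugate phase of [z], equal to 0 at [z = 0]. *)
Definition phase (z : C) : C := ((cmod z)^-1)%:C * (z^*)%C.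

Lemma phaseK z : phase z * z = (cmod z)%:C.
Proof.
have [->|z0] := eqVneq z 0; first by rewrite mulr0 cmod0.
have nz : cmod z != 0 by apply: contra_neq z0; exact: cmod_eq0.
rewrite /phase -mulrA; have -> : (z^*)%C * z = (cmod z ^+ 2)%:C.
  rewrite sqr_cmod; case: (z) => a b; apply/eqP; rewrite eq_complex /=.
  by apply/andP; split; apply/eqP; ring.
by rewrite -rmorphM expr2 mulKf.
Qed.

Lemma cmod_phase_le1 z : cmod (phase z) <= 1.
Proof.
rewrite /phase cmodM cmod_conj cmod_real ger0_norm ?invr_ge0 ?cmod_ge0//.
have [->|z0] := eqVneq z 0; first by rewrite cmod0 mulr0 ler01.
by rewrite mulVf//; apply: contra_neq z0; exact: cmod_eq0.
Qed.

Lemma sum_indicator_le1 (m : nat) (l : int) (F : 'I_m -> R) :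
  (forall j, F j <= if j%:Z == l then 1 else 0) -> \sum_j F j <= 1.
Proof.
move=> Fl; rewrite (le_trans (ler_sum _ (fun j _ => Fl j)))//.
pose g (k : int) : R := if k == l then 1 else 0.
have g1 : zsum g = 1.
  by rewrite (@zsum_delta _ l) /g ?eqxx// => k /negPf ->.
rewrite -[leRHS]g1 (eq_bigr (fun j : 'I_m => g (0 + j%:Z))); last by move=> j _; rewrite add0r.
apply: (@sum_le_zsum R g m 0); last by move=> k; rewrite /g; case: ifP.
by exists `|l|%N => k; rewrite /g; case: eqP => // ->; rewrite ltnn.
Qed.

(** The test matrix lives on the entries [(j + e, j)]; it picks the coefficient of frequency
    [2 j + e] and rotates it to its modulus. The parities [e = 0] and [e = 1] reach every
    nonnegative frequency, so the trace norm controls the Wiener norm there. *)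
Lemma nuclear_diag (e m : nat) a :
  \sum_(j < m) (if (j + e < m)%N then cmod (a (j + j + e)%N%:Z) else 0) <= nuclear a.
Proof.
pose K : 'M[C]_m := \matrix_(k, j)
  (if k == (j + e)%N :> nat then phase (a (j + j + e)%N%:Z) else 0).
have K1 : opnorm_le 1 K.
  have le1 (k j : 'I_m) : cmod (K k j) <= (if k == (j + e)%N :> nat then 1 else 0).
    by rewrite mxE; case: ifP => _; rewrite ?cmod_phase_le1 ?cmod0.
  apply: schur_test => // [k|j].
    apply: (@sum_indicator_le1 _ (k%:Z - e%:Z)) => j; rewrite (le_trans (le1 k j))//.
    by case: eqP => [->|_]; case: ifP => //; lia.
  apply: (@sum_indicator_le1 _ (j + e)%N%:Z) => k; rewrite (le_trans (le1 k j))//.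
apply: le_trans (nuclear_ub a K1); rewrite trK_hankel.
rewrite [leRHS](_ : _ = cmod (\sum_(j < m)
   (if (j + e < m)%N then cmod (a (j + j + e)%N%:Z) else 0))%:C).
  by rewrite cmod_real ler_norm.
congr cmod; rewrite rmorph_sum; apply: eq_bigr => j _.
case: ifP => jm.
  rewrite (bigD1 (Ordinal jm))//= mxE /= eqxx big1 ?addr0; last first.
    move=> k kj; rewrite mxE; case: eqP => [ke|]; last by rewrite mul0r.
    by move: kj; rewrite -val_eqE /= ke eqxx.
  by rewrite -phaseK; congr (_ * a _); lia.
rewrite big1// => k _; rewrite mxE; case: eqP => [ke|]; last by rewrite mul0r.
by have := ltn_ord k; rewrite ke jm.
Qed.

Lemma nuclear_pos_sum a :
  zsum (fun k => if 0 <= k then cmod (a k) else 0) <= 2 * nuclear a.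
Proof.
have [n an] := tp_supp a; pose m := n.+2.
rewrite (@zsum_nonneg _ (m + m)%N (fun k => cmod (a k))); last first.
  by move=> k km; rewrite an ?cmod0//; lia.
have split (f : int -> R) q : \sum_(t < (q + q)%N) f t%:Z =
    \sum_(t < q) f (t + t + 0)%N%:Z + \sum_(t < q) f (t + t + 1)%N%:Z.
  elim: q => [|q IH]; first by rewrite !big_ord0 addr0.
  rewrite addSn addnS !big_ord_recr /= IH addn0 addn1 -!addrA; congr (_ + _).
  by rewrite addrCA; congr (_ + _); rewrite addrCA.
(* Only [j = m - 1] with [e = 1] violates [j + e < m], and there the frequency exceeds the degree
   [n], because [m = n + 2]. *)
have eqs e : (e <= 1)%N -> \sum_(j < m) cmod (a (j + j + e)%N%:Z) =
    \sum_(j < m) (if (j + e < m)%N then cmod (a (j + j + e)%N%:Z) else 0).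
  move=> e1; apply: eq_bigr => j _; case: ifP => // jm.
  by rewrite an ?cmod0//; have := ltn_ord j; rewrite /m in jm *; lia.
rewrite (split (fun k => cmod (a k))) !eqs// mulr_natl mulr2n lerD ?nuclear_diag//.
Qed.

(** [nuclear] ignores the negative frequencies; conjugation makes them visible. *)
Definition hankel_norm a := nuclear a + nuclear (tbar a).

Lemma hankel_norm_ge0 a : 0 <= hankel_norm a.
Proof. by rewrite addr_ge0 ?nuclear_ge0. Qed.

Lemma nuclear_le_hankel_norm a : nuclear a <= hankel_norm a.
Proof. by rewrite lerDl nuclear_ge0. Qed.

Lemma wiener_le_hankel_norm a : wiener a <= 2 * hankel_norm a.
Proof.
rewrite wiener_zsum mulrDr; apply: le_trans (lerD (nuclear_pos_sum a) (nuclear_pos_sum (tbar a))).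
rewrite [X in _ <= _ + X]zsum_opp -zsumD.
- apply: ler_zsum; first exact: finsupp_cmod.
    have [n an] := tp_supp a; exists n => k kn.
    by rewrite tbarE opprK an// conjc0 cmod0; do 2!case: ifP; rewrite ?addr0.
  move=> k; rewrite tbarE opprK cmod_conj; case: ifP => k0.
    by rewrite lerDl; case: ifP; rewrite ?cmod_ge0.
  by rewrite ifT ?add0r//; lia.
- by apply: finsupp_comp (finsupp_cmod a) => k ->; case: ifP.
- apply: finsupp_comp (finsupp_cmod a) => k ak.
  by rewrite tbarE opprK cmod_conj ak; case: ifP.
Qed.

Lemma cmod0_le_nuclear a : cmod (a 0) <= nuclear a.
Proof. by apply: le_trans (nuclear_diag 0 1 a); rewrite big_ord_recl big_ord0 /= addr0. Qed.

Lemma opnorm_diag m (d : 'I_m -> C) : (forall j, cmod (d j) <= 1) ->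
  opnorm_le 1 (\matrix_(j, k) (d j *+ (j == k))).
Proof.
move=> d1; apply: schur_test => // [j|k].
  rewrite (bigD1 j)//= mxE eqxx mulr1n big1 ?addr0// => k kj.
  by rewrite mxE eq_sym (negPf kj) mulr0n cmod0.
rewrite (bigD1 k)//= mxE eqxx mulr1n big1 ?addr0// => j jk.
by rewrite mxE (negPf jk) mulr0n cmod0.
Qed.

(* Multiplying by d j d k is conjugating by a diagonal contraction. *)
Lemma nuclear_diag_test a m (K : 'M[C]_m) (d : nat -> C) :
  (forall j, cmod (d j) <= 1) -> opnorm_le 1 K ->
  cmod (\sum_(j < m) \sum_(k < m) K k j * (d j * d k * a (j%:Z + k%:Z))) <= nuclear a.
Proof.
move=> d1 K1; pose D : 'M[C]_m := \matrix_(j, k) (d j *+ (j == k)).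
have D1 : opnorm_le 1 D by apply: opnorm_diag => j; exact: d1.
have DKD : opnorm_le 1 (D *m K *m D).
  rewrite -[1](mulr1 (1 : R)) -{1}[1](mulr1 (1 : R)); apply: opnorm_leM => //.
  exact: opnorm_leM.
apply: le_trans (nuclear_ub a DKD); rewrite trK_hankel.
rewrite le_eqVlt; apply/orP; left; apply/eqP; congr cmod.
apply: eq_bigr => j _; apply: eq_bigr => k _.
rewrite !mxE (bigD1 j)//= !mxE eqxx mulr1n (bigD1 k)//= !mxE eqxx mulr1n.
rewrite big1 ?addr0; last by move=> l lk; rewrite mxE eq_sym (negPf lk) mulr0n mul0r.
rewrite big1 ?addr0; first by ring.
by move=> l lj; rewrite [D l j]mxE (negPf lj) mulr0n mulr0.
Qed.

Lemma nuclear_mod x a : nuclear (tmod x a) <= nuclear a.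
Proof.
apply: (@nuclear_le _ _ _ 0) => m K _ K1; rewrite trK_hankel.
have := @nuclear_diag_test a m K (fun j => cexpi (j%:R * x)) _ K1.
move=> /(_ (fun j => _)) h; rewrite (_ : \sum_j _ = \sum_(j < m) \sum_(k < m)
  K k j * (cexpi (j%:R * x) * cexpi (k%:R * x) * a (j%:Z + k%:Z))).
  by apply: h => j; rewrite cmod_cexpi.
apply: eq_bigr => j _; apply: eq_bigr => k _; congr (_ * _).
by rewrite /tmod tmultE -cexpiD -mulrDl intrD.
Qed.

(* 1/(j+k+1) is the integral of r^j r^k over [0, 1], an average of products
   of contractions. *)
Lemma nuclear_invS a :
  nuclear (tmult (fun k => ((k + 1)%:~R)^-1) a) <= nuclear a.
Proof.
apply: (@nuclear_le _ _ _ 0) => m K _ K1; rewrite trK_hankel.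
set z := \sum_j _.
(* The trace is rotated to its modulus and real parts are taken, so that the polynomial [P] below is
   real and its derivative at [r] is the pairing with weights [r^j r^k]. *)
pose x (j k : 'I_m) : R := complex.Re (phase z * (K k j * a (j%:Z + k%:Z))).
have ReS (I : Type) (r : seq I) (f : I -> C) :
    complex.Re (\sum_(j <- r) f j) = \sum_(j <- r) complex.Re (f j).
  exact: (raddf_sum (@complex.Re R : Rcomplex R -> R)).
have ReM (u : R) (w : C) : complex.Re (u%:C * w) = u * complex.Re w.
  by case: w => w1 w2 /=; rewrite mul0r subr0.
pose P : {poly R} := \sum_(j < m) \sum_(k < m)
  (x j k / (j + k).+1%:R) *: 'X^((j + k).+1).
have zE : cmod z = P.[1] - P.[0].
  have -> : cmod z = complex.Re (phase z * z) by rewrite phaseK.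
  rewrite [in X in complex.Re (_ * X)]/z mulr_sumr ReS /P !horner_sum -sumrB.
  apply: eq_bigr => j _; rewrite mulr_sumr ReS !horner_sum -sumrB.
  apply: eq_bigr => k _; rewrite !hornerZ !hornerXn expr1n expr0n mulr0 subr0 mulr1.
  rewrite tmultE /x [RHS]mulrC -ReM; congr complex.Re.
  rewrite (_ : ((j + k).+1%:R^-1)%:C = (((j%:Z + k%:Z + 1)%:~R)^-1 : C)); first by ring.
  rewrite fmorphV; congr (_^-1).
  by rewrite (_ : j%:Z + k%:Z + 1 = (j + k).+1%:Z) ?rmorph_nat//; lia.
(* The mean value theorem stands in for the integral over [0, 1]: a single [r] realizes the
   average. *)
have [r] := poly_mvt P (@ltr01 R); rewrite in_itv /= => /andP[r0 r1].
rewrite subr0 mulr1 zE => ->.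
have -> : P^`().[r] = complex.Re (phase z *
   \sum_(j < m) \sum_(k < m) K k j * ((r ^+ j)%:C * (r ^+ k)%:C * a (j%:Z + k%:Z))).
  rewrite /P !raddf_sum /= horner_sum mulr_sumr ReS; apply: eq_bigr => j _.
  rewrite raddf_sum /= horner_sum mulr_sumr ReS; apply: eq_bigr => k _.
  rewrite derivZ derivXn hornerZ hornerMn hornerXn /=.
  rewrite -rmorphM -exprD.
  rewrite (_ : phase z * (K k j * _) = (r ^+ (j + k))%:C *
    (phase z * (K k j * a (j%:Z + k%:Z)))); last by ring.
  rewrite ReM -/(x j k). by rewrite -[X in _ * X = _]mulr_natr mulrACA mulVf ?pnatr_eq0//
    mulr1 mulrC.
apply: le_trans (ler_norm _) (le_trans (Re_le_cmod _) _).
rewrite cmodM -[leRHS]mul1r ler_pM ?cmod_ge0 ?cmod_phase_le1//.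
apply: (nuclear_diag_test a (d := fun j => (r ^+ j)%:C)) => // j.
by rewrite cmod_real ger0_norm ?exprn_ge0 ?exprn_ile1 ?(ltW r0) ?(ltW r1).
Qed.

(** The multiplier [1 / k] is singular at the Hankel index [j + k = 0]. Shifting the frequency by
    one turns it into [1 / (j + k + 1)], which [nuclear_invS] handles, and by [nuclearM] the shifts
    add only multiples of Wiener norms. *)
Lemma tinvD_shift a : tinvD a =
  tmono 1 * tmult (fun k => ((k + 1)%:~R)^-1) (tmono (-1) * a).
Proof.
apply: tpP => k; rewrite tmonoME tmultE tmonoME /tinvD tmultE subrK.
by congr (_ * a _); lia.
Qed.

Lemma wiener_tmono j : wiener (tmono j : tp) = 1.
Proof.
rewrite wiener_zsum (@zsum_delta _ j) /= ?eqxx ?cmod1// => k /negPf ->.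
by rewrite cmod0.
Qed.

Lemma nuclear_invD a : nuclear (tinvD a) <=
  nuclear a + (nuclear (tmono 1) + nuclear (tmono (-1))) * wiener a.
Proof.
rewrite tinvD_shift.
have W1 : wiener (tmult (fun k => ((k + 1)%:~R)^-1) (tmono (-1) * a)) <= wiener a.
  rewrite -[leRHS](wiener_mono (-1)); apply: wiener_mult_le => k.
  exact: cmod_invD_mult.
set g := tmult _ _ in W1 *.
have h1 := nuclearM (tmono 1) g; rewrite wiener_tmono in h1.
have h2 : nuclear g <= nuclear (tmono (-1) * a) by exact: nuclear_invS.
have h3 := nuclearM (tmono (-1)) a; rewrite wiener_tmono in h3.
have h4 := ler_wpM2l (nuclear_ge0 (tmono 1)) W1.
rewrite mulrDl; move: h1 h2 h3 h4.
move: (nuclear (tmono 1 * g)) (nuclear g) (nuclear (tmono (-1) * a)) => x y z.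
move: (nuclear (tmono 1)) (nuclear (tmono (-1))) (nuclear a) (wiener g) (wiener a) =>
  n1 n2 n3 w1 w2.
by rewrite !mul1r => h1 h2 h3 h4; lra.
Qed.

Lemma hankel_tpos a m : hankel (tpos a) m = hankel a m.
Proof. by apply/matrixP => j k; rewrite !mxE tposE. Qed.

Lemma nuclear_pos a : nuclear (tpos a) = nuclear a.
Proof. by apply: nuclear_hankel => m; rewrite hankel_tpos. Qed.

(** [tbar (tpos a)] has no positive frequencies, so its Hankel matrix reduces to the corner entry,
    the conjugate of [a 0]. *)
Lemma nuclear_bar_pos a : nuclear (tbar (tpos a)) <= cmod (a 0) * nuclear 1.
Proof.
rewrite (@nuclear_hankel _ _ (tcst ((a 0)^*)%C * 1)).
  by rewrite (le_trans (nuclearZ _ _))// cmod_conj.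
move=> m; apply/matrixP => j k; rewrite !mxE tbarE tposE tcstME.
rewrite -tcst1 tcstE; case: (eqVneq (j%:Z + k%:Z) 0) => [->|jk].
  by rewrite oppr0 lexx mulr1.
by rewrite ifF ?conjc0 ?mulr0//; lia.
Qed.

Lemma tneg_pos a : tneg a = a + tcst (-1) * tpos a.
Proof. by rewrite tcstN tcst1 mulN1r -{2}(tpos_tneg a) addrAC subrr add0r. Qed.

Lemma tinvD_bar a : tinvD (tbar a) = tcst (-1) * tbar (tinvD a).
Proof.
apply: tpP => k; rewrite tcstME !tbarE /tinvD !tmultE tbarE rmorphM mulN1r -mulNr.
by congr (_ * _); rewrite fmorphV rmorph_int mulrNz invrN opprK.
Qed.

Lemma conjM (z w : C) : ((z * w)^*)%C = (z^*)%C * (w^*)%C.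
Proof. exact: rmorphM. Qed.

Lemma tmod_bar x a : tmod x (tbar a) = tbar (tmod x a).
Proof.
apply: tpP => k; rewrite /tmod !(tbarE, tmultE) conjM conj_cexpi; congr (_ * _).
by rewrite mulrNz mulNr opprK.
Qed.

Lemma nuclear_bar_pos_bound : exists2 k : R, 0 <= k &
  forall a, nuclear (tbar (tpos a)) <= k * cmod (a 0).
Proof.
by exists (nuclear 1) => [|a]; [exact: nuclear_ge0 | rewrite mulrC; exact: nuclear_bar_pos].
Qed.

Lemma nuclear_invD_bound : exists2 k : R, 0 <= k &
  forall a, nuclear (tinvD a) <= nuclear a + k * wiener a.
Proof.
exists (nuclear (tmono 1) + nuclear (tmono (-1))); last exact: nuclear_invD.
by rewrite addr_ge0 ?nuclear_ge0.
Qed.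

Lemma tame_hankel_norm : exists2 K : R, 1 <= K & tame K hankel_norm.
Proof.
have [k1 k10 hk1] := nuclear_bar_pos_bound.
have [k2 k20 hk2] := nuclear_invD_bound.
have pos a : hankel_norm (tpos a) <= (1 + k1) * hankel_norm a.
  have h1 := hk1 a; have h2 := ler_wpM2l k10 (cmod0_le_nuclear a).
  have h3 := ler_wpM2l k10 (nuclear_le_hankel_norm a); have h4 := nuclear_le_hankel_norm a.
  by rewrite {1}/hankel_norm nuclear_pos; lra.
have D a b : hankel_norm (a + b) <= hankel_norm a + hankel_norm b.
  by rewrite /hankel_norm tbarD addrACA lerD ?nuclearD.
have Z z a : hankel_norm (tcst z * a) <= cmod z * hankel_norm a.
  rewrite /hankel_norm tbarM tbar_cst mulrDr lerD ?nuclearZ//.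
  by rewrite (le_trans (nuclearZ _ _))// cmod_conj.
(* [2 + k1] is for [tneg], the identity minus [tpos]. [4 * k2] is for [tinvD]: [k2] occurs for [a]
   and for its conjugate, and the Wiener norm is at most [2 * hankel_norm]. *)
have K1 : 1 <= 2 + k1 + 4 * k2 by lra.
have w a : 0 <= hankel_norm a by exact: hankel_norm_ge0.
have mono c a : c <= 2 + k1 + 4 * k2 -> c * hankel_norm a <= (2 + k1 + 4 * k2) * hankel_norm a.
  by move=> h; rewrite ler_wpM2r.
exists (2 + k1 + 4 * k2) => //; split => //.
- move=> a b; have := nuclearM a b; have := nuclearM (tbar a) (tbar b).
  rewrite -tbarM !wiener_bar => h1 h2.
  have h3 : 0 <= wiener a * hankel_norm b + hankel_norm a * wiener b.
    by rewrite addr_ge0 ?mulr_ge0 ?wiener_ge0.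
  apply: le_trans (ler_peMl h3 K1); rewrite /hankel_norm; lra.
- by move=> a; rewrite /hankel_norm tbarK addrC.
- by move=> a; rewrite (le_trans (pos a))// mono//; lra.
- move=> a; rewrite tneg_pos; have h1 := D a (tcst (-1) * tpos a).
  have h2 := Z (-1) (tpos a); rewrite cmodN cmod1 mul1r in h2.
  have h3 := pos a; have h4 : 0 <= k2 * hankel_norm a by rewrite mulr_ge0.
  lra.
- move=> a; have := hk2 a; have := hk2 (tbar a).
  rewrite tinvD_bar wiener_bar => h1 h2.
  have h3 : nuclear (tbar (tinvD a)) <= nuclear (tcst (-1) * tbar (tinvD a)).
    have := nuclearZ (-1) (tcst (-1) * tbar (tinvD a)).
    by rewrite mulrA -tcstM mulrNN mulr1 tcst1 mul1r cmodN cmod1 mul1r.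
  have := ler_wpM2l k20 (wiener_le_hankel_norm a).
  have : 0 <= (1 + k1) * hankel_norm a by rewrite mulr_ge0// addr_ge0.
  move: h1 h2 h3; rewrite /hankel_norm; set u := nuclear a; set v := nuclear (tbar a).
  by nra.
- by move=> x a; rewrite /hankel_norm -tmod_bar lerD ?nuclear_mod.
- move=> a; rewrite (le_trans (wiener_le_hankel_norm a))// mono//; lra.
Qed.

Lemma hankel_norm_sobolev s : 1 < s ->
  exists2 c, 0 < c & forall a, hankel_norm a <= c * sobolev s a.
Proof.
move=> s1; have [c c0 hc] := @nuclear_sobolev R s s1; exists (2 * c); first by rewrite mulr_gt0.
move=> a; have := hc a; have := hc (tbar a); rewrite sobolev_bar /hankel_norm.
by lra.
Qed.

(** For nonnegative frequencies conjugation leaves only the mean, so the quantity conserved by the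
    Lax pair already controls the full norm. *)
Lemma hankel_norm_pos_le : exists2 k : R, 1 <= k &
  forall p, tpos p = p -> hankel_norm p <= k * nuclear p.
Proof.
have [k k0 hk] := nuclear_bar_pos_bound; exists (1 + k); first by rewrite lerDl.
move=> p pp; have := hk p; have := ler_wpM2l k0 (cmod0_le_nuclear p).
by rewrite pp /hankel_norm; lra.
Qed.

End NuclearTame.

(** * The Lax pair of the cubic Szego equation *)

Section LaxPair.
Context {R : realType}.
Local Notation C := R[i].
Local Notation iC := (@Complex R 0 1).
Local Notation tp := (trigpoly R).
Implicit Types a b p : tp.

Definition cubic_tp p : tp := p * tbar p * p.

Lemma opnorm_leD m n (c d : R) (A B : 'M[C]_(m, n)) : 0 <= c -> 0 <= d ->
  opnorm_le c A -> opnorm_le d B -> opnorm_le (c + d) (A + B).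
Proof.
move=> c0 d0 Ac Bd x; rewrite mulmxDl.
set y := A *m x; set z := B *m x.
have hy : Num.sqrt (sqnorm y) <= c * Num.sqrt (sqnorm x).
  rewrite -{1}(ger0_norm c0) -sqrtr_sqr -sqrtrM ?sqr_ge0// ler_wsqrtr//; exact: Ac.
have hz : Num.sqrt (sqnorm z) <= d * Num.sqrt (sqnorm x).
  rewrite -{1}(ger0_norm d0) -sqrtr_sqr -sqrtrM ?sqr_ge0// ler_wsqrtr//; exact: Bd.
have h : Num.sqrt (sqnorm (y + z)) <= Num.sqrt (sqnorm y) + Num.sqrt (sqnorm z).
  apply: le_trans (minkowski_sqrt _ _ _); apply: ler_wsqrtr.
  apply: ler_sum => j _; rewrite mxE lerXn2r ?nnegrE ?addr_ge0 ?cmod_ge0//.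
  exact: cmodD.
rewrite -(sqr_sqrtr (sqnorm_ge0 (y + z))) -(sqr_sqrtr (sqnorm_ge0 x)) -exprMn.
rewrite lerXn2r ?nnegrE ?sqrtr_ge0 ?mulr_ge0 ?addr_ge0 ?sqrtr_ge0//.
by rewrite mulrDl; lra.
Qed.

Lemma sum_shift_intball (V : nmodType) (g : int -> V) n m (j : nat) :
  supported n g -> (n < m)%N ->
  \sum_(t < m) g (t%:Z + j%:Z) = \sum_(y <- intball n) if j%:Z <= y then g y else 0.
Proof.
move=> gn nm; rewrite -(@zsum_nonneg _ m (fun t => g (t + j%:Z))); last first.
  by move=> k km; apply: gn; lia.
rewrite -(@zsumE _ n (fun y => if j%:Z <= y then g y else 0)); last first.
  by move=> k kn; rewrite gn//; case: ifP.
rewrite [RHS](zsum_shift j%:Z); apply: eq_zsum => k.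
by rewrite (_ : (j%:Z <= k + j%:Z) = (0 <= k))//; lia.
Qed.

(** For a symmetric matrix, such as a Hankel matrix, this is the adjoint. *)
Definition conjmx m (A : 'M[C]_m) : 'M[C]_m := \matrix_(j, k) ((A j k)^*)%C.

Lemma sqmod_coef n p (z : int) : supported n p ->
  (p * tbar p) z = \sum_(x <- intball n) p x * ((p (x - z))^*)%C.
Proof.
move=> pn; rewrite tpME (@zsumE _ n); last by move=> k kn; rewrite pn// mul0r.
by apply: eq_bigr => x _; rewrite tbarE opprB.
Qed.

(* Both sides sum p_x p_y conj(p_(x + y - j - k)); the products on the right
   restrict to y >= k, to x >= j, and to both, and the remaining terms have
   x + y - j - k < 0, hence vanish. *)
Lemma hankel_cubic n m p : supported n p -> tpos p = p -> (n < m)%N ->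
  let G := hankel p m in let T := toeplitz (p * tbar p) m in
  hankel (tpos (cubic_tp p)) m = T *m G + G *m T^T - G *m conjmx G *m G.
Proof.
move=> pn pp nm G T; rewrite hankel_tpos.
have p_neg (k : int) : k < 0 -> p k = 0 by move=> k0; rewrite -pp tposE ifF//; lia.
apply/matrixP => j k; rewrite !mxE.
set s : int := j%:Z + k%:Z; set B := intball n.
pose F (y x : int) : C := p x * ((p (x + y - s))^*)%C * p y.
pose dbl (P : int -> int -> bool) : C :=
  \sum_(y <- B) \sum_(x <- B) if P y x then F y x else 0.
have E0 : cubic_tp p s = dbl (fun _ _ => true).
  rewrite /cubic_tp tpME (zsum_rev s) (@zsumE _ n); last first.
    by move=> y yn; rewrite subKr pn ?mulr0.
  apply: eq_bigr => y _; rewrite subKr (sqmod_coef _ pn) mulr_suml.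
  by apply: eq_bigr => x _; rewrite /F; congr (_ * (p _)^* * _); lia.
have E1 : \sum_t T j t * G t k = dbl (fun y _ => k%:Z <= y).
  pose g y := (p * tbar p) (s - y) * p y.
  rewrite (eq_bigr (fun t : 'I_m => g (t%:Z + k%:Z))); last first.
    by move=> t _; rewrite !mxE /g; congr (_ * _); congr ((p * tbar p) _); rewrite /s; lia.
  rewrite (@sum_shift_intball _ _ n)//; last by move=> y yn; rewrite /g pn ?mulr0.
  apply: eq_bigr => y _; case: ifP => _; last by rewrite big1.
  rewrite /g (sqmod_coef _ pn) mulr_suml.
  by apply: eq_bigr => x _; rewrite /F; congr (_ * (p _)^* * _); lia.
have E2 : \sum_t G j t * T^T t k = dbl (fun _ x => j%:Z <= x).
  pose g x := p x * (p * tbar p) (s - x).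
  rewrite (eq_bigr (fun t : 'I_m => g (t%:Z + j%:Z))); last first.
    move=> t _; rewrite !mxE /g [j%:Z + _]addrC; congr (_ * _).
    by congr ((p * tbar p) _); rewrite /s; lia.
  rewrite (@sum_shift_intball _ _ n)//; last by move=> y yn; rewrite /g pn ?mul0r.
  rewrite /dbl exchange_big /=; apply: eq_bigr => x _; case: ifP => _; last by rewrite big1.
  rewrite /g (sqmod_coef _ pn) mulr_sumr.
  apply: eq_bigr => y _; rewrite /F [p y * _]mulrC mulrA.
  by congr (_ * (p _)^* * _); lia.
have E3 : \sum_r (G *m conjmx G) j r * G r k = dbl (fun y x => (k%:Z <= y) && (j%:Z <= x)).
  pose g y : C := (\sum_(x <- B) if j%:Z <= x then p x * ((p (x + y - s))^*)%C else 0) * p y.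
  rewrite (eq_bigr (fun r : 'I_m => g (r%:Z + k%:Z))); last first.
    move=> r _; rewrite [G r k]mxE; congr (_ * _); rewrite mxE.
    pose g' x := p x * ((p (x - j%:Z + r%:Z))^*)%C.
    rewrite (eq_bigr (fun q : 'I_m => g' (q%:Z + j%:Z))); last first.
      by move=> q _; rewrite !mxE /g' [j%:Z + _]addrC addrK.
    rewrite (@sum_shift_intball _ _ n)//; last by move=> y yn; rewrite /g' pn ?mul0r.
    apply: eq_bigr => x _; case: ifP => // _.
    by rewrite /g'; congr (_ * (p _)^*); rewrite /s; lia.
  rewrite (@sum_shift_intball _ _ n)//; last by move=> y yn; rewrite /g pn ?mulr0.
  apply: eq_bigr => y _; case: ifP => _; last by rewrite big1.
  by rewrite /g mulr_suml; apply: eq_bigr => x _; case: ifP => //; rewrite mul0r.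
rewrite E0 E1 E2 E3; apply/eqP; rewrite eq_sym subr_eq eq_sym; apply/eqP.
rewrite /dbl -!big_split; apply: eq_bigr => y _; rewrite -!big_split.
apply: eq_bigr => x _ /=.
case: (leP k%:Z y) => ky; case: (leP j%:Z x) => jx /=; rewrite ?addr0 ?add0r//.
by rewrite /F [p (x + y - s)]p_neg ?conjc0 ?mulr0 ?mul0r//; rewrite /s; lia.
Qed.

Lemma conjugate_expand m (z : C) (A G B : 'M[C]_m) :
  (1%:M + z *: A) *m G *m (1%:M + z *: B) - z ^+ 2 *: (A *m G *m B) =
  G + z *: (A *m G + G *m B).
Proof.
rewrite mulmxDl mul1mx mulmxDr mulmx1 mulmxDl -!scalemxAl -!scalemxAr scalerA -expr2.
by rewrite -!mulmxA scalerDr !addrA addrK.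
Qed.

Section LaxStep.
Variables (n m : nat) (p : tp).
Hypotheses (pn : supported n p) (pp : tpos p = p) (nm : (n < m)%N).
Let G := hankel p m.
Let T := toeplitz (p * tbar p) m.
(** The operator of the Lax pair. The cubic term [G conj(G) G] is shared equally between the left
    and the right factor, whence [iC / 2]. The Hankel operator is antilinear, so its matrix evolves
    by [G -> U G U^T], and the right factor is the transpose of [A]. *)
Let A : 'M[C]_m := (- iC)%C *: T + (iC / 2)%C *: (G *m conjmx G).
Let w := wiener p.

Lemma lax_sym : G^T = G.
Proof. by apply/matrixP => j k; rewrite !mxE addrC. Qed.

Lemma lax_tr : A^T = (- iC)%C *: T^T + (iC / 2)%C *: (conjmx G *m G).
Proof.
rewrite /A linearD /= !linearZ /= trmx_mul lax_sym; congr (_ + _ *: (_ *m _)).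
by apply/matrixP => j k; rewrite !mxE addrC.
Qed.

(** [T] is Hermitian because [|p|^2] is real, and [G *m conjmx G] because [G] is symmetric; [A] is i
    times a Hermitian matrix. *)
Lemma lax_skew : skew_adjoint A.
Proof.
have bb : tbar (p * tbar p) = p * tbar p by rewrite tbarM tbarK mulrC.
have TE j k : ((T k j)^*)%C = T j k.
  by rewrite !mxE -[in RHS]bb tbarE opprB.
have HE j k : (((G *m conjmx G) k j)^*)%C = (G *m conjmx G) j k.
  rewrite !mxE conj_sum; apply: eq_bigr => l _.
  rewrite !mxE conjM conjcK mulrC; congr (p _ * (p _)^*); lia.
have AE j k : A j k = - iC * T j k + iC / 2 * (G *m conjmx G) j k.
  by rewrite /A mxE [X in X + _]mxE [X in _ + X]mxE.
have i1 : (iC^*)%C = - iC :> C by apply/eqP; rewrite eq_complex /= oppr0 !eqxx.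
have i3 : ((- iC)^*)%C = iC :> C by rewrite -i1 conjcK.
have cD (y z : C) : ((y + z)^*)%C = (y^*)%C + (z^*)%C by exact: rmorphD.
by move=> j k; rewrite !AE cD !conjM i3 i1 TE HE conjc_inv conjc_nat; ring.
Qed.

Let opG : opnorm_le w G.
Proof. by apply: opnorm_hankel => j k; rewrite mxE. Qed.

Let opGc : opnorm_le w (conjmx G).
Proof. by apply: opnorm_hankel => j k; rewrite !mxE cmod_conj. Qed.

Let opT : opnorm_le (w * w) T.
Proof.
apply: (@opnorm_le_trans _ _ _ (wiener (p * tbar p))); first exact: wiener_ge0.
  by rewrite (le_trans (wienerM _ _))// wiener_bar.
by apply: opnorm_toeplitz => j k; rewrite mxE.
Qed.

Let w0 : 0 <= w. Proof. exact: wiener_ge0. Qed.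

Let cmod_halfi : cmod (iC / 2 : C) = 2^-1.
Proof.
rewrite cmodM cmodi mul1r.
rewrite ComplexField.Normc.normcV.
by rewrite normcMn cmod1.
Qed.

Lemma lax_opnorm : opnorm_le (2 * w ^+ 2) A.
Proof.
have h1 : opnorm_le (w * w) ((- iC)%C *: T).
  by have := opnorm_leZ (- iC)%C opT; rewrite cmodN cmodi mul1r.
have h2 : opnorm_le (2^-1 * (w * w)) ((iC / 2)%C *: (G *m conjmx G)).
  by rewrite -cmod_halfi; apply: opnorm_leZ; exact: opnorm_leM.
have w2 : 0 <= w * w by rewrite mulr_ge0.
have w3 : 0 <= 2^-1 * (w * w) by rewrite mulr_ge0 ?invr_ge0.
apply: (@opnorm_le_trans _ _ _ (w * w + 2^-1 * (w * w))).
- exact: addr_ge0.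
- by rewrite expr2; lra.
- exact: opnorm_leD.
Qed.

Lemma lax_opnorm_tr : opnorm_le (2 * w ^+ 2) A^T.
Proof.
rewrite lax_tr.
have opTt : opnorm_le (w * w) T^T.
  apply: (@opnorm_le_trans _ _ _ (wiener (p * tbar p))); first exact: wiener_ge0.
    by rewrite (le_trans (wienerM _ _))// wiener_bar.
  by apply: opnorm_toeplitz_tr => j k; rewrite !mxE.
have h1 : opnorm_le (w * w) ((- iC)%C *: T^T).
  by have := opnorm_leZ (- iC)%C opTt; rewrite cmodN cmodi mul1r.
have h2 : opnorm_le (2^-1 * (w * w)) ((iC / 2)%C *: (conjmx G *m G)).
  by rewrite -cmod_halfi; apply: opnorm_leZ; exact: opnorm_leM.
have w2 : 0 <= w * w by rewrite mulr_ge0.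
have w3 : 0 <= 2^-1 * (w * w) by rewrite mulr_ge0 ?invr_ge0.
apply: (@opnorm_le_trans _ _ _ (w * w + 2^-1 * (w * w))).
- exact: addr_ge0.
- by rewrite expr2; lra.
- exact: opnorm_leD.
Qed.

Lemma lax_eq : (- iC)%C *: hankel (tpos (cubic_tp p)) m = A *m G + G *m A^T.
Proof.
rewrite (hankel_cubic pn pp nm) -/G -/T lax_tr /A.
rewrite mulmxDl mulmxDr -!scalemxAl -!scalemxAr !mulmxA.
set X := G *m conjmx G *m G.
rewrite scalerBr scalerDr [RHS]addrACA -scalerDl; congr (_ + _).
by rewrite -scaleNr opprK; congr (_ *: _); field.
Qed.

(* To first order in h the perturbation conjugates the Hankel matrix by the
   near-unitaries 1 + hA and 1 + hA^T, A being skew-adjoint. *)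
Lemma lax_test (h u : R) (K : 'M[C]_m) : opnorm_le 1 K ->
  u = h ^+ 2 * (2 * w ^+ 2) ^+ 2 ->
  cmod (\tr (K *m hankel (p + tcst (- iC * h%:C)%C * tpos (cubic_tp p)) m)) <=
  ((1 + u) ^+ 2 + u) * nuclear p.
Proof.
move=> K1 uE; pose M1 : 'M[C]_m := 1%:M + h%:C *: A; pose M2 : 'M[C]_m := 1%:M + h%:C *: A^T.
have skT : skew_adjoint A^T.
  by move=> j k; rewrite [A^T j k]mxE [A^T k j]mxE lax_skew.
have o1 : opnorm_le (1 + u) M1 by rewrite uE; exact: skew_opnorm lax_skew lax_opnorm.
have o2 : opnorm_le (1 + u) M2 by rewrite uE; exact: skew_opnorm skT lax_opnorm_tr.
have u0 : 0 <= u by rewrite uE mulr_ge0 ?sqr_ge0.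
(* The Euler step differs from the congruence [M1 *m G *m M2] only at order [h^2]; that difference,
   bounded by means of [h^2 (2 w^2)^2 = u], is the last summand of the bound. *)
have -> : hankel (p + tcst (- iC * h%:C)%C * tpos (cubic_tp p)) m =
    M1 *m G *m M2 - (h ^+ 2)%:C *: (A *m G *m A^T).
  rewrite rmorphXn conjugate_expand hankelD hankelZ [- iC * _]mulrC -scalerA.
  by rewrite lax_eq.
rewrite mulmxBr linearB /= mulrDl (le_trans (cmodB _ _))// lerD//.
  rewrite mulmxA mxtrace_mulC !mulmxA; apply: nuclear_ubZ; first by rewrite exprn_ge0// addr_ge0.
  have o3 := opnorm_leM K1 o1; rewrite mul1r in o3.
  by rewrite -mulmxA expr2; exact: (opnorm_leM o2 o3).
rewrite uE -scalemxAr mxtraceZ cmodM cmod_real ger0_norm ?sqr_ge0// -mulrA ler_wpM2l ?sqr_ge0//.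
rewrite mulmxA mxtrace_mulC !mulmxA; apply: nuclear_ubZ;
  first by rewrite exprn_ge0// mulr_ge0// exprn_ge0.
have o3 := opnorm_leM K1 lax_opnorm; rewrite mul1r in o3.
by rewrite -mulmxA [X in opnorm_le X]expr2; exact: (opnorm_leM lax_opnorm_tr o3).
Qed.

End LaxStep.

(** The bound is independent of the size [m], hence passes to the supremum. As [u] is of order
    [h^2], the upper derivative of the trace norm along this direction is at most 0. *)
Lemma nuclear_lax_step p (h u : R) : tpos p = p ->
  u = h ^+ 2 * (2 * wiener p ^+ 2) ^+ 2 ->
  nuclear (p + tcst (- iC * h%:C)%C * tpos (cubic_tp p)) <= ((1 + u) ^+ 2 + u) * nuclear p.
Proof.
move=> pp uE; have [n pn] := tp_supp p; apply: (@nuclear_le _ _ _ n.+1) => m K nm K1.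
exact: (lax_test pn pp nm K1 uE).
Qed.

End LaxPair.

(** * Gronwall estimates along curves *)

Section RealInduction.
Context {R : realType}.
Implicit Types (f : R -> R) (T : R).

(** At the infimum of the times where [P] fails, [P] holds by the second hypothesis, and the third
    one then keeps failures away from it. *)
Lemma real_induction T (P : R -> Prop) : P 0 ->
  (forall t, 0 < t <= T -> (forall r, 0 <= r < t -> P r) -> P t) ->
  (forall t, 0 <= t < T -> (forall r, 0 <= r <= t -> P r) ->
     exists2 d, 0 < d & forall r, t < r < t + d -> P r) ->
  forall t, 0 <= t <= T -> P t.
Proof.
move=> P0 Pl Pr t tT; apply: contrapT => nPt.
pose B := [set r | 0 <= r <= T /\ ~ P r].
have Bt : B t by [].
have Bl : has_lbound B by exists 0 => r [/andP[]].
have B0 : B !=set0 by exists t.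
pose b := inf B.
have b0 : 0 <= b by apply: lb_le_inf => // r [/andP[]].
have bt : b <= t by apply: ge_inf.
have Plt r : 0 <= r < b -> P r.
  move=> /andP[r0 rb]; apply: contrapT => nPr.
  have : B r by split => //; rewrite r0/= (le_trans (ltW rb))// (le_trans bt)//; case/andP: tT.
  by move=> /(ge_inf Bl); rewrite leNgt rb.
have Pb : P b.
  have [b1|b1] := ltP 0 b; last by rewrite (_ : b = 0)//; apply/eqP; rewrite eq_le b1 b0.
  by apply: Pl => //; rewrite b1 (le_trans bt)//; case/andP: tT.
have btlt : b < t.
  by rewrite lt_neqAle bt andbT; apply: contra_notN nPt => /eqP <-.
have bT : 0 <= b < T by rewrite b0 (lt_le_trans btlt)//; case/andP: tT.
have Ple r : 0 <= r <= b -> P r.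
  by move=> /andP[r0]; rewrite le_eqVlt => /predU1P[->//|rb]; apply: Plt; rewrite r0.
have [d d0 Pd] := Pr b bT Ple.
have [r [rT nPr] rbd] : exists2 r, B r & r < b + d by apply: inf_adherent.
have br : b <= r by apply: ge_inf.
apply: nPr; move: br; rewrite le_eqVlt => /predU1P[<-//|br].
by apply: Pd; rewrite br rbd.
Qed.

Definition eps_continuous f t :=
  forall e, 0 < e -> exists2 d, 0 < d & forall r, `|r - t| < d -> `|f r - f t| <= e.

Lemma eps_continuous_left f t c : 0 < t -> eps_continuous f t ->
  (forall r, 0 <= r < t -> f r <= c) -> f t <= c.
Proof.
move=> t0 fc h; apply/ler_addgt0Pr => e e0; have [d d0 hd] := fc _ e0.
pose r := Num.max 0 (t - d / 2).
have rt : 0 <= r < t by rewrite le_max lexx /= gt_max t0 ltrBlDr ltrDl divr_gt0.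
have rtd : `|r - t| < d.
  have h1 : t - d / 2 <= r by rewrite le_max lexx orbT.
  case/andP: rt => _ rt; rewrite ler0_norm ?subr_le0 ?ltW// opprB.
  by rewrite ltrBlDr; lra.
have := hd _ rtd; have := h _ rt; have := ler_norm (f t - f r); rewrite distrC; lra.
Qed.

(** The doubled bounds persist for a short time by continuity, and on that time they improve to the
    original ones. Both functions are treated at once because each improvement uses the bounds on
    both. *)
Lemma bootstrap f1 f2 (A1 A2 T : R) : 0 < A1 -> 0 < A2 ->
  (forall t, 0 <= t <= T -> eps_continuous f1 t) ->
  (forall t, 0 <= t <= T -> eps_continuous f2 t) ->
  f1 0 <= A1 -> f2 0 <= A2 ->
  (forall t, 0 <= t <= T ->
     (forall r, 0 <= r <= t -> f1 r <= 2 * A1 /\ f2 r <= 2 * A2) ->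
     f1 t <= A1 /\ f2 t <= A2) ->
  forall t, 0 <= t <= T -> f1 t <= A1 /\ f2 t <= A2.
Proof.
move=> A10 A20 c1 c2 h1 h2 H; apply: real_induction; first by [].
- move=> t /andP[t0 tT] IH; have tT' : 0 <= t <= T by rewrite tT ltW.
  apply: H => // r /andP[r0]; rewrite le_eqVlt => /predU1P[->|rt]; last first.
    by have [] := IH r; rewrite ?r0// => ? ?; split; lra.
  split.
    have : f1 t <= A1 by apply: eps_continuous_left (c1 _ tT') _ => // q /IH[].
    lra.
  have : f2 t <= A2 by apply: eps_continuous_left (c2 _ tT') _ => // q /IH[].
  lra.
- move=> t /andP[t0 tT] IH; have tT' : 0 <= t <= T by rewrite t0 ltW.
  have [d1 d10 e1] := c1 _ tT' _ A10; have [d2 d20 e2] := c2 _ tT' _ A20.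
  have [It1 It2] : f1 t <= A1 /\ f2 t <= A2 by apply: IH; rewrite t0 lexx.
  exists (Num.min (Num.min d1 d2) (T - t)); first by rewrite !lt_min d10 d20 subr_gt0.
  move=> r /andP[tr]; rewrite addrC -ltrBlDr !lt_min => /andP[/andP[rd1 rd2] rT].
  apply: H; first by rewrite (le_trans t0 (ltW tr)); lra.
  move=> q /andP[q0 qr]; have [qt|tq] := leP q t.
    by have [] := IH q; rewrite ?q0// => ? ?; split; lra.
  have nq : `|q - t| = q - t by rewrite ger0_norm// subr_ge0 ltW.
  have : `|f1 q - f1 t| <= A1 by apply: e1; rewrite nq; lra.
  have : `|f2 q - f2 t| <= A2 by apply: e2; rewrite nq; lra.
  have := ler_norm (f1 q - f1 t); have := ler_norm (f2 q - f2 t).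
  by move=> *; split; lra.
Qed.

(** Norms have only upper right derivatives, hence the arbitrary error [e]. The comparison function
    is a supersolution already over finite steps, because [expR (b * h) >= 1 + b * h], so real
    induction applies directly. *)
Lemma gronwall f (T b c : R) : 0 <= b -> 0 <= c -> 0 <= f 0 ->
  (forall t, 0 <= t <= T -> eps_continuous f t) ->
  (forall t, 0 <= t <= T -> forall e, 0 < e -> exists2 d, 0 < d &
     forall h, 0 <= h < d -> f (t + h) <= f t + h * (b * f t + c + e)) ->
  forall t, 0 <= t <= T -> f t <= (f 0 + c * t) * expR (b * t).
Proof.
move=> b0 c0 f0 fc fd t0 t0T.
suff main e : 0 < e -> forall t, 0 <= t <= T ->
    f t <= (f 0 + (c + e) * t) * expR (b * t).
  apply/ler_addgt0Pr => e e0; have [/andP[t00 _]] := t0T.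
  (* Chosen so that the surplus [e' * (t0 * expR (b * t0))] is at most [e]. *)
  pose e' := e / (t0 * expR (b * t0) + 1).
  have te : 0 <= t0 * expR (b * t0) by rewrite mulr_ge0// expR_ge0.
  have e'0 : 0 < e' by rewrite divr_gt0// ltr_wpDl.
  have := main _ e'0 _ t0T.
  have : e' * (t0 * expR (b * t0)) <= e.
    by rewrite /e' mulrAC ler_pdivrMr ?ltr_wpDl// ler_wpM2l ?(ltW e0)// lerDl.
  by rewrite !mulrDl; lra.
move=> e0; set g := fun t => (f 0 + (c + e) * t) * expR (b * t).
have ce : 0 <= c + e by rewrite addr_ge0// ltW.
have g_step t h : 0 <= t -> 0 <= h -> g t + h * (b * g t + c + e) <= g (t + h).
  move=> t_ge0 h0; rewrite /g (mulrDr b t h) expRD.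
  have h1 := expR_ge1Dx (b * h); have bh : 0 <= b * h by rewrite mulr_ge0.
  have h2 : 1 <= expR (b * t) by rewrite -[leLHS]expR0 ler_expR mulr_ge0.
  set E := expR (b * t) in h2 *; set F := expR (b * h) in h1 *.
  set A := f 0 + (c + e) * t.
  have A0 : 0 <= A by rewrite addr_ge0// mulr_ge0.
  have -> : f 0 + (c + e) * (t + h) = A + (c + e) * h by rewrite /A; ring.
  have EF : E * (1 + b * h) <= E * F by rewrite ler_wpM2l// (le_trans ler01).
  have AE : 0 <= A + (c + e) * h by rewrite addr_ge0// mulr_ge0.
  apply: le_trans (ler_wpM2l AE EF).
  have x1 : (c + e) * h <= (c + e) * h * E by rewrite ler_peMr// mulr_ge0.
  have x2 : 0 <= (c + e) * h * E * (b * h).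
    by rewrite !mulr_ge0// (le_trans ler01).
  rewrite (_ : (A + _) * _ = A * E + A * E * b * h + (c + e) * h * E + (c + e) * h * E * (b *
    h)); last by ring.
  by rewrite (_ : h * _ = A * E * b * h + (c + e) * h); [lra | ring].
have g_mono r t : 0 <= r -> r <= t -> g r <= g t.
  move=> r0 rt; have h0 : 0 <= t - r by rewrite subr_ge0.
  have := g_step r (t - r) r0 h0; rewrite subrKC.
  have gr : 0 <= g r.
    by rewrite mulr_ge0 ?expR_ge0// addr_ge0// mulr_ge0.
  have : 0 <= (t - r) * (b * g r + c + e).
    by rewrite mulr_ge0// -addrA addr_ge0// mulr_ge0.
  lra.
apply: real_induction.
- by rewrite /g !mulr0 addr0 expR0 mulr1.
- move=> t /andP[t_gt0 tT] IH; apply: (@eps_continuous_left f t (g t)) => //.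
    by apply: fc; rewrite tT ltW.
  move=> r /andP[r0 rt]; apply: le_trans (g_mono _ _ r0 (ltW rt)).
  by apply: IH; rewrite r0.
- move=> t /andP[t_ge0 tT] IH.
  have tT' : 0 <= t <= T by rewrite t_ge0 ltW.
  have [d d0 hd] := fd _ tT' _ e0; exists d => // r /andP[tr rd].
  have h0 : 0 <= r - t < d by rewrite subr_ge0 ltW//=; lra.
  have := hd _ h0; rewrite subrKC => /le_trans; apply.
  case/andP: h0 => h0 _.
  apply: le_trans (_ : g t + (r - t) * (b * g t + c + e) <= _); last first.
    by rewrite (le_trans (g_step _ _ t_ge0 h0))// subrKC.
  have ft : f t <= g t by apply: IH; rewrite t_ge0 lexx.
  by rewrite lerD// ler_wpM2l// -!addrA lerD2r ler_wpM2l.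
Qed.

End RealInduction.

(** * Curves of trigonometric polynomials and upper derivatives of their norms *)

Section Curves.
Context {R : realType}.
Local Notation C := R[i].
Local Notation tp := (trigpoly R).
Local Notation iC := (@Complex R 0 1).

Definition cderiv (f : R -> C) (t : R) (z : C) : Prop :=
  is_derive t 1 (fun r => complex.Re (f r)) (complex.Re z) /\
  is_derive t 1 (fun r => complex.Im (f r)) (complex.Im z).

Lemma eq_cderiv f g t z : f =1 g -> cderiv f t z -> cderiv g t z.
Proof. by move=> /funext ->. Qed.

Lemma cderiv_cst z t : cderiv (fun=> z) t 0.
Proof. by split; exact: is_derive_cst. Qed.

Lemma cderivD f g t z w : cderiv f t z -> cderiv g t w ->
  cderiv (fun r => f r + g r) t (z + w).
Proof.
move=> [f1 f2] [g1 g2]; split.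
  have -> : (fun r => complex.Re (f r + g r)) =
      (fun r => complex.Re (f r)) \+ (fun r => complex.Re (g r)).
    by apply/funext => r /=; case: (f r) (g r) => [? ?] [].
  rewrite (_ : complex.Re (z + w) = complex.Re z + complex.Re w); first exact: is_deriveD.
  by case: z w {f1 f2 g1 g2} => [? ?] [].
have -> : (fun r => complex.Im (f r + g r)) =
    (fun r => complex.Im (f r)) \+ (fun r => complex.Im (g r)).
  by apply/funext => r /=; case: (f r) (g r) => [? ?] [].
rewrite (_ : complex.Im (z + w) = complex.Im z + complex.Im w); first exact: is_deriveD.
by case: z w {f1 f2 g1 g2} => [? ?] [].
Qed.

Lemma cderivM f g t z w : cderiv f t z -> cderiv g t w ->
  cderiv (fun r => f r * g r) t (z * g t + f t * w).
Proof.
move=> [f1 f2] [g1 g2]; split.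
  have -> : (fun r => complex.Re (f r * g r)) =
      (fun r => complex.Re (f r)) \* (fun r => complex.Re (g r)) \-
      (fun r => complex.Im (f r)) \* (fun r => complex.Im (g r)).
    by apply/funext => r /=; case: (f r) (g r) => [? ?] [].
  apply: is_derive_eq (is_deriveB (is_deriveM f1 g1) (is_deriveM f2 g2)) _.
  rewrite /GRing.scale /=.
  by case: z w (f t) (g t) {f1 f2 g1 g2} => [? ?] [? ?] [? ?] [? ?] /=; ring.
have -> : (fun r => complex.Im (f r * g r)) =
    (fun r => complex.Re (f r)) \* (fun r => complex.Im (g r)) \+
    (fun r => complex.Im (f r)) \* (fun r => complex.Re (g r)).
  by apply/funext => r /=; case: (f r) (g r) => [? ?] [].
apply: is_derive_eq (is_deriveD (is_deriveM f1 g2) (is_deriveM f2 g1)) _.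
rewrite /GRing.scale /=.
by case: z w (f t) (g t) {f1 f2 g1 g2} => [? ?] [? ?] [? ?] [? ?] /=; ring.
Qed.

Lemma cderiv_conj f t z : cderiv f t z -> cderiv (fun r => ((f r)^*)%C) t (z^*)%C.
Proof.
move=> [f1 f2]; split.
  have -> : (fun r => complex.Re ((f r)^*)%C) = (fun r => complex.Re (f r)).
    by apply/funext => r; case: (f r).
  by rewrite (_ : complex.Re (z^*)%C = complex.Re z)//; case: z {f1 f2}.
have -> : (fun r => complex.Im ((f r)^*)%C) = \- (fun r => complex.Im (f r)).
  by apply/funext => r /=; case: (f r).
rewrite (_ : complex.Im (z^*)%C = - complex.Im z); first exact: is_deriveN.
by case: z {f1 f2}.
Qed.

Lemma cderivZ c f t z : cderiv f t z -> cderiv (fun r => c * f r) t (c * z).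
Proof.
move=> fz; have := cderivM (cderiv_cst c t) fz.
by rewrite mul0r add0r.
Qed.

Lemma cderiv_sum (I : Type) (r : seq I) (F : I -> R -> C) (z : I -> C) t :
  (forall j, cderiv (F j) t (z j)) ->
  cderiv (fun x => \sum_(j <- r) F j x) t (\sum_(j <- r) z j).
Proof.
move=> H; elim: r => [|j r IH].
  by rewrite big_nil; apply: eq_cderiv (cderiv_cst 0 t) => x; rewrite big_nil.
rewrite big_cons; apply: eq_cderiv (cderivD (H j) IH) => x.
by rewrite big_cons.
Qed.

Lemma cderiv_cexpi (x c t : R) :
  cderiv (fun r => cexpi (x * (r - c))) t (x%:C * iC * cexpi (x * (t - c))).
Proof.
have d1 : is_derive t 1 (fun r : R => x * (r - c)) x.
  have h : is_derive t 1 (fun r : R => r - c) 1.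
    rewrite (_ : (fun r : R => r - c) = id \+ cst (- c))//.
    by apply: is_derive_eq (is_deriveD (is_derive_id _ _) (is_derive_cst _ _ _)) _; rewrite addr0.
  rewrite (_ : (fun r : R => x * (r - c)) = x \*: (fun r : R => r - c))//.
  by apply: is_derive_eq (is_deriveZ x h) _; rewrite /GRing.scale /= mulr1.
split.
  have := @is_derive1_comp R cos (fun r => x * (r - c)) t _ _ (is_derive_cos _) d1.
  by move=> h; apply: is_derive_eq h _; rewrite /GRing.scale /=; ring.
have := @is_derive1_comp R sin (fun r => x * (r - c)) t _ _ (is_derive_sin _) d1.
by move=> h; apply: is_derive_eq h _; rewrite /GRing.scale /=; ring.
Qed.

Lemma is_derive_eps (f : R -> R) (t d : R) : is_derive t 1 f d ->
  forall e, 0 < e -> exists2 r, 0 < r & forall h, `|h| < r ->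
    `|f (t + h) - f t - h * d| <= e * `|h|.
Proof.
move=> [fd df] e e0.
have := fd; rewrite /derivable => /cvg_ex[l lP].
have dl : l = d by rewrite -df; apply/esym/cvg_lim.
rewrite dl in lP; move/cvgrPdist_le : lP => /(_ e e0).
rewrite near_withinE => /nbhs_ballP[r /= r0 rP]; exists r => // h hr.
have [->|h0] := eqVneq h 0; first by rewrite addr0 subrr mul0r subrr normr0 mulr0.
have := rP h; rewrite /ball /= sub0r normrN => /(_ hr h0).
rewrite /GRing.scale /= mulr1 [h + t]addrC => H.
have -> : f (t + h) - f t - h * d = h * (h^-1 * (f (t + h) - f t) - d).
  by rewrite mulrBr mulrA mulfV// mul1r.
by rewrite normrM mulrC distrC ler_wpM2r.
Qed.

Lemma cderiv_eps (f : R -> C) (t : R) (z : C) : cderiv f t z ->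
  forall e, 0 < e -> exists2 r, 0 < r & forall h, `|h| < r ->
    cmod (f (t + h) - f t - h%:C * z) <= e * `|h|.
Proof.
move=> [f1 f2] e e0.
have e2 : 0 < e / 2 by rewrite divr_gt0.
have [r1 r10 h1] := is_derive_eps f1 e2; have [r2 r20 h2] := is_derive_eps f2 e2.
exists (Num.min r1 r2); first by rewrite lt_min r10.
move=> h; rewrite lt_min => /andP[/h1 {}h1 /h2 {}h2].
rewrite (le_trans (cmod_le_ReIm _))// (_ : e * _ = e / 2 * `|h| + e / 2 * `|h|); last by field.
move: h1 h2; case: (f (t + h)) (f t) z {f1 f2} => [a b] [a' b'] [c d] /=.
by rewrite !mul0r subr0 addr0 => *; rewrite lerD.
Qed.

(** One degree bound for all times reduces differentiability in norm to finitely many coefficients;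
    it influences radii of smallness and not the constants. *)
Definition tderiv (u : R -> tp) (t : R) (u' : tp) : Prop :=
  exists n, [/\ forall r, supported n (u r), supported n u' &
    forall k, cderiv (fun r => u r k) t (u' k)].

Lemma eq_tderiv u v t u' : u =1 v -> tderiv u t u' -> tderiv v t u'.
Proof. by move=> /funext ->. Qed.

Lemma tderivD u v t u' v' : tderiv u t u' -> tderiv v t v' ->
  tderiv (fun r => u r + v r) t (u' + v').
Proof.
move=> [n [un un' ud]] [m [vm vm' vd]]; exists (n + m)%N.
have nm := leq_addr m n; have mn := leq_addl n m.
split=> [r||k].
- exact: supportedD (supported_le nm (un r)) (supported_le mn (vm r)).
- exact: supportedD (supported_le nm un') (supported_le mn vm').
- exact: cderivD (ud k) (vd k).
Qed.

Lemma tderiv_mult m u t u' : tderiv u t u' ->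
  tderiv (fun r => tmult m (u r)) t (tmult m u').
Proof.
move=> [n [un un' ud]]; exists n; split=> [r||k].
- exact: supported_mult.
- exact: supported_mult.
- rewrite tmultE; apply: eq_cderiv (cderivZ _ (ud k)) => r.
  by rewrite tmultE.
Qed.

Lemma tderiv_bar u t u' : tderiv u t u' -> tderiv (fun r => tbar (u r)) t (tbar u').
Proof.
move=> [n [un un' ud]]; exists n; split=> [r||k].
- exact: supported_bar.
- exact: supported_bar.
- rewrite tbarE; apply: eq_cderiv (cderiv_conj (ud (- k))) => r.
  by rewrite tbarE.
Qed.

Lemma tderivZ z u t u' : tderiv u t u' ->
  tderiv (fun r => tcst z * u r) t (tcst z * u').
Proof.
move=> ud; have := tderiv_mult (fun=> z) ud.
have E a : tmult (fun=> z) a = tcst z * a by apply: tpP => k; rewrite tmultE tcstME.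
by rewrite E; apply: eq_tderiv => r; rewrite E.
Qed.

Lemma tderivM u v t u' v' : tderiv u t u' -> tderiv v t v' ->
  tderiv (fun r => u r * v r) t (u' * v t + u t * v').
Proof.
move=> [n [un un' ud]] [m [vm vm' vd]]; exists (n + m)%N; split=> [r||k].
- exact: supportedM.
- by apply: supportedD; exact: supportedM.
have E (a b : tp) : supported n a -> (a * b) k = \sum_(l <- intball n) a l * b (k - l).
  by move=> an; rewrite tpME (@zsumE _ n)// => l ln; rewrite an// mul0r.
rewrite tpDE (E _ _ un') (E _ _ (un t)) -big_split /=.
apply: (@eq_cderiv (fun r => \sum_(l <- intball n) u r l * v r (k - l))).
  by move=> r; symmetry; exact: E.
by apply: cderiv_sum => l; exact: cderivM.
Qed.

(** Less than [tame], so as to include [nuclear], which does not control conjugates. *)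
Record modnorm (X : tp -> R) : Prop := Modnorm {
  modnorm_ge0 : forall a, 0 <= X a;
  modnormD : forall a b, X (a + b) <= X a + X b;
  modnormZ : forall z a, X (tcst z * a) <= cmod z * X a;
  modnorm_mod : forall x a, X (tmod x a) <= X a }.

Lemma tame_modnorm K X : tame K X -> modnorm X.
Proof. by case. Qed.

Lemma modnorm_nuclear : modnorm (@nuclear R).
Proof.
split; [exact: nuclear_ge0 | exact: nuclearD | exact: nuclearZ | exact: nuclear_mod].
Qed.

Section Dini.
Variables (X : tp -> R) (hX : modnorm X).

Lemma modnormN a : X (- a) <= X a.
Proof. by rewrite -mulN1r -tcst1 -tcstN (le_trans (modnormZ hX _ _))// cmodN cmod1 mul1r. Qed.

Lemma modnorm0 : X 0 = 0.
Proof.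
apply/eqP; rewrite eq_le modnorm_ge0// andbT -(mul0r (0 : tp)) -tcst0.
by rewrite (le_trans (modnormZ hX _ _))// cmod0 mul0r.
Qed.

Lemma modnorm_dist a b : `|X a - X b| <= X (a - b).
Proof.
have h1 := modnormD hX (a - b) b; have h2 := modnormD hX (- (a - b)) a.
have h3 := modnormN (a - b); rewrite subrK in h1.
rewrite (_ : - (a - b) + a = b) in h2; last by rewrite opprB subrK.
by rewrite ler_norml; lra.
Qed.

Lemma modnorm_sum n (a : tp) : supported n a ->
  X a <= \sum_(k <- intball n) cmod (a k) * X (tmono k).
Proof.
move=> an; rewrite -[a in X a]mulr1 (tp_mulE 1 an).
elim/big_rec2: _ => [|l y x _ h]; first by rewrite modnorm0.
rewrite (le_trans (modnormD hX _ _))// lerD//.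
by rewrite (le_trans (modnormZ hX _ _))// mulr1.
Qed.

Lemma modnorm_modE x a : X (tmod x a) = X a.
Proof.
apply/eqP; rewrite eq_le modnorm_mod// /= -{1}(_ : tmod (- x) (tmod x a) = a).
  exact: modnorm_mod.
apply: tpP => k; rewrite /tmod !tmultE mulrA -cexpiD mulrN addNr cexpi0.
by rewrite mul1r.
Qed.

Lemma common_radius (I : eqType) (s : seq I) (P : I -> R -> Prop) :
  (forall j, exists2 d, 0 < d & forall h, `|h| < d -> P j h) ->
  exists2 d, 0 < d & forall h, `|h| < d -> forall j, j \in s -> P j h.
Proof.
move=> H; elim: s => [|j s [d d0 hd]]; first by exists 1.
have [d' d'0 hd'] := H j; exists (Num.min d d'); first by rewrite lt_min d0.
move=> h; rewrite lt_min => /andP[hd1 hd2] l; rewrite inE => /predU1P[->|ls].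
  exact: hd'.
exact: hd.
Qed.

(* The generator of the modulation group does not contribute: X is invariant
   under modulation, so one differentiates in the co-moving frame. *)
Lemma dini_step (sg : R) u t u' f : tderiv u t u' ->
  u' = tcst (- (iC * sg%:C)) * tD (u t) + f ->
  forall e, 0 < e -> exists2 d, 0 < d & forall h, `|h| < d ->
    `|X (u (t + h)) - X (u t + tcst h%:C * f)| <= e * `|h|.
Proof.
move=> [n [un un' ud]] u'E e e0.
pose v r := tmod (sg * (r - t)) (u r).
have vt : v t = u t.
  by apply: tpP => k; rewrite /v /tmod tmultE subrr !mulr0 cexpi0 mul1r.
have vd k : cderiv (fun r => v r k) t (f k).
  have := cderivM (cderiv_cexpi (k%:~R * sg) t t) (ud k).
  rewrite subrr mulr0 cexpi0 mulr1 mul1r u'E tpDE tcstME /tD tmultE.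
  have -> : (k%:~R * sg)%:C * iC * u t k + (- (iC * sg%:C) * (k%:~R * u t k) + f k) = f k.
    have -> : (k%:~R * sg)%:C = k%:~R * sg%:C :> C by rewrite rmorphM rmorph_int.
    ring.
  by apply: eq_cderiv => r; rewrite /v /tmod tmultE mulrA.
(* The degree and the norms of the exponentials enter through [S] and affect only the radius [d]. *)
pose S := \sum_(k <- intball n) X (tmono k).
have S0 : 0 <= S by apply: sumr_ge0 => k _; exact: modnorm_ge0.
have e1 : 0 < e / (S + 1) by rewrite divr_gt0// ltr_wpDl.
have [d d0 hd] := @common_radius _ (intball n) _ (fun k => cderiv_eps (vd k) e1).
exists d => // h /hd {}hd.
have -> : X (u (t + h)) = X (v (t + h)) by rewrite /v modnorm_modE.
apply: le_trans (modnorm_dist _ _) _.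
have fE : f = u' - tcst (- (iC * sg%:C)) * tD (u t) by rewrite u'E addrC addKr.
have sn : supported n (v (t + h) - (u t + tcst h%:C * f)).
  have sf : supported n f.
    rewrite fE => k kn; rewrite tpBE tcstME /tD tmultE un' ?un//.
    by rewrite !mulr0 subr0.
  move=> k kn; rewrite tpBE tpDE tcstME sf// /v /tmod tmultE !un//.
  by rewrite !mulr0 addr0 subr0.
apply: le_trans (modnorm_sum sn) _.
apply: (@le_trans _ _ (\sum_(k <- intball n) e / (S + 1) * `|h| * X (tmono k))).
  rewrite big_seq [leRHS]big_seq; apply: ler_sum => k kn.
  rewrite ler_wpM2r ?modnorm_ge0//; have := hd k kn.
  by rewrite vt tpBE tpDE tcstME opprD addrA.
rewrite -mulr_sumr -/S mulrAC ler_wpM2r//.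
by rewrite mulrAC ler_pdivrMr ?ltr_wpDl// ler_wpM2l ?(ltW e0)// lerDl.
Qed.

Lemma curve_continuous (sg : R) u t u' f : tderiv u t u' ->
  u' = tcst (- (iC * sg%:C)) * tD (u t) + f -> eps_continuous (fun r => X (u r)) t.
Proof.
move=> ud u'E e e0; have [d d0 hd] := dini_step ud u'E ltr01.
pose M := 1 + X f.
have M0 : 0 < M by rewrite ltr_wpDr// modnorm_ge0.
exists (Num.min d (e / M)); first by rewrite lt_min d0 divr_gt0.
move=> r; rewrite lt_min => /andP[/hd]; rewrite subrKC mul1r => h1.
rewrite ltr_pdivlMr// => h2.
have h3 : `|X (u t + tcst (r - t)%:C * f) - X (u t)| <= `|r - t| * X f.
  apply: le_trans (modnorm_dist _ _) _; rewrite addrAC subrr add0r.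
  by rewrite (le_trans (modnormZ hX _ _))// cmod_real.
have := ler_normD (X (u r) - X (u t + tcst (r - t)%:C * f))
  (X (u t + tcst (r - t)%:C * f) - X (u t)).
by rewrite addrA subrK; move: h2; rewrite /M mulrDr; lra.
Qed.

(** The hypothesis concerns the Euler step and not the norm of the forcing: cancellations to first
    order in [h], from the Lax pair or from a phase rotation, are visible only there. In the
    applications [sg] is 1 on nonnegative and -1 on negative frequencies, where |D| is D and -D. *)
Lemma gronwall_curve (sg : R) (u u' f : R -> tp) (T b c : R) : 0 <= b -> 0 <= c ->
  (forall t, 0 <= t <= T -> tderiv u t (u' t)) ->
  (forall t, 0 <= t <= T -> u' t = tcst (- (iC * sg%:C)) * tD (u t) + f t) ->
  (forall t, 0 <= t <= T -> forall e, 0 < e -> exists2 d, 0 < d &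
     forall h, 0 <= h < d -> X (u t + tcst h%:C * f t) <= X (u t) + h * (b * X (u t) + c + e)) ->
  forall t, 0 <= t <= T -> X (u t) <= (X (u 0) + c * t) * expR (b * t).
Proof.
move=> b0 c0 ud u'E H; apply: gronwall => //; first exact: modnorm_ge0.
  by move=> t tT; apply: curve_continuous (ud t tT) (u'E t tT).
move=> t tT e e0; have e2 : 0 < e / 2 by rewrite divr_gt0.
have [d1 d10 h1] := dini_step (ud t tT) (u'E t tT) e2.
have [d2 d20 h2] := H t tT _ e2.
exists (Num.min d1 d2); first by rewrite lt_min d10.
move=> h /andP[h0]; rewrite lt_min => /andP[hd1 hd2].
have {}h1 := h1 h; rewrite ger0_norm// in h1; have {}h1 := h1 hd1.
have {}h2 := h2 h; rewrite h0 hd2 in h2; have {}h2 := h2 isT.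
have := ler_norm (X (u (t + h)) - X (u t + tcst h%:C * f t)).
have -> : h * (b * X (u t) + c + e) = h * (b * X (u t) + c + e / 2) + e / 2 * h by field.
by lra.
Qed.

Lemma gronwall_curve_bound (sg : R) (u u' f : R -> tp) (T b c : R) : 0 <= b -> 0 <= c ->
  (forall t, 0 <= t <= T -> tderiv u t (u' t)) ->
  (forall t, 0 <= t <= T -> u' t = tcst (- (iC * sg%:C)) * tD (u t) + f t) ->
  (forall t, 0 <= t <= T -> X (f t) <= b * X (u t) + c) ->
  forall t, 0 <= t <= T -> X (u t) <= (X (u 0) + c * t) * expR (b * t).
Proof.
move=> b0 c0 ud u'E H; apply: (gronwall_curve b0 c0 ud u'E) => t tT e e0.
exists 1 => // h /andP[h0 _]; rewrite (le_trans (modnormD hX _ _))// lerD2l.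
rewrite (le_trans (modnormZ hX _ _))// cmod_real ger0_norm// ler_wpM2l//.
by rewrite (le_trans (H t tT))// lerDl ltW.
Qed.

End Dini.
End Curves.

(** * Normal form for the negative frequencies *)

Section NormalFormAlgebra.
Context {R : realType}.
Local Notation C := R[i].
Local Notation tp := (trigpoly R).
Local Notation iC := (@Complex R 0 1).
Implicit Types a b c p q : tp.

Definition tabsD : tp -> tp := tmult (fun k => `|k|%:~R).

Lemma tpos_absD a : tpos (tabsD a) = tD (tpos a).
Proof.
apply: tpP => k; rewrite tposE /tabsD /tD 2!tmultE tposE; case: ifP => k0; last by rewrite mulr0.
by rewrite ger0_norm.
Qed.

Lemma tneg_absD a : tneg (tabsD a) = - tD (tneg a).
Proof.
apply: tpP => k; rewrite tpNE tnegE /tabsD /tD 2!tmultE tnegE; case: ifP => k0.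
  by rewrite mulr0 oppr0.
have kn : k < 0 by rewrite ltNge k0.
by rewrite ltr0_norm// mulrNz mulNr.
Qed.

Lemma tpos_id a : tpos (tpos a) = tpos a.
Proof. by apply: tpP => k; rewrite !tposE; case: (0 <= k). Qed.

Lemma tposD a b : tpos (a + b) = tpos a + tpos b. Proof. exact: tmultD. Qed.
Lemma tnegD a b : tneg (a + b) = tneg a + tneg b. Proof. exact: tmultD. Qed.
Lemma tposZ z a : tpos (tcst z * a) = tcst z * tpos a. Proof. exact: tmultZ. Qed.
Lemma tnegZ z a : tneg (tcst z * a) = tcst z * tneg a. Proof. exact: tmultZ. Qed.

Lemma tinvD_tneg_tD a : tinvD (tneg (tD a)) = tneg a.
Proof.
apply: tpP => k; rewrite /tinvD tmultE !tnegE /tD tmultE; case: ifP => k0; first by rewrite mulr0.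
by rewrite mulKf// intr_eq0; apply: contraFneq k0 => ->.
Qed.

Lemma tD_tinvD_tneg a : tD (tinvD (tneg a)) = tneg a.
Proof.
apply: tpP => k; rewrite /tD /tinvD 2!tmultE !tnegE; case: ifP => k0; first by rewrite !mulr0.
by rewrite mulVKf// intr_eq0; apply: contraFneq k0 => ->.
Qed.

Lemma tinvD_tD a : tinvD (tD a) = a - tcst (a 0).
Proof.
apply: tpP => k; rewrite /tD /tinvD !tmultE tpBE tcstE; case: eqP => [->|/eqP k0].
  by rewrite mul0r mulr0 subrr.
by rewrite subr0 mulKf// intr_eq0.
Qed.

Lemma tD_tinvD a : tD (tinvD a) = a - tcst (a 0).
Proof. by rewrite -tinvD_tD /tD /tinvD !tmult_comp; apply: eq_tmult => k _; rewrite mulrC. Qed.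

Lemma tD_tneg a : tD (tneg a) = tneg (tD a).
Proof. by rewrite /tD /tneg !tmult_comp; apply: eq_tmult => k _; rewrite mulrC. Qed.

Lemma tneg_pos_mul a b : tpos a = a -> tpos b = b -> tneg (a * b) = 0.
Proof.
move=> pa pb; apply: tpP => k; rewrite tnegE; case: ifP => // k0.
rewrite tpME; apply: fsbig1 => l _; rewrite -pa -pb !tposE.
by case: ifP => l0; [case: ifP => l1; [lia | rewrite mulr0] | rewrite mul0r].
Qed.

Lemma tpos_mul a b : tpos a = a -> tpos b = b -> tpos (a * b) = a * b.
Proof. by move=> pa pb; rewrite -[RHS]tpos_tneg (tneg_pos_mul pa pb) addr0. Qed.

Lemma tpos_bar_tneg a : tpos (tbar (tneg a)) = tbar (tneg a).
Proof.
apply: tpP => k; rewrite tposE tbarE tnegE; case: (leP 0 k) => // k0.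
by rewrite ifT ?conjc0//; lia.
Qed.

Lemma sqmod_coef0 p : (p * tbar p) 0 = (zsum (fun k => cmod (p k) ^+ 2))%:C.
Proof.
have [n pn] := tp_supp p; rewrite (sqmod_coef _ pn) (@zsumE _ n); last first.
  by move=> k /pn ->; rewrite cmod0 expr0n.
rewrite rmorph_sum; apply: eq_bigr => k _; rewrite subr0 sqr_cmod.
by case: (p k) => x y; apply/eqP; rewrite eq_complex /=; apply/andP; split; apply/eqP; ring.
Qed.

Definition mass p : R := zsum (fun k => cmod (p k) ^+ 2).

Section Derivative.
Variables (u r : tp).
Let p := tpos u.
Let q := tneg u.
Let J := tcst iC.
Let H := tcst (2^-1 : C).
Let b := p * tbar p.
Let m := tcst (b 0).

(* e_p and e_q are what remains of p' + iDp and q' - iDq. *)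
Definition forcing_pos : tp := - J * tpos (cubic_tp u + r).
Definition forcing_neg : tp := - J * tneg (cubic_tp u + r).
Let ep := forcing_pos.
Let eq_ := forcing_neg.

(** The homological equation: products of [p] and its conjugate are transported by -iD, but [q] by
    iD. The mismatch 2D is invertible on negative frequencies, so half of this term absorbs the
    forcing by [|p|^2 p]. *)
Definition nf_cubic : tp := tinvD (tneg (cubic_tp p)).
(** The counterpart for [2 |p|^2 q], whose mismatch is twice the frequency of [|p|^2]. [tinvD] drops
    the mean [m], for which there is no mismatch. *)
Definition nf_mixed : tp := tneg (tinvD b * q).
Definition nf_var : tp := q - H * nf_cubic - nf_mixed.

(** What [ep] contributes, beyond transport, to the time derivative of [|p|^2 p], and in [nf_G2] to
    that of [|p|^2]. *)
Definition nf_G1 : tp := (ep * tbar p + p * tbar ep) * p + b * ep.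
Definition nf_G2 : tp := ep * tbar p + p * tbar ep.
(** The part of [|u|^2 u] that is at least quadratic in [q]. *)
Definition nf_S : tp := (p * q * tbar q) *+ 2 + tbar p * q * q + q * q * tbar q.

(** The first summand arises because the resonant term [2 m q] is expressed through [nf_var], which
    differs from [q] by the two corrections. *)
Definition nf_rest : tp :=
  - (J * m * (H * nf_cubic + nf_mixed)) *+ 2 - J * tneg (nf_S + r)
  - H * tinvD (tneg nf_G1) - tneg (tinvD nf_G2 * q + tinvD b * eq_).

Let dp := - J * tD p + ep.
Let dq := J * tD q + eq_.

Lemma hw_pos : tpos (tcst (- iC) * (tabsD u + cubic_tp u + r)) = dp.
Proof. by rewrite tposZ tcstN -addrA tposD tpos_absD mulrDr. Qed.

Lemma hw_neg : tneg (tcst (- iC) * (tabsD u + cubic_tp u + r)) = dq.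
Proof. by rewrite tnegZ tcstN -addrA tnegD tneg_absD mulrDr mulrNN. Qed.

(** The sign from conjugating i cancels the sign in [tDbar]: [p] and its conjugate are transported
    alike, so by the Leibniz rule every product of them is. *)
Lemma nf_bar_dp : tbar dp = - J * tD (tbar p) + tbar ep.
Proof.
rewrite /dp tbarD tbarM tbarN tbar_cst (_ : (iC^*)%C = - iC); last first.
  by apply/eqP; rewrite eq_complex /= oppr0 !eqxx.
by rewrite tcstN opprK tDbar mulrNN.
Qed.

Let dcubic := (dp * tbar p + p * tbar dp) * p + p * tbar p * dp.

Lemma nf_dcubic : dcubic = - J * tD (cubic_tp p) + nf_G1.
Proof. by rewrite /dcubic nf_bar_dp /dp /cubic_tp !tDM /nf_G1 /b; ring. Qed.

Lemma nf_dsq : dp * tbar p + p * tbar dp = - J * tD b + nf_G2.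
Proof. by rewrite nf_bar_dp /dp /b !tDM /nf_G2; ring. Qed.

Let NJ : - J = tcst (- iC). Proof. by rewrite tcstN. Qed.

Lemma nf_cubic_deriv : tinvD (tneg dcubic) =
  J * tD nf_cubic - (J * tneg (cubic_tp p)) *+ 2 + tinvD (tneg nf_G1).
Proof.
rewrite nf_dcubic tnegD /tinvD tmultD NJ tnegZ tmultZ -/tinvD tinvD_tneg_tD.
by rewrite /nf_cubic tD_tinvD_tneg tcstN -/J; ring.
Qed.

Lemma nf_mixed_deriv :
  tneg (tinvD (dp * tbar p + p * tbar dp) * q + tinvD b * dq) =
  J * tD nf_mixed - (J * tneg ((b - m) * q)) *+ 2
  + tneg (tinvD nf_G2 * q + tinvD b * eq_).
Proof.
have -> : tinvD (dp * tbar p + p * tbar dp) = - J * (b - m) + tinvD nf_G2.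
  by rewrite nf_dsq /tinvD tmultD NJ tmultZ -/tinvD tinvD_tD.
rewrite /nf_mixed tD_tneg tDM tD_tinvD -/m /dq.
rewrite (_ : _ + _ = tcst (- iC) * ((b - m) * q) + tcst iC * (tinvD b * tD q) +
  (tinvD nf_G2 * q + tinvD b * eq_)); last by rewrite -NJ -/J; ring.
by rewrite !tnegD !tnegZ -NJ -/J; ring.
Qed.

Lemma tneg_q : tneg q = q.
Proof. by apply: tpP => k; rewrite !tnegE; case: (0 <= k). Qed.

Lemma nf_forcing : eq_ = - (J * tneg (cubic_tp p)) - (J * tneg (b * q)) *+ 2 - J * tneg (nf_S + r).
Proof.
rewrite /eq_ /forcing_neg (_ : cubic_tp u + r =
    cubic_tp p + (b * q + b * q) + p * p * tbar q + (nf_S + r)); last first.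
  rewrite -[u]tpos_tneg -/p -/q /cubic_tp /nf_S /b tbarD; ring.
(* The conjugate of [q] has positive frequencies only. This disposes of the last term linear in
   [q]. *)
have z : tneg (p * p * tbar q) = 0.
  by rewrite tneg_pos_mul ?tpos_bar_tneg// tpos_mul// tpos_id.
by rewrite !tnegD z; ring.
Qed.

Lemma nf_var_deriv :
  dq - H * tinvD (tneg dcubic)
     - tneg (tinvD (dp * tbar p + p * tbar dp) * q + tinvD b * dq) =
  J * tD nf_var - (J * m * nf_var) *+ 2 + nf_rest.
Proof.
have HH : H + H = 1.
  by rewrite /H -tcstD -tcst1; congr tcst; field.
have -> : tD nf_var = tD q - H * tD nf_cubic - tD nf_mixed.
  by rewrite /nf_var /tD tmultB tmultB tmultZ.
rewrite nf_cubic_deriv nf_mixed_deriv /nf_rest.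
set x4 := tneg (tinvD nf_G2 * q + tinvD b * eq_); set x5 := tinvD (tneg nf_G1).
rewrite /dq nf_forcing /nf_var.
have -> : tneg ((b - m) * q) = tneg (b * q) - m * q.
  by rewrite mulrBl /tneg tmultB -/tneg tnegZ tneg_q.
set x1 := tneg (cubic_tp p); set x2 := tneg (b * q); set x3 := tneg (nf_S + r).
have e1 : H * ((J * x1) *+ 2) = J * x1.
  by rewrite mulr2n mulrDr -mulrDl HH mul1r.
rewrite mulrDr mulrBr e1; ring.
Qed.

End Derivative.
End NormalFormAlgebra.

Section NormalFormEstimates.
Context {R : realType}.
Local Notation C := R[i].
Local Notation tp := (trigpoly R).
Local Notation iC := (@Complex R 0 1).
Implicit Types a b c p q : tp.

Lemma tame_weaken (K M : R) (X : tp -> R) : K <= M -> tame K X -> tame M X.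
Proof.
move=> KM [K1 X0 XD XZ XM Xb Xp Xn XI Xm XW].
have mono y : 0 <= y -> K * y <= M * y by move=> y0; rewrite ler_wpM2r.
split => //; first exact: le_trans KM.
- move=> a b; rewrite (le_trans (XM a b))// mono// addr_ge0// mulr_ge0 ?wiener_ge0//.
- by move=> a; rewrite (le_trans (Xp a))// mono.
- by move=> a; rewrite (le_trans (Xn a))// mono.
- by move=> a; rewrite (le_trans (XI a))// mono.
- by move=> a; rewrite (le_trans (XW a))// mono.
Qed.

Section Estimates.
Variables (M : R) (X : tp -> R).
Hypothesis hX : tame M X.

Let M1 : 1 <= M := tame_K hX.
Let M0 : 0 <= M := le_trans ler01 M1.
Let X0 : forall a, 0 <= X a := tame_ge0 hX.
Let mX : modnorm X := tame_modnorm hX.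

Lemma tame_mul a b x y : X a <= x -> X b <= y -> X (a * b) <= 2 * M ^+ 2 * x * y.
Proof.
move=> ax bY; have x0 := le_trans (X0 a) ax; have y0 := le_trans (X0 b) bY.
apply: le_trans (tameM hX a b) _.
have wa : wiener a <= M * x by rewrite (le_trans (tame_wiener hX a))// ler_wpM2l.
have wb : wiener b <= M * y by rewrite (le_trans (tame_wiener hX b))// ler_wpM2l.
rewrite (_ : 2 * M ^+ 2 * x * y = M * (M * x * y + x * (M * y))); last by ring.
by rewrite ler_wpM2l// lerD// ler_pM ?wiener_ge0.
Qed.

Lemma tame_mul3 a b c x y z : X a <= x -> X b <= y -> X c <= z ->
  X (a * b * c) <= 2 * M ^+ 2 * (2 * M ^+ 2 * x * y) * z.
Proof. by move=> ax bY cz; apply: tame_mul => //; exact: tame_mul. Qed.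

Lemma tame_mul3_wiener a b c :
  X (a * b * c) <= M ^+ 2 * (X a * wiener b * wiener c + wiener a * X b * wiener c +
                            wiener a * wiener b * X c).
Proof.
apply: le_trans (tameM hX _ _) _.
have h1 := ler_wpM2r (wiener_ge0 c) (tameM hX a b).
have h2 := ler_wpM2r (X0 c) (wienerM a b).
have s0 : 0 <= wiener a * wiener b * X c by rewrite !mulr_ge0 ?wiener_ge0.
have h3 := ler_peMl s0 M1.
rewrite expr2 -mulrA ler_wpM2l//.
by move: h1 h2 h3; lra.
Qed.

Lemma tame_scal z a x : cmod z <= 1 -> X a <= x -> X (tcst z * a) <= x.
Proof.
move=> z1 ax; rewrite (le_trans (tameZ hX _ _))// (le_trans _ ax)//.
by rewrite -[leRHS]mul1r ler_wpM2r.
Qed.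

Lemma tame_opp a x : X a <= x -> X (- a) <= x.
Proof. exact: le_trans (modnormN mX a). Qed.

Lemma tame_add a b x y : X a <= x -> X b <= y -> X (a + b) <= x + y.
Proof. by move=> ax bY; rewrite (le_trans (tameD hX _ _))// lerD. Qed.

Lemma tame_sub a b x y : X a <= x -> X b <= y -> X (a - b) <= x + y.
Proof. by move=> ax bY; apply: tame_add => //; exact: tame_opp. Qed.

Lemma tame_dbl a x : X a <= x -> X (a *+ 2) <= 2 * x.
Proof. by move=> ax; rewrite mulr2n mulr_natl mulr2n; exact: tame_add. Qed.

Lemma tame_Ple (F : tp -> tp) a x : (forall a, X (F a) <= M * X a) -> X a <= x ->
  X (F a) <= M * x.
Proof. by move=> FX ax; rewrite (le_trans (FX a))// ler_wpM2l. Qed.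

Definition tame_posle a x := @tame_Ple tpos a x (tame_pos hX).
Definition tame_negle a x := @tame_Ple tneg a x (tame_neg hX).
Definition tame_invDle a x := @tame_Ple tinvD a x (tame_invD hX).

Lemma tame_barle a x : X a <= x -> X (tbar a) <= x.
Proof. exact: le_trans (tame_bar hX a). Qed.

Lemma cmod_half_le1 : cmod (2^-1 : C) <= 1.
Proof.
rewrite ComplexField.Normc.normcV normcMn cmod1 invf_le1//.
by rewrite ler1n.
Qed.

Lemma cmod_iC_le1 : cmod iC <= 1. Proof. by rewrite cmodi. Qed.

Variable e : R.
Hypotheses (e0 : 0 < e) (e1 : e <= 1).

(** Lower-order monomials are absorbed into one with a larger power of [M >= 1] and a smaller power
    of [e <= 1]; the powers of [M] below are not optimized. *)
Lemma monomial_le j k l n : (j <= k)%N -> (n <= l)%N -> M ^+ j * e ^+ l <= M ^+ k * e ^+ n.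
Proof.
move=> jk nl; rewrite ler_pM ?exprn_ge0// ?(ltW e0)//; first exact: ler_weXn2l.
by apply: ler_wiXn2l => //; exact: ltW.
Qed.

Variables (u r : tp).
Hypotheses (hu : X u <= M * e) (hr : X r <= M * e ^+ 5).
Hypothesis hq : wiener (tneg u) <= e ^+ 2.

Let p := tpos u.
Let q := tneg u.
Let b := p * tbar p.

Let Xp : X p <= M ^+ 2 * e.
Proof. by rewrite (_ : M ^+ 2 * e = M * (M * e)); [exact: tame_posle | ring]. Qed.

Let Xq : X q <= M ^+ 2 * e.
Proof. by rewrite (_ : M ^+ 2 * e = M * (M * e)); [exact: tame_negle | ring]. Qed.

Let Xpb : X (tbar p) <= M ^+ 2 * e. Proof. exact: tame_barle. Qed.

Let Xb : X b <= 2 * M ^+ 6 * e ^+ 2.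
Proof.
by rewrite (_ : _ * e ^+ 2 = 2 * M ^+ 2 * (M ^+ 2 * e) * (M ^+ 2 * e)); [exact: tame_mul | ring].
Qed.

Let Xforce : X (cubic_tp u + r) <= 5 * M ^+ 7 * e ^+ 3.
Proof.
have h : X (cubic_tp u) <= 2 * M ^+ 2 * (2 * M ^+ 2 * (M * e) * (M * e)) * (M * e).
  by apply: tame_mul3 => //; exact: tame_barle.
apply: le_trans (tame_add h hr) _.
have := @monomial_le 1 7 5 3 isT isT; rewrite expr1 => h1.
rewrite (_ : 2 * M ^+ 2 * (2 * M ^+ 2 * (M * e) * (M * e)) * (M * e) = 4 * (M ^+ 7 * e ^+
  3)); last by ring.
by rewrite -!mulrA; lra.
Qed.

Let Xep : X (forcing_pos u r) <= 5 * M ^+ 8 * e ^+ 3.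
Proof.
rewrite /forcing_pos mulNr; apply: tame_opp; apply: tame_scal; first exact: cmod_iC_le1.
rewrite (_ : 5 * M ^+ 8 * e ^+ 3 = M * (5 * M ^+ 7 * e ^+ 3)); last by ring.
exact: tame_posle.
Qed.

Let Xeq : X (forcing_neg u r) <= 5 * M ^+ 8 * e ^+ 3.
Proof.
rewrite /forcing_neg mulNr; apply: tame_opp; apply: tame_scal; first exact: cmod_iC_le1.
rewrite (_ : 5 * M ^+ 8 * e ^+ 3 = M * (5 * M ^+ 7 * e ^+ 3)); last by ring.
exact: tame_negle.
Qed.

Lemma nf_cubic_le : X (nf_cubic u) <= 4 * M ^+ 12 * e ^+ 3.
Proof.
rewrite (_ : 4 * _ * _ = M * (M * (2 * M ^+ 2 * (2 * M ^+ 2 * (M ^+ 2 * e) * (M ^+ 2 * e)) *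
  (M ^+ 2 * e)))); last by ring.
by apply: tame_invDle; apply: tame_negle; apply: tame_mul3.
Qed.

Lemma nf_mixed_le : X (nf_mixed u) <= 4 * M ^+ 12 * e ^+ 3.
Proof.
rewrite (_ : 4 * _ * _ = M * (2 * M ^+ 2 * (M * (2 * M ^+ 6 * e ^+ 2)) * (M ^+ 2 * e)));
  last by ring.
by apply: tame_negle; apply: tame_mul => //; apply: tame_invDle.
Qed.

Lemma nf_correction_le : X (tcst (2^-1) * nf_cubic u + nf_mixed u) <= 8 * M ^+ 12 * e ^+ 3.
Proof.
rewrite (_ : 8 * _ * _ = 4 * M ^+ 12 * e ^+ 3 + 4 * M ^+ 12 * e ^+ 3); last by ring.
apply: tame_add nf_mixed_le; apply: tame_scal nf_cubic_le; exact: cmod_half_le1.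
Qed.

Lemma nf_neg_le : X q <= X (nf_var u) + 8 * M ^+ 12 * e ^+ 3.
Proof.
rewrite (_ : q = nf_var u + (tcst (2^-1) * nf_cubic u + nf_mixed u)).
  by apply: tame_add => //; exact: nf_correction_le.
by rewrite /nf_var -/q; ring.
Qed.

(** Although [q] vanishes initially, [nf_var] does not: it starts from the corrections, and they are
    of size [e^3]. *)
Lemma nf_var_le : q = 0 -> X (nf_var u) <= 8 * M ^+ 12 * e ^+ 3.
Proof.
move=> q0; rewrite /nf_var -/q q0 sub0r -opprD; apply: tame_opp; exact: nf_correction_le.
Qed.

Lemma mass_le a x : X a <= x -> cmod (a 0) <= M * x.
Proof.
move=> ax; rewrite (le_trans (cmod_le_wiener _ _))// (le_trans (tame_wiener hX a))//.
by rewrite ler_wpM2l.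
Qed.

(** Two factors at least are [q], and the Wiener bound [e^2] is available for one of them. Up to
    powers of [M], a product is at most [e * e^2 * e^2] or [e * e^2 * X q]; hence the rate [e^3],
    harmless on times [e^-3]. *)
Let XS : X (nf_S u) <= M ^+ 5 * (9 * e ^+ 3 * X q + 3 * e ^+ 5).
Proof.
have Wq0 : 0 <= wiener q := wiener_ge0 q.
have Wp : wiener p <= M ^+ 3 * e.
  rewrite (le_trans (tame_wiener hX p))// (_ : M ^+ 3 * e = M * (M ^+ 2 * e)); last by ring.
  by rewrite ler_wpM2l.
have e20 : 0 <= e ^+ 2 by rewrite exprn_ge0// ltW.
have P1 y : X y <= M ^+ 2 * e -> X y * wiener q * wiener q <= M ^+ 3 * e ^+ 5.
  move=> Xy; rewrite -mulrA (_ : e ^+ 5 = e * (e ^+ 2 * e ^+ 2)); last by ring.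
  rewrite [leRHS]mulrA ler_pM ?mulr_ge0//; last by rewrite ler_pM.
  rewrite (le_trans Xy)// ler_wpM2r ?(ltW e0)//; exact: ler_weXn2l.
have P2 y : wiener y <= M ^+ 3 * e -> wiener y * X q * wiener q <= M ^+ 3 * (e ^+ 3 * X q).
  move=> Wy; rewrite mulrAC (_ : M ^+ 3 * _ = M ^+ 3 * e * e ^+ 2 * X q); last by ring.
  by rewrite ler_wpM2r// ler_pM// wiener_ge0.
have P3 : X q * wiener q * wiener q <= M ^+ 3 * (e ^+ 3 * X q).
  rewrite -mulrA mulrC (_ : M ^+ 3 * _ = M ^+ 3 * e ^+ 3 * X q); last by ring.
  rewrite ler_wpM2r//; apply: le_trans (_ : e ^+ 4 <= _).
    by rewrite (_ : e ^+ 4 = e ^+ 2 * e ^+ 2) ?ler_pM//; ring.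
  by have := @monomial_le 0 3 4 3 isT isT; rewrite expr0 mul1r.
have t1 : X (p * q * tbar q) <= M ^+ 5 * (2 * (e ^+ 3 * X q) + e ^+ 5).
  apply: le_trans (tame_mul3_wiener _ _ _) _; rewrite wiener_bar.
  rewrite (_ : M ^+ 5 * _ = M ^+ 2 * (M ^+ 3 * e ^+ 5 + M ^+ 3 * (e ^+ 3 * X q) +
    M ^+ 3 * (e ^+ 3 * X q))); last by ring.
  rewrite ler_wpM2l ?exprn_ge0//; apply: lerD (lerD (P1 _ Xp) (P2 _ Wp)) _.
  apply: le_trans (P2 _ Wp); rewrite mulrAC ler_wpM2r// ler_wpM2l ?wiener_ge0//.
  exact: tame_bar hX q.
have t2 : X (tbar p * q * q) <= M ^+ 5 * (2 * (e ^+ 3 * X q) + e ^+ 5).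
  apply: le_trans (tame_mul3_wiener _ _ _) _.
  rewrite (_ : M ^+ 5 * _ = M ^+ 2 * (M ^+ 3 * e ^+ 5 + M ^+ 3 * (e ^+ 3 * X q) +
    M ^+ 3 * (e ^+ 3 * X q))); last by ring.
  rewrite ler_wpM2l ?exprn_ge0// wiener_bar.
  apply: lerD (lerD (P1 _ Xpb) (P2 _ Wp)) _.
  by rewrite mulrAC; exact: P2.
have t3 : X (q * q * tbar q) <= M ^+ 5 * (3 * (e ^+ 3 * X q)).
  apply: le_trans (tame_mul3_wiener _ _ _) _; rewrite wiener_bar.
  rewrite (_ : M ^+ 5 * _ = M ^+ 2 * (M ^+ 3 * (e ^+ 3 * X q) + M ^+ 3 * (e ^+ 3 * X q) +
    M ^+ 3 * (e ^+ 3 * X q))); last by ring.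
  rewrite ler_wpM2l ?exprn_ge0// [wiener q * X q]mulrC; apply: lerD (lerD P3 P3) _.
  apply: le_trans P3; rewrite [leRHS](_ : _ = wiener q * wiener q * X q); last by ring.
  by rewrite ler_wpM2l ?mulr_ge0//; exact: tame_bar hX q.
apply: le_trans (tame_add (tame_add (tame_dbl t1) t2) t3) _.
rewrite le_eqVlt; apply/orP; left; apply/eqP; ring.
Qed.

Lemma nf_rest_le : X (nf_rest u r) <= 9 * M ^+ 6 * e ^+ 3 * X (nf_var u) + 230 * M ^+ 19 * e ^+ 5.
Proof.
set Q := X (nf_var u).
have Q0 : 0 <= Q by exact: X0.
have b0 : cmod (b 0) <= 2 * M ^+ 7 * e ^+ 2.
  by rewrite (_ : _ * e ^+ 2 = M * (2 * M ^+ 6 * e ^+ 2)); [exact: mass_le | ring].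
have T1 : X ((tcst iC * tcst (b 0) * (tcst (2^-1) * nf_cubic u + nf_mixed u)) *+ 2) <=
    32 * (M ^+ 19 * e ^+ 5).
  rewrite (_ : 32 * _ = 2 * ((2 * M ^+ 7 * e ^+ 2) * (8 * M ^+ 12 * e ^+ 3))); last by ring.
  apply: tame_dbl; rewrite -mulrA; apply: tame_scal; first exact: cmod_iC_le1.
  apply: le_trans (tameZ hX _ _) _; apply: ler_pM => //; first exact: cmod_ge0.
  exact: nf_correction_le.
have T2 : X (tcst iC * tneg (nf_S u + r)) <=
    M * (M ^+ 5 * (9 * e ^+ 3 * (Q + 8 * M ^+ 12 * e ^+ 3) + 3 * e ^+ 5) + M * e ^+ 5).
  apply: tame_scal; first exact: cmod_iC_le1.
  apply: tame_negle; apply: tame_add => //; apply: le_trans XS _.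
  rewrite ler_wpM2l ?exprn_ge0// lerD2r ler_wpM2l ?nf_neg_le//.
  by rewrite mulr_ge0// exprn_ge0// ltW.
have G2 : X (nf_G2 u r) <= 20 * M ^+ 12 * e ^+ 4.
  rewrite (_ : 20 * _ * _ = 2 * M ^+ 2 * (5 * M ^+ 8 * e ^+ 3) * (M ^+ 2 * e) +
    2 * M ^+ 2 * (M ^+ 2 * e) * (5 * M ^+ 8 * e ^+ 3)); last by ring.
  by apply: tame_add; apply: tame_mul => //; exact: tame_barle.
have G1 : X (nf_G1 u r) <= 60 * M ^+ 16 * e ^+ 5.
  rewrite (_ : 60 * _ * _ = 2 * M ^+ 2 * (20 * M ^+ 12 * e ^+ 4) * (M ^+ 2 * e) +
    2 * M ^+ 2 * (2 * M ^+ 6 * e ^+ 2) * (5 * M ^+ 8 * e ^+ 3)); last by ring.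
  by apply: tame_add; apply: tame_mul.
have T3 : X (tcst (2^-1) * tinvD (tneg (nf_G1 u r))) <= 60 * (M ^+ 18 * e ^+ 5).
  apply: tame_scal; first exact: cmod_half_le1.
  rewrite (_ : 60 * _ = M * (M * (60 * M ^+ 16 * e ^+ 5))); last by ring.
  by apply: tame_invDle; apply: tame_negle.
have T4 : X (tneg (tinvD (nf_G2 u r) * q + tinvD b * forcing_neg u r)) <= 60 * (M ^+ 18 * e ^+ 5).
  rewrite (_ : 60 * _ = M * (2 * M ^+ 2 * (M * (20 * M ^+ 12 * e ^+ 4)) * (M ^+ 2 * e) +
     2 * M ^+ 2 * (M * (2 * M ^+ 6 * e ^+ 2)) * (5 * M ^+ 8 * e ^+ 3))); last by ring.
  by apply: tame_negle; apply: tame_add; apply: tame_mul => //; apply: tame_invDle.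
have -> : nf_rest u r = - ((tcst iC * tcst (b 0) * (tcst (2^-1) * nf_cubic u + nf_mixed u)) *+ 2)
  - tcst iC * tneg (nf_S u + r) - tcst (2^-1) * tinvD (tneg (nf_G1 u r))
  - tneg (tinvD (nf_G2 u r) * q + tinvD b * forcing_neg u r).
  by rewrite /nf_rest -/p -/q -/b mulNrn.
apply: le_trans (tame_sub (tame_sub (tame_sub (tame_opp T1) T2) T3) T4) _.
(* The numerical coefficients are 32, 72, 3, 1, 60 and 60; their sum 228 is rounded up to 230. *)
have c1 := @monomial_le 18 19 6 5 isT isT.
have c2 := @monomial_le 6 19 5 5 isT isT.
have c3 := @monomial_le 2 19 5 5 isT isT.
have c4 := @monomial_le 18 19 5 5 isT isT.
have c5 : 0 <= M ^+ 19 * e ^+ 5 by rewrite mulr_ge0 ?exprn_ge0// ltW.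
rewrite (_ : M * _ = 9 * M ^+ 6 * e ^+ 3 * Q + 72 * (M ^+ 18 * e ^+ 6) +
  3 * (M ^+ 6 * e ^+ 5) + M ^+ 2 * e ^+ 5); last by ring.
by rewrite -(mulrA 230); lra.
Qed.

End Estimates.

Lemma tderivB (u v : R -> tp) t u' v' : tderiv u t u' -> tderiv v t v' ->
  tderiv (fun r => u r - v r) t (u' - v').
Proof.
move=> ud vd; have := tderivD ud (tderivZ (-1) vd).
rewrite tcstN tcst1 mulN1r; apply: eq_tderiv => r.
by rewrite mulN1r.
Qed.

Definition hw_approx (T : R) (u r : R -> tp) := forall t, 0 <= t <= T ->
  tderiv u t (tcst (- iC) * (tabsD (u t) + cubic_tp (u t) + r t)).

Lemma hw_pos_deriv T u r t : hw_approx T u r -> 0 <= t <= T ->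
  tderiv (fun t => tpos (u t)) t (- tcst iC * tD (tpos (u t)) + forcing_pos (u t) (r t)).
Proof. by move=> H tT; rewrite -hw_pos; exact: tderiv_mult (H t tT). Qed.

Lemma hw_neg_deriv T u r t : hw_approx T u r -> 0 <= t <= T ->
  tderiv (fun t => tneg (u t)) t (tcst iC * tD (tneg (u t)) + forcing_neg (u t) (r t)).
Proof. by move=> H tT; rewrite -hw_neg; exact: tderiv_mult (H t tT). Qed.

Lemma nf_var_tderiv T u r t : hw_approx T u r -> 0 <= t <= T ->
  tderiv (fun t => nf_var (u t)) t
    (tcst iC * tD (nf_var (u t)) -
     (tcst iC * tcst ((tpos (u t) * tbar (tpos (u t))) 0) * nf_var (u t)) *+ 2 +
     nf_rest (u t) (r t)).
Proof.
move=> H tT; have pd := hw_pos_deriv H tT; have qd := hw_neg_deriv H tT.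
rewrite -nf_var_deriv.
have bd := tderivM pd (tderiv_bar pd).
apply: tderivB; first apply: tderivB => //.
  apply: tderivZ; apply: tderiv_mult; apply: tderiv_mult.
  exact: tderivM bd pd.
apply: tderiv_mult; apply: tderivM qd; apply: tderiv_mult; exact: bd.
Qed.

(** An Euler step of a rotation lengthens vectors only to second order. *)
Lemma cmod_1i_le (x : R) : cmod (1 - x%:C * iC) <= 1 + x ^+ 2.
Proof.
rewrite -(@ler_pXn2r _ 2) ?nnegrE ?cmod_ge0 ?addr_ge0 ?sqr_ge0// sqr_cmod /=.
have := sqr_ge0 x; set y := x ^+ 2 => y0.
rewrite (_ : _ + _ = 1 + y); last by rewrite /y; ring.
by have := sqr_ge0 y; rewrite sqrrD; nra.
Qed.

(* The resonant term -2i m Q only rotates the phase of Q, since m is real. *)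
Lemma neg_part_bound (M e T : R) X (u r : R -> tp) : tame M X ->
  0 < e -> e <= 1 -> e ^+ 3 * T <= 1 -> hw_approx T u r ->
  (forall t, 0 <= t <= T ->
    [/\ X (u t) <= M * e, X (r t) <= M * e ^+ 5 & wiener (tneg (u t)) <= e ^+ 2]) ->
  tneg (u 0) = 0 ->
  forall t, 0 <= t <= T -> X (tneg (u t)) <=
    (8 * M ^+ 12 * e ^+ 3 + 230 * M ^+ 19 * e ^+ 5 * t) * expR (9 * M ^+ 6) + 8 * M ^+ 12 * e ^+ 3.
Proof.
move=> hX e0 e1 eT H bnd u0 t tT.
have M1 := tame_K hX; have M0 : 0 <= M := le_trans ler01 M1.
have mX := tame_modnorm hX.
have t0 : 0 <= t by case/andP: tT.
have T0 : 0 <= (0 : R) <= T.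
  by apply/andP; split => //; apply: (le_trans t0); case/andP: tT.
have [hu hr hq] := bnd t tT.
apply: le_trans (nf_neg_le hX hu) _; rewrite lerD2r.
set bb := 9 * M ^+ 6 * e ^+ 3; set cc := 230 * M ^+ 19 * e ^+ 5.
have e30 : 0 <= e ^+ 3 by rewrite exprn_ge0// ltW.
have bb0 : 0 <= bb by rewrite mulr_ge0// mulr_ge0// exprn_ge0.
have cc0 : 0 <= cc.
  apply: mulr_ge0; last by apply: exprn_ge0; exact: ltW.
  by apply: mulr_ge0; [exact: ler0n|exact: exprn_ge0].
pose m s := mass (tpos (u s)).
have b0E s : (tpos (u s) * tbar (tpos (u s))) 0 = (m s)%:C by exact: sqmod_coef0.
pose f s := - (tcst iC * tcst (m s)%:C * nf_var (u s)) *+ 2 + nf_rest (u s) (r s).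
have step : forall s, 0 <= s <= T -> forall d, 0 < d -> exists2 h0, 0 < h0 &
    forall h, 0 <= h < h0 ->
    X (nf_var (u s) + tcst h%:C * f s) <= X (nf_var (u s)) + h * (bb * X (nf_var (u s)) + cc + d).
  move=> s sT d d0; set x := nf_var (u s); set k := (2 * m s) ^+ 2 * X x.
  have k0 : 0 <= k by rewrite mulr_ge0 ?sqr_ge0 ?(tame_ge0 hX).
  (* In this range the second-order gain [h^2 * k] of the rotation is at most [h * d]. *)
  exists (d / (k + 1)); first by rewrite divr_gt0// ltr_wpDl.
  move=> h /andP[h0 hk].
  have -> : x + tcst h%:C * f s = tcst (1 - (2 * m s * h)%:C * iC) * x + tcst h%:C * nf_rest
    (u s) (r s).
    have two : tcst 2 = 2 :> tp by rewrite -[2 in LHS]/(1 + 1) tcstD tcst1.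
    have E : tcst (2 * m s * h)%:C = 2 * tcst (m s)%:C * tcst h%:C.
      by rewrite -two -!tcstM !rmorphM rmorph_nat.
    by rewrite /f -/x tcstD tcstN tcstM E tcst1; ring.
  have [su sr sq] := bnd s sT.
  have h1 := nf_rest_le hX e0 e1 su sr sq; rewrite -/x -/bb -/cc in h1.
  have h2 : X (tcst h%:C * nf_rest (u s) (r s)) <= h * (bb * X x + cc).
    apply: le_trans (tameZ hX _ _) _; rewrite cmod_real ger0_norm//.
    by rewrite ler_wpM2l.
  have h3 : X (tcst (1 - (2 * m s * h)%:C * iC) * x) <= (1 + (2 * m s * h) ^+ 2) * X x.
    apply: le_trans (tameZ hX _ _) _; rewrite ler_wpM2r ?(tame_ge0 hX)//.
    exact: cmod_1i_le.
  have h4 : (2 * m s * h) ^+ 2 * X x <= h * d.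
    rewrite (_ : _ * X x = h * (h * k)); last by rewrite /k; ring.
    rewrite ler_wpM2l//; move: hk; rewrite ltr_pdivlMr ?ltr_wpDl// => hk.
    by apply: le_trans (ltW hk); rewrite ler_wpM2l// lerDl.
  apply: le_trans (tameD hX _ _) _.
  by move: h2 h3 h4; rewrite [(1 + _) * X x]mulrDl mul1r !mulrDr; lra.
have ud s : 0 <= s <= T -> tderiv (fun s => nf_var (u s)) s
    (tcst (- (iC * (-1)%:C)) * tD (nf_var (u s)) + f s).
  have e2 : - (iC * (-1)%:C) = iC.
    by apply/eqP; rewrite eq_complex /=; apply/andP; split; apply/eqP; ring.
  move=> sT; have h := nf_var_tderiv H sT; rewrite b0E in h.
  by rewrite e2 /f [X in tderiv _ _ X]addrA [X in _ + X + _]mulNrn; exact: h.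
have main := gronwall_curve mX bb0 cc0 ud (fun s _ => erefl) step tT.
apply: le_trans main _.
have Q0 : X (nf_var (u 0)) <= 8 * M ^+ 12 * e ^+ 3.
  by have [h1 h2 h3] := bnd 0 T0; apply: nf_var_le.
apply: ler_pM.
- by rewrite addr_ge0 ?(tame_ge0 hX)// mulr_ge0.
- exact: expR_ge0.
- by rewrite lerD2r.
(* Here [e ^+ 3 * T <= 1] bounds the exponent independently of [e]. *)
- rewrite ler_expR -[leRHS]mulr1 /bb -mulrA ler_wpM2l ?mulr_ge0 ?exprn_ge0//.
  by apply: le_trans eT; rewrite ler_wpM2l//; case/andP: tT.
Qed.

End NormalFormEstimates.

(** * A priori estimates for truncated solutions *)

Section Approximation.
Context {R : realType}.
Local Notation C := R[i].
Local Notation tp := (trigpoly R).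
Local Notation iC := (@Complex R 0 1).
Implicit Types a : tp.

Lemma cubic_diff_le (M x y : R) X (u v : tp) : tame M X -> X u <= y -> X v <= y ->
  X (u - v) <= x -> X (cubic_tp u - cubic_tp v) <= 12 * M ^+ 4 * y ^+ 2 * x.
Proof.
move=> hX Xu Xv Xd.
have -> : cubic_tp u - cubic_tp v =
    (u - v) * tbar u * u + v * tbar (u - v) * u + v * tbar v * (u - v).
  by rewrite /cubic_tp tbarD tbarN; ring.
rewrite (_ : 12 * _ * _ * _ = 2 * M ^+ 2 * (2 * M ^+ 2 * x * y) * y +
  2 * M ^+ 2 * (2 * M ^+ 2 * y * x) * y + 2 * M ^+ 2 * (2 * M ^+ 2 * y * y) * x); last by ring.
have bar := tame_barle hX.
do 2?[apply: (tame_add hX)]; apply: (tame_mul3 hX) => //; exact: bar.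
Qed.

(** By the Lax step the cubic term contributes to the trace norm only at order [h^2]; the growth is
    due to [g] alone. *)
Lemma nuclear_growth (T rho : R) (p g : R -> tp) : 0 <= rho ->
  (forall t, tpos (p t) = p t) ->
  (forall t, 0 <= t <= T ->
     tderiv p t (- tcst iC * tD (p t) + - tcst iC * (tpos (cubic_tp (p t)) + g t))) ->
  (forall t, 0 <= t <= T -> nuclear (g t) <= rho) ->
  forall t, 0 <= t <= T -> nuclear (p t) <= nuclear (p 0) + rho * t.
Proof.
move=> rho0 pp pd hg t tT.
pose f s := - tcst iC * (tpos (cubic_tp (p s)) + g s).
have ud s : 0 <= s <= T -> tderiv p s (tcst (- (iC * 1%:C)) * tD (p s) + f s).
  by move=> sT; have := pd s sT; rewrite mulr1 tcstN.
have step : forall s, 0 <= s <= T -> forall d, 0 < d -> exists2 h0, 0 < h0 &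
    forall h, 0 <= h < h0 ->
    nuclear (p s + tcst h%:C * f s) <= nuclear (p s) + h * (0 * nuclear (p s) + rho + d).
  move=> s sT d d0; set k := (2 * wiener (p s) ^+ 2) ^+ 2; set N := nuclear (p s).
  have k0 : 0 <= k by exact: sqr_ge0.
  have N0 : 0 <= N by exact: nuclear_ge0.
  have kN : 0 <= (3 * k + k ^+ 2) * N by rewrite mulr_ge0// addr_ge0 ?sqr_ge0// mulr_ge0.
  (* [h <= 1] yields [h^4 k^2 <= h^2 k^2]; the other bound makes the gain [h^2 (3 k + k^2) N] at
     most [h * d]. *)
  exists (Num.min 1 (d / ((3 * k + k ^+ 2) * N + 1))).
    by rewrite lt_min ltr01 divr_gt0// ltr_wpDl.
  move=> h /andP[h0]; rewrite lt_min => /andP[h1 hk].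
  have -> : p s + tcst h%:C * f s =
      (p s + tcst (- iC * h%:C) * tpos (cubic_tp (p s))) + tcst h%:C * (tcst (- iC) * g s).
    by rewrite /f tcstM tcstN; ring.
  have a1 := nuclear_lax_step (pp s) (erefl (h ^+ 2 * k)).
  have a2 : nuclear (tcst h%:C * (tcst (- iC) * g s)) <= h * rho.
    rewrite (le_trans (nuclearZ _ _))// cmod_real ger0_norm// ler_wpM2l//.
    by rewrite (le_trans (nuclearZ _ _))// cmodN cmodi mul1r hg.
  rewrite (le_trans (nuclearD _ _))// mul0r add0r.
  rewrite -/N in a1.
  have a3 : h * ((3 * k + k ^+ 2) * N) <= d.
    move: hk; rewrite ltr_pdivlMr ?ltr_wpDl// => hk; apply: le_trans (ltW hk).
    by rewrite ler_wpM2l// lerDl.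
  have a4 : (1 + h ^+ 2 * k) ^+ 2 + h ^+ 2 * k <= 1 + h * h * (3 * k + k ^+ 2).
    have h21 : h ^+ 2 <= 1 by rewrite expr_le1// ltW.
    have : h ^+ 2 * h ^+ 2 * k ^+ 2 <= 1 * h ^+ 2 * k ^+ 2.
      by rewrite ler_wpM2r ?sqr_ge0// ler_wpM2r ?sqr_ge0.
    by rewrite -!expr2; nra.
  have a5 := ler_wpM2r N0 a4; have a6 := ler_wpM2l h0 a3.
  have a7 : (1 + h * h * (3 * k + k ^+ 2)) * N = N + h * (h * ((3 * k + k ^+ 2) * N)) by ring.
  by move: a1 a2 a5 a6; rewrite a7 mulrDr; lra.
have := gronwall_curve modnorm_nuclear (lexx 0) rho0 ud (fun s _ => erefl) step tT.
by rewrite mul0r expR0 mulr1.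
Qed.

Lemma hw_approx_le (T T' : R) (u r : R -> tp) : T' <= T -> hw_approx T u r -> hw_approx T' u r.
Proof. by move=> TT H t /andP[t0 tT]; apply: H; rewrite t0 (le_trans tT). Qed.

Lemma tpos_neg0 a : tneg a = 0 -> tpos a = a.
Proof. by move=> a0; rewrite -[RHS]tpos_tneg a0 addr0. Qed.

(** The bootstrap carries [nuclear] of p, which the Lax pair nearly conserves, and [hankel_norm] of
    q. Replacing [|u|^2 u] by [|p|^2 p] is an error of order [e^2 * e^2], hence adds [e^4 t] to the
    trace norm, a small multiple of [e]. The normal form gives q the size [e^3 + e^5 t], below [e^2]
    once [e] and [e^3 t] are small. *)
Lemma half_wave_long_time (s : R) : 1 < s ->
  exists e0 c M : R, [/\ 0 < e0 < 1, 0 < c <= 1, 1 <= M &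
    forall (e T : R) (u r : R -> tp), 0 < e <= e0 -> e ^+ 3 * T <= c ->
      hw_approx T u r -> (forall t, 0 <= t <= T -> sobolev s (r t) <= e ^+ 5) ->
      sobolev s (u 0) <= e -> tneg (u 0) = 0 ->
      forall t, 0 <= t <= T -> hankel_norm (u t) <= M * e /\ wiener (tneg (u t)) <= e ^+ 2].
Proof.
move=> s1.
have [K K1 hK] := @tame_hankel_norm R.
have [C0 C00 hC0] := @hankel_norm_sobolev R s s1.
have [k k1 hk] := @hankel_norm_pos_le R.
have k0 : 0 <= k := le_trans ler01 k1.
have kC : 0 <= k * C0 by rewrite mulr_ge0// ltW.
(* [K] is for tameness, [4 * (k * C0) + 1] for the norm of [u] under the doubled bootstrap bounds,
   and the last [C0] for the norm of the error [r]. *)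
pose M := K + 4 * (k * C0) + 1 + C0.
have M1 : 1 <= M by rewrite /M; lra.
have M0 : 0 < M := lt_le_trans ltr01 M1.
have M00 : 0 <= M := ltW M0.
have hX : tame M (@hankel_norm R) by apply: tame_weaken hK; rewrite /M; lra.
have mX := tame_modnorm hX.
pose E := expR (9 * M ^+ 6).
have E1 : 1 <= E by rewrite /E -[leLHS]expR0 ler_expR mulr_ge0// exprn_ge0.
have E0 : 0 <= E := le_trans ler01 E1.
pose D := 230 * M ^+ 19 * E.
have D0 : 0 < D.
  by apply: (mulr_gt0 (mulr_gt0 _ _) (expR_gt0 _)); rewrite ?ltr0n// exprn_gt0.
pose D2 := 12 * M ^+ 6 + C0.
have D20 : 0 < D2 by rewrite addr_gt0 ?mulr_gt0 ?exprn_gt0.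
(* [d1 * D = 1 / (4 M)] is half of [A2 / e^2] below: one half is spent through [e <= d1] on the
   terms in [e^3], the other through [e^3 t <= d1] on the term in [e^5 t]. *)
pose d1 := (4 * M * D)^-1.
have d10 : 0 < d1 by rewrite invr_gt0; apply: mulr_gt0 D0; rewrite mulr_gt0.
have d1E : d1 * D = (4 * M)^-1.
  by rewrite /d1 invfM -mulrA mulVf ?mulr1// gt_eqF.
(* [C0 / D2] keeps the growth [D2 * e ^+ 4 * t] of the trace norm within [C0 * e]. *)
pose c := Num.min 1 (Num.min d1 (C0 / D2)).
have c0 : 0 < c by rewrite !lt_min ltr01 d10 divr_gt0.
have c1 : c <= 1 by rewrite ge_min lexx.
have cd1 : c <= d1 by rewrite !ge_min lexx !orbT.
have cD2 : c * D2 <= C0 by rewrite -ler_pdivlMr// !ge_min lexx !orbT.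
pose e0 := Num.min 2^-1 d1.
have e00 : 0 < e0 by rewrite lt_min invr_gt0 ltr0n.
have e01 : e0 < 1 by rewrite gt_min invf_lt1 ?ltr1n.
exists e0, c, M; split; [by rewrite e00 | by rewrite c0 | by [] |].
move=> e T u r /andP[ep ee0] eT H hr hu0 q0.
have e1 : e <= 1 by rewrite (le_trans ee0)// ltW.
have ed1 : e <= d1 by rewrite (le_trans ee0)// ge_min lexx orbT.
have en n : 0 <= e ^+ n by rewrite exprn_ge0// ltW.
have e_mono m n : (m <= n)%N -> e ^+ n <= e ^+ m by move=> mn; rewrite ler_wiXn2l ?(ltW ep).
(* [A1] is twice the initial size [C0 * e], the second half being room for growth. [A2] is such that
   [M] times its double is the Wiener bound [e^2] that the normal form requires of q. *)
pose A1 := 2 * C0 * e; pose A2 := e ^+ 2 / (2 * M).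
have A10 : 0 < A1 by rewrite mulr_gt0 ?mulr_gt0.
have A20 : 0 < A2 by rewrite divr_gt0 ?exprn_gt0// mulr_gt0.
have MA2 : M * (2 * A2) = e ^+ 2 by rewrite /A2; field; rewrite gt_eqF.
have A2e : 2 * A2 <= e ^+ 2 by rewrite -MA2 ler_peMl// mulr_ge0// ltW.
have Xr (t : R) : 0 <= t <= T -> hankel_norm (r t) <= C0 * e ^+ 5.
  by move=> tT; rewrite (le_trans (hC0 _))// ler_wpM2l ?(ltW C00) ?hr.
have p0N : nuclear (tpos (u 0)) <= C0 * e.
  rewrite nuclear_pos (le_trans (nuclear_le_hankel_norm _))// (le_trans (hC0 _))//.
  by rewrite ler_wpM2l ?(ltW C00).
have bounds (t : R) : nuclear (tpos (u t)) <= 2 * A1 -> hankel_norm (tneg (u t)) <= 2 * A2 ->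
    [/\ hankel_norm (tpos (u t)) <= M * e, hankel_norm (u t) <= M * e & wiener (tneg (u t))
      <= e ^+ 2].
  move=> b1 b2.
  have h1 : hankel_norm (tpos (u t)) <= 4 * (k * C0) * e.
    rewrite (le_trans (hk _ (tpos_id _)))// (_ : _ * e = k * (2 * A1)); last by rewrite /A1; ring.
    by rewrite ler_wpM2l.
  have h2 : e ^+ 2 <= e by have := e_mono 1%N 2%N isT; rewrite expr1.
  have h3 := tameD hX (tpos (u t)) (tneg (u t)); rewrite tpos_tneg in h3.
  have h4 : (4 * (k * C0) + 1) * e <= M * e by rewrite ler_wpM2r ?(ltW ep)// /M; lra.
  have h5 : 0 <= e := ltW ep.
  rewrite [leLHS]mulrDl mul1r in h4; split; [lra | lra |].
  by rewrite (le_trans (tame_wiener hX _))// -MA2 ler_wpM2l.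
have boot : forall t, 0 <= t <= T ->
    nuclear (tpos (u t)) <= A1 /\ hankel_norm (tneg (u t)) <= A2.
  apply: bootstrap => //.
  - move=> t tT; apply: (curve_continuous modnorm_nuclear (sg := 1) (hw_pos_deriv H tT)).
    by rewrite mulr1 tcstN.
  - move=> t tT; apply: (curve_continuous mX (sg := -1) (hw_neg_deriv H tT)).
    congr (tcst _ * _ + _).
    by apply/eqP; rewrite eq_complex /=; apply/andP; split; apply/eqP; ring.
  - by rewrite (le_trans p0N)// /A1 -mulrA ler_peMl// ?ler1n// mulr_ge0// ltW.
  - by rewrite q0 (modnorm0 mX) ltW.
  - move=> t /andP[t0 tT] hyp.
    have sub (q : R) : 0 <= q <= t -> 0 <= q <= T by move=> /andP[-> /le_trans ->].
    have tt : 0 <= t <= t by rewrite t0 lexx.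
    have bd (q : R) : 0 <= q <= t -> [/\ hankel_norm (tpos (u q)) <= M * e,
        hankel_norm (u q) <= M * e & wiener (tneg (u q)) <= e ^+ 2].
      by move=> qt; have [h1 h2] := hyp q qt; apply: bounds.
    have e3t : e ^+ 3 * t <= c by rewrite (le_trans _ eT)// ler_wpM2l.
    split.
      pose g (q : R) := tpos (cubic_tp (u q) - cubic_tp (tpos (u q)) + r q).
      have gb (q : R) : 0 <= q <= t -> nuclear (g q) <= D2 * e ^+ 4.
        move=> qt; rewrite nuclear_pos (le_trans (nuclear_le_hankel_norm _))//.
        have [h1 h2 h3] := bd q qt; have [_ h4] := hyp q qt.
        have h5 : hankel_norm (u q - tpos (u q)) <= e ^+ 2.
          by rewrite -{1}(tpos_tneg (u q)) addrAC subrr add0r (le_trans h4).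
        rewrite (le_trans (tame_add hX (cubic_diff_le hX h2 h1 h5) (Xr q (sub q qt))))//.
        rewrite (_ : 12 * _ * _ * _ = 12 * M ^+ 6 * e ^+ 4); last by ring.
        by rewrite /D2 [leRHS]mulrDl lerD2l ler_wpM2l ?(ltW C00)// e_mono.
      have := @nuclear_growth t (D2 * e ^+ 4) (fun q => tpos (u q)) g _ _ _ gb t tt.
      move=> grow; apply: le_trans (grow _ _ _) _.
      + by rewrite mulr_ge0// ltW.
      + by move=> q; exact: tpos_id.
      + move=> q qt; have := hw_pos_deriv H (sub q qt).
        rewrite /forcing_pos (_ : tpos (cubic_tp (u q) + r q) =
           tpos (cubic_tp (tpos (u q))) + g q)// /g -tposD; congr tpos.
        by ring.
      + rewrite (_ : D2 * e ^+ 4 * t = D2 * (e ^+ 3 * t) * e); last by ring.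
        have : D2 * (e ^+ 3 * t) * e <= C0 * e.
          rewrite ler_wpM2r ?(ltW ep)//; apply: le_trans cD2.
          by rewrite [leRHS]mulrC ler_wpM2l ?(ltW D20).
        by rewrite /A1; lra.
    have q_le := neg_part_bound hX ep e1 (le_trans e3t c1) (hw_approx_le tT H) _ q0 tt.
    apply: le_trans (q_le _) _.
      move=> q qt; have [h1 h2 h3] := bd q qt; split => //.
      rewrite (le_trans (Xr q (sub q qt)))// ler_wpM2r//.
      by rewrite /M; lra.
    rewrite -/E.
    have m12 : M ^+ 12 <= M ^+ 19 by exact: ler_weXn2l.
    have a1 : 8 * M ^+ 12 * e ^+ 3 <= 8 * M ^+ 19 * E * e ^+ 3.
      have x1 : 8 * M ^+ 12 <= 8 * M ^+ 19 by rewrite ler_wpM2l.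
      have x2 : 8 * M ^+ 19 <= 8 * M ^+ 19 * E by rewrite ler_peMr// mulr_ge0// exprn_ge0.
      by rewrite ler_wpM2r// (le_trans x1).
    have a2 : 8 * M ^+ 12 * e ^+ 3 * E <= 8 * M ^+ 19 * E * e ^+ 3.
      by rewrite mulrAC ler_wpM2r// ler_wpM2r// ler_wpM2l.
    have a3 : D * e ^+ 3 <= (4 * M)^-1 * e ^+ 2.
      rewrite -d1E [d1 * D]mulrC -[leRHS]mulrA ler_wpM2l ?(ltW D0)// exprS.
      by rewrite ler_wpM2r.
    have a4 : D * (e ^+ 3 * t) * e ^+ 2 <= (4 * M)^-1 * e ^+ 2.
      rewrite ler_wpM2r// -d1E mulrC ler_wpM2r ?(ltW D0)//.
      by rewrite (le_trans e3t).
    have a5 : A2 = (4 * M)^-1 * e ^+ 2 + (4 * M)^-1 * e ^+ 2.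
      by rewrite /A2; field; rewrite gt_eqF.
    have a6 : 230 * M ^+ 19 * e ^+ 5 * t * E = D * (e ^+ 3 * t) * e ^+ 2 by rewrite /D; ring.
    have a7 : 0 <= M ^+ 19 * E * e ^+ 3.
      by rewrite mulr_ge0//; apply: mulr_ge0 E0; exact: exprn_ge0.
    have a8 : D * e ^+ 3 = 230 * (M ^+ 19 * E * e ^+ 3) by rewrite /D; ring.
    rewrite [X in X + _ <= _]mulrDl a6 a5.
    have a9 : 8 * M ^+ 19 * E * e ^+ 3 = 8 * (M ^+ 19 * E * e ^+ 3) by ring.
    by move: a1 a2 a3 a4; rewrite a8 a9; lra.
move=> t tT; have [h1 h2] := boot t tT.
by have [] := @bounds t; [lra | lra | ].
Qed.

End Approximation.

(** * Growth of Sobolev norms and comparison with the Szego flow *)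

Section Comparison.
Context {R : realType}.
Local Notation C := R[i].
Local Notation tp := (trigpoly R).
Local Notation iC := (@Complex R 0 1).

Lemma eps_continuousD (f g : R -> R) t : eps_continuous f t -> eps_continuous g t ->
  eps_continuous (fun r => f r + g r) t.
Proof.
move=> cf cg e e0; have e2 : 0 < e / 2 by rewrite divr_gt0.
have [d1 d10 h1] := cf _ e2; have [d2 d20 h2] := cg _ e2.
exists (Num.min d1 d2); first by rewrite lt_min d10.
move=> r; rewrite lt_min => /andP[/h1 {}h1 /h2 {}h2].
rewrite (_ : _ - _ = (f r - f t) + (g r - g t)); last by ring.
by rewrite (le_trans (ler_normD _ _))// (splitr e) lerD.
Qed.

Lemma cubic_tame_le K X (u : tp) (w : R) : tame K X -> wiener u <= w ->
  X (cubic_tp u) <= 3 * K ^+ 2 * w ^+ 2 * X u.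
Proof.
move=> hX uw; have W0 := wiener_ge0 u; have X0 := tame_ge0 hX.
have K0 : 0 <= K := le_trans ler01 (tame_K hX).
apply: le_trans (tame_mul3_wiener hX _ _ _) _; rewrite wiener_bar.
have xb := tame_bar hX u.
rewrite (_ : 3 * _ * _ * _ = K ^+ 2 * (3 * (w ^+ 2 * X u))); last by ring.
rewrite ler_wpM2l ?exprn_ge0//.
have h : wiener u * wiener u * X u <= w ^+ 2 * X u by rewrite ler_wpM2r// expr2 ler_pM.
have h2 : wiener u * X (tbar u) * wiener u <= wiener u * wiener u * X u.
  by rewrite mulrAC ler_wpM2l// mulr_ge0.
by move: h h2; rewrite (_ : X u * wiener u * wiener u = wiener u * wiener u * X u); [lra | ring].
Qed.

(** The two halves of [u] move in opposite directions, and no single moving frame serves both; hence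
    the sum of their norms is estimated. The rate involves only the Wiener bound [w]. *)
Lemma pair_growth K X (T w rho : R) (u r : R -> tp) : tame K X -> 0 <= rho ->
  hw_approx T u r ->
  (forall t, 0 <= t <= T -> wiener (u t) <= w /\ X (r t) <= rho) ->
  forall t, 0 <= t <= T -> X (u t) <=
    (X (tpos (u 0)) + X (tneg (u 0)) + 2 * K * rho * t) * expR (6 * K ^+ 3 * w ^+ 2 * t).
Proof.
move=> hX rho0 H bnd t tT; have mX := tame_modnorm hX; have X0 := tame_ge0 hX.
have K0 : 0 <= K := le_trans ler01 (tame_K hX).
pose f s := X (tpos (u s)) + X (tneg (u s)).
have Xuf s : X (u s) <= f s by rewrite -{1}(tpos_tneg (u s)) (tameD hX).
apply: le_trans (Xuf t) _.
set b := 6 * K ^+ 3 * w ^+ 2; set c := 2 * K * rho.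
have b0 : 0 <= b by rewrite mulr_ge0 ?sqr_ge0// mulr_ge0// exprn_ge0.
have c0 : 0 <= c by rewrite mulr_ge0// mulr_ge0.
have pE s : - tcst iC * tD (tpos (u s)) + forcing_pos (u s) (r s) =
    tcst (- (iC * 1%:C)) * tD (tpos (u s)) + forcing_pos (u s) (r s) :> tp.
  by rewrite mulr1 tcstN.
have nE s : tcst iC * tD (tneg (u s)) + forcing_neg (u s) (r s) =
    tcst (- (iC * (-1)%:C)) * tD (tneg (u s)) + forcing_neg (u s) (r s) :> tp.
  congr (tcst _ * _ + _).
  by apply/eqP; rewrite eq_complex /=; apply/andP; split; apply/eqP; ring.
have force s : 0 <= s <= T -> X (forcing_pos (u s) (r s)) + X (forcing_neg (u s) (r s)) <= b
  * f s + c.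
  move=> sT; have [hw hr] := bnd s sT.
  have h1 : X (cubic_tp (u s) + r s) <= 3 * K ^+ 2 * w ^+ 2 * f s + rho.
    apply: (tame_add hX) => //; apply: le_trans (cubic_tame_le hX hw) _.
    by rewrite ler_wpM2l// mulr_ge0 ?sqr_ge0// mulr_ge0// sqr_ge0.
  have h2 := tame_posle hX h1; have h3 := tame_negle hX h1.
  have h4 : X (forcing_pos (u s) (r s)) <= K * (3 * K ^+ 2 * w ^+ 2 * f s + rho).
    rewrite /forcing_pos mulNr; apply: (tame_opp hX); apply: (tame_scal hX) => //.
    exact: cmod_iC_le1.
  have h5 : X (forcing_neg (u s) (r s)) <= K * (3 * K ^+ 2 * w ^+ 2 * f s + rho).
    rewrite /forcing_neg mulNr; apply: (tame_opp hX); apply: (tame_scal hX) => //.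
    exact: cmod_iC_le1.
  rewrite (_ : b * f s + c = K * (3 * K ^+ 2 * w ^+ 2 * f s + rho) + K * (3 * K ^+ 2 * w ^+ 2
    * f s + rho)).
    exact: lerD.
  by rewrite /b /c; ring.
have f0 : 0 <= f 0 by rewrite addr_ge0.
apply: (gronwall b0 c0 f0) tT.
- move=> s sT; apply: eps_continuousD.
    by apply: (curve_continuous mX (sg := 1) (hw_pos_deriv H sT)); exact: pE.
  by apply: (curve_continuous mX (sg := -1) (hw_neg_deriv H sT)); exact: nE.
- move=> s sT e e0; have e2 : 0 < e / 2 by rewrite divr_gt0.
  have [d1 d10 h1] := dini_step mX (sg := 1) (hw_pos_deriv H sT) (pE s) e2.
  have [d2 d20 h2] := dini_step mX (sg := -1) (hw_neg_deriv H sT) (nE s) e2.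
  exists (Num.min d1 d2); first by rewrite lt_min d10.
  move=> h /andP[h0]; rewrite lt_min => /andP[hd1 hd2].
  have {}h1 := h1 h; rewrite (ger0_norm h0) in h1; have {}h1 := le_trans (ler_norm _) (h1 hd1).
  have {}h2 := h2 h; rewrite (ger0_norm h0) in h2; have {}h2 := le_trans (ler_norm _) (h2 hd2).
  have step a y : X (a + tcst h%:C * y) <= X a + h * X y.
    rewrite (le_trans (tameD hX _ _))// lerD2l (le_trans (tameZ hX _ _))//.
    by rewrite cmod_real ger0_norm.
  have h3 := step (tpos (u s)) (forcing_pos (u s) (r s)).
  have h4 := step (tneg (u s)) (forcing_neg (u s) (r s)).
  have h5 := ler_wpM2l h0 (force s sT).
  rewrite (_ : h * (b * f s + c + e) = h * (b * f s + c) + e / 2 * h + e / 2 * h); last by field.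
  by move: h1 h2 h3 h4 h5; rewrite /f mulrDr; lra.
Qed.

Definition szego_approx (T : R) (v r : R -> tp) := forall t, 0 <= t <= T ->
  tderiv v t (- tcst iC * tD (v t) + - tcst iC * (tpos (cubic_tp (v t)) + r t)).

Lemma szego_forcing K X (v r : tp) (w rho : R) : tame K X -> wiener v <= w -> X r <= rho ->
  X (- tcst iC * (tpos (cubic_tp v) + r)) <= 3 * K ^+ 3 * w ^+ 2 * X v + rho.
Proof.
move=> hX vw hr; rewrite mulNr; apply: (tame_opp hX); apply: (tame_scal hX).
  exact: cmod_iC_le1.
apply: (tame_add hX) => //.
rewrite (_ : 3 * _ * _ * _ = K * (3 * K ^+ 2 * w ^+ 2 * X v)); last by ring.
by apply: (tame_posle hX); exact: cubic_tame_le.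
Qed.

Lemma szego_growth K X (T w rho : R) (v r : R -> tp) : tame K X -> 0 <= rho ->
  szego_approx T v r ->
  (forall t, 0 <= t <= T -> wiener (v t) <= w /\ X (r t) <= rho) ->
  forall t, 0 <= t <= T -> X (v t) <=
    (X (v 0) + rho * t) * expR (3 * K ^+ 3 * w ^+ 2 * t).
Proof.
move=> hX rho0 H bnd; have mX := tame_modnorm hX.
have K0 : 0 <= K := le_trans ler01 (tame_K hX).
have b0 : 0 <= 3 * K ^+ 3 * w ^+ 2 by rewrite mulr_ge0 ?sqr_ge0// mulr_ge0// exprn_ge0.
apply: (gronwall_curve_bound mX (sg := 1) b0 rho0 H (f := fun t =>
  - tcst iC * (tpos (cubic_tp (v t)) + r t))).
- by move=> t tT; rewrite mulr1 tcstN.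
- by move=> t tT; have [h1 h2] := bnd t tT; exact: szego_forcing.
Qed.

(** A bound of size [e] up to time [e^-3] is out of reach for Gronwall with rate [e^2]. It comes
    from the conservation of the trace norm, to which the error [r] adds at most
    [C0 * e^5 * t <= C0 * e]. *)
Lemma szego_wiener (s : R) : 1 < s -> exists2 B : R, 1 <= B &
  forall (e T : R) (v r : R -> tp), 0 < e <= 1 -> e ^+ 3 * T <= 1 ->
    szego_approx T v r -> (forall t, tpos (v t) = v t) ->
    (forall t, 0 <= t <= T -> sobolev s (r t) <= e ^+ 5) -> sobolev s (v 0) <= e ->
    forall t, 0 <= t <= T -> wiener (v t) <= B * e.
Proof.
move=> s1; have [C0 C00 hC0] := @hankel_norm_sobolev R s s1.
have [k k1 hk] := @hankel_norm_pos_le R.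
have k0 : 0 <= k := le_trans ler01 k1.
exists (4 * k * C0 + 1); first by rewrite lerDr mulr_ge0 ?(ltW C00)// mulr_ge0.
move=> e T v r /andP[e0 e1] eT H vp hr v0 t tT.
have en n : 0 <= e ^+ n by rewrite exprn_ge0// ltW.
have nr q : 0 <= q <= T -> nuclear (r q) <= C0 * e ^+ 5.
  move=> qT; rewrite (le_trans (nuclear_le_hankel_norm _))// (le_trans (hC0 _))//.
  by rewrite ler_wpM2l ?(ltW C00) ?hr.
have rho0 : 0 <= C0 * e ^+ 5 by rewrite mulr_ge0// ltW.
have h1 := nuclear_growth rho0 vp H nr tT.
have h2 : nuclear (v 0) <= C0 * e.
  rewrite (le_trans (nuclear_le_hankel_norm _))// (le_trans (hC0 _))//.
  by rewrite ler_wpM2l ?(ltW C00).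
have h3 : C0 * e ^+ 5 * t <= C0 * e.
  rewrite (_ : C0 * e ^+ 5 * t = C0 * (e ^+ 2 * (e ^+ 3 * t))); last by ring.
  rewrite ler_wpM2l ?(ltW C00)// -[leRHS]mulr1 ler_pM//.
  - by rewrite mulr_ge0//; case/andP: tT.
  - by rewrite expr2 ler_piMl ?(ltW e0).
  - by rewrite (le_trans _ eT)// ler_wpM2l//; case/andP: tT.
apply: le_trans (wiener_le_hankel_norm _) _.
have h4 := hk _ (vp t).
have h5 : k * nuclear (v t) <= k * (2 * (C0 * e)) by rewrite ler_wpM2l//; lra.
have e0' := ltW e0.
rewrite [leRHS]mulrDl mul1r (_ : 4 * k * C0 * e = 2 * (k * (2 * (C0 * e)))); last by ring.
by lra.
Qed.

Lemma expR_ge1 (x : R) : 0 <= x -> 1 <= expR x.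
Proof. by move=> x0; rewrite -[leLHS]expR0 ler_expR. Qed.

(* The norms wiener + lam * sobolev are tame uniformly in lam; lam is chosen to
   absorb the exponential growth of the Sobolev norms of u and v. *)
Lemma half_wave_szego_close (s : R) (B : R) : 1 < s -> 1 <= B ->
  exists CC A : R, [/\ 0 < CC, 0 < A &
    forall (e T : R) (u r v r2 : R -> tp), 0 < e <= 1 -> e ^+ 3 * T <= 1 ->
      hw_approx T u r -> szego_approx T v r2 ->
      (forall t, 0 <= t <= T -> sobolev s (r t) <= e ^+ 5 /\ sobolev s (r2 t) <= e ^+ 5) ->
      (forall t, 0 <= t <= T -> [/\ wiener (u t) <= B * e,
         wiener (v t) <= B * e & wiener (tneg (u t)) <= e ^+ 2]) ->
      (forall t, tpos (v t) = v t) ->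
      sobolev s (u 0) <= e -> tneg (u 0) = 0 -> v 0 = u 0 ->
      forall t, 0 <= t <= T -> sobolev s (u t - v t) <= CC * e ^+ 3 * expR (A * (e ^+ 2 * T))].
Proof.
move=> s1 B1; have s0 : 0 <= s by lra.
have [C0 C00 hC0] := @hankel_norm_sobolev R s s1.
pose K : R := 2 `^ s.
have tameX lam : 0 <= lam -> tame K (fun a : tp => wiener a + lam * sobolev s a).
  by move=> l0; exact: tame_wiener_sobolev.
have K1 : 1 <= K by have := tame_K (tameX 1 ler01).
have K0 : 0 <= K := le_trans ler01 K1.
have B0 : 0 <= B := le_trans ler01 B1.
pose Y0 := 2 * C0 + 1; have Y00 : 0 <= Y0 by rewrite /Y0; lra.
have YS (a : tp) : wiener a + sobolev s a <= Y0 * sobolev s a.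
  by rewrite /Y0 mulrDl mul1r lerD2r (le_trans (wiener_le_hankel_norm a))// -mulrA ler_wpM2l.
pose b2 := 6 * K ^+ 3 * B ^+ 2.
have b20 : 0 <= b2 by rewrite mulr_ge0 ?sqr_ge0// mulr_ge0// exprn_ge0.
pose M := K + B + 3 * K * Y0 + Y0.
have KY : 0 <= 3 * K * Y0 by rewrite mulr_ge0// mulr_ge0.
have M1 : 1 <= M by rewrite /M; lra.
have M0 : 0 <= M := le_trans ler01 M1.
pose E := expR (9 * M ^+ 6).
have E1 : 1 <= E by apply: expR_ge1; rewrite mulr_ge0// exprn_ge0.
have E0 : 0 <= E := le_trans ler01 E1.
pose D := 230 * M ^+ 19 * E.
have M190 : 0 <= M ^+ 19 by exact: exprn_ge0.
have D0 : 0 <= D := mulr_ge0 (mulr_ge0 (ler0n _ _) M190) E0.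
pose D3 := 12 * M ^+ 7 * D + 2 * M ^+ 2.
have D30 : 0 < D3.
  apply: ltr_wpDl; first by apply: mulr_ge0 D0; rewrite mulr_ge0// exprn_ge0.
  by rewrite mulr_gt0// exprn_gt0// (lt_le_trans ltr01).
pose b3 := 12 * M ^+ 7; have b30 : 0 <= b3 by rewrite mulr_ge0// exprn_ge0.
exists (D3 + D), (b2 + 2 + b3); split; first by rewrite ltr_pwDl.
  by rewrite ltr_pwDl// ltr_pwDr.
move=> e T u r v r2 /andP[e0 e1] eT Hu Hv hr hw vp u0 q0 v0u t tT.
have en n : 0 <= e ^+ n by rewrite exprn_ge0// ltW.
have e0' := ltW e0.
have T0 : 0 <= T by case/andP: tT; exact: le_trans.
have z0 : 0 <= (0 : R) <= T by apply/andP; split.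
pose l := e ^+ 2 * T; have l0 : 0 <= l by rewrite mulr_ge0.
have tl q : 0 <= q <= T -> e ^+ 2 * q <= l by case/andP=> _ qT; rewrite ler_wpM2l.
have te q : 0 <= q <= T -> 0 <= e ^+ 5 * q <= e.
  case/andP=> q0' qT; rewrite mulr_ge0//=.
  rewrite (_ : e ^+ 5 * q = e ^+ 2 * (e ^+ 3 * q)); last by ring.
  rewrite -[leRHS]mulr1 ler_pM ?mulr_ge0//; first by rewrite expr2 ler_piMl.
  by rewrite (le_trans _ eT)// ler_wpM2l.
pose Y (a : tp) := wiener a + 1 * sobolev s a.
have hY : tame K Y := tameX 1 ler01.
have Yle (a : tp) x : sobolev s a <= x -> Y a <= Y0 * x.
  by move=> ax; rewrite /Y mul1r (le_trans (YS a))// ler_wpM2l.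
have growth q : 0 <= q <= T -> Y (u q) <= 3 * K * Y0 * e * expR (b2 * l) /\
    Y (v q) <= 3 * K * Y0 * e * expR (b2 * l).
  move=> qT; have rho0 : 0 <= Y0 * e ^+ 5 by rewrite mulr_ge0.
  have [q0' _] := andP qT; have /andP[_ eq5] := te q qT.
  have Ye : 0 <= Y0 * e by rewrite mulr_ge0.
  have KYe : Y0 * e <= K * (Y0 * e) by rewrite ler_peMl.
  have x1 : Y0 * e ^+ 5 * q <= Y0 * e by rewrite -mulrA ler_wpM2l.
  have x2 : K * (Y0 * e ^+ 5 * q) <= K * (Y0 * e) by rewrite ler_wpM2l.
  have x3 : 0 <= Y0 * e ^+ 5 * q by rewrite mulr_ge0.
  have x4 : Y (u 0) <= Y0 * e by exact: Yle.
  split.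
    have := pair_growth hY rho0 Hu (w := B * e) _ qT => /(_ _)/le_trans; apply.
      by move=> y yT; have [h1 _ _] := hw y yT; have [h2 _] := hr y yT; split => //; exact: Yle.
    rewrite q0 (modnorm0 (tame_modnorm hY)) addr0 (tpos_neg0 q0).
    apply: ler_pM; last first.
    - rewrite ler_expR (_ : 6 * _ * _ * _ = b2 * (e ^+ 2 * q)); last by rewrite /b2; ring.
      by rewrite ler_wpM2l ?tl.
    - rewrite (_ : 3 * K * Y0 * e = 3 * (K * (Y0 * e))); last by ring.
      by rewrite -[2 * K * _ * _]mulrA -[2 * K * _]mulrA; lra.
    - exact: expR_ge0.
    - by rewrite addr_ge0 ?(tame_ge0 hY)// -[2 * K * _ * _]mulrA mulr_ge0// mulr_ge0.
  have := szego_growth hY rho0 Hv (w := B * e) _ qT => /(_ _)/le_trans; apply.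
    by move=> y yT; have [_ h1 _] := hw y yT; have [_ h2] := hr y yT; split => //; exact: Yle.
  rewrite v0u; apply: ler_pM; last first.
  - rewrite ler_expR (_ : 3 * _ * _ * _ = 2^-1 * b2 * (e ^+ 2 * q)); last by rewrite /b2; field.
    apply: ler_pM; [by rewrite mulr_ge0| by rewrite mulr_ge0 | | exact: tl].
    by rewrite ler_piMl// invf_le1// ler1n.
  - rewrite (_ : 3 * K * Y0 * e = 3 * (K * (Y0 * e))); last by ring.
    lra.
  - exact: expR_ge0.
  - by rewrite addr_ge0 ?(tame_ge0 hY).
(* Under this weight [u] and [v] have norm [X] at most [M * e] up to time [T], with [M] independent
   of [T], as [neg_part_bound] demands. *)
pose lam := expR (- (b2 * l)).
have lam0 : 0 < lam by exact: expR_gt0.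
have lam1 : lam <= 1 by rewrite /lam -expR0 ler_expR oppr_le0 mulr_ge0.
pose X (a : tp) := wiener a + lam * sobolev s a.
have hX : tame M X by apply: tame_weaken (tameX _ (ltW lam0)); rewrite /M; lra.
have lamY (a : tp) : wiener a <= B * e -> Y a <= 3 * K * Y0 * e * expR (b2 * l) -> X a <= M * e.
  move=> aw aY; have : sobolev s a <= 3 * K * Y0 * e * expR (b2 * l).
    by apply: le_trans aY; rewrite /Y mul1r lerDr wiener_ge0.
  move=> /(ler_wpM2l (ltW lam0)); rewrite mulrCA -expRD addNr expR0 mulr1 => aS.
  have : 0 <= (K + Y0) * e by rewrite mulr_ge0// addr_ge0.
  rewrite (_ : M * e = B * e + 3 * K * Y0 * e + (K + Y0) * e); last by rewrite /M; ring.
  by rewrite /X; lra.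
have Xr (a : tp) : sobolev s a <= e ^+ 5 -> X a <= M * e ^+ 5.
  move=> ha; have h1 : X a <= Y a.
    by rewrite /X /Y lerD2l ler_wpM2r ?sobolev_ge0.
  by rewrite (le_trans h1)// (le_trans (Yle _ _ ha))// ler_wpM2r// /M; lra.
(* The normal form bound [e^3 + e^5 t] is [e^3 (1 + e^2 t)], and [1 + l <= expR l]. *)
have Xq q : 0 <= q <= T -> X (tneg (u q)) <= D * e ^+ 3 * expR l.
  move=> qT; have [q0' _] := andP qT.
  have := neg_part_bound hX e0 e1 eT Hu _ q0 qT => /(_ _)/le_trans; apply.
    move=> y yT; have [h1 h2 h3] := hw y yT; have [h4 h5] := hr y yT; have [h6 h7] := growth y yT.
    by split => //; [exact: lamY | exact: Xr].
  rewrite -/E.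
  have m12 : M ^+ 12 <= M ^+ 19 by exact: ler_weXn2l.
  set z := M ^+ 19 * E * e ^+ 3.
  have z1 : 0 <= z by rewrite mulr_ge0//; exact: mulr_ge0.
  have a0 : M ^+ 12 * e ^+ 3 <= M ^+ 19 * e ^+ 3 by rewrite ler_wpM2r.
  have a1 : M ^+ 12 * e ^+ 3 * E <= z by rewrite mulrAC ler_wpM2r// ler_wpM2r.
  have a2 : M ^+ 12 * e ^+ 3 <= z.
    apply: le_trans a1; rewrite ler_peMr// mulr_ge0// exprn_ge0//.
  have a3 : z * (e ^+ 2 * q) <= z * l by rewrite ler_wpM2l ?tl.
  have a4 := ler_wpM2l z1 (expR_ge1Dx l).
  rewrite (_ : D * e ^+ 3 * expR l = 230 * (z * expR l)); last by rewrite /D /z; ring.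
  rewrite (_ : _ + _ = 8 * (M ^+ 12 * e ^+ 3 * E) + 230 * (z * (e ^+ 2 * q)) + 8 * (M ^+ 12 *
    e ^+ 3)); last first.
    by rewrite /z; ring.
  by rewrite mulrDr mulr1 in a4; lra.
(* Both terms solve the Szego equation up to errors, with equal initial data. The negative part of
   [u], of size [e^3 expR l], forces [w] at order [e^2 * e^3], and integrating this in time costs a
   factor at most [l]. *)
pose w q := tpos (u q) - v q.
pose f q := forcing_pos (u q) (r q) - (- tcst iC * (tpos (cubic_tp (v q)) + r2 q)).
have Xw q : 0 <= q <= T -> X (w q) <= D3 * e ^+ 3 * expR ((2 + b3) * l).
  have c0 : 0 <= D3 * e ^+ 5 * expR l by rewrite mulr_ge0 ?expR_ge0// mulr_ge0// ltW.
  have bb0 : 0 <= b3 * e ^+ 2 by rewrite mulr_ge0.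
  move=> qT; have [q0' _] := andP qT.
  have wd y : 0 <= y <= T -> tderiv w y (tcst (- (iC * 1%:C)) * tD (w y) + f y).
    move=> yT; have := tderivB (hw_pos_deriv Hu yT) (Hv y yT).
    rewrite (_ : _ - _ = tcst (- (iC * 1%:C)) * tD (w y) + f y)//.
    by rewrite mulr1 tcstN /w /f /tD tmultB; ring.
  have fb y : 0 <= y <= T -> X (f y) <= b3 * e ^+ 2 * X (w y) + D3 * e ^+ 5 * expR l.
    move=> yT; have [h1 h2 h3] := hw y yT; have [h4 h5] := hr y yT; have [h6 h7] := growth y yT.
    rewrite (_ : f y = - (tcst iC * (tpos (cubic_tp (u y) - cubic_tp (v y) + r y) - r2 y)));
      last first.
      by rewrite /f /forcing_pos /tpos !(tmultD, tmultN); ring.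
    have Xuv : X (u y - v y) <= X (w y) + D * e ^+ 3 * expR l.
      rewrite -{1}(tpos_tneg (u y)) (_ : _ - _ = w y + tneg (u y)); last by rewrite /w; ring.
      by apply: (tame_add hX) => //; exact: Xq.
    have cd := cubic_diff_le hX (lamY _ h1 h6) (lamY _ h2 h7) Xuv.
    apply: (tame_opp hX).
    have tot := tame_scal hX cmod_iC_le1 (tame_sub hX (tame_posle hX (tame_add hX cd (Xr _
      h4))) (Xr _ h5)).
    apply: le_trans tot _.
    have m12 : M * e ^+ 5 <= M ^+ 2 * e ^+ 5 by rewrite ler_wpM2r// expr2 ler_peMl.
    have g1 : M ^+ 2 * e ^+ 5 <= M ^+ 2 * e ^+ 5 * expR l.
      by rewrite ler_peMr ?expR_ge1// mulr_ge0// exprn_ge0.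
    rewrite (_ : M * _ = b3 * e ^+ 2 * X (w y) + 12 * M ^+ 7 * D * e ^+ 5 * expR l + M ^+ 2 *
      e ^+ 5); last first.
      by rewrite /b3; ring.
    rewrite (_ : D3 * e ^+ 5 * expR l = 12 * M ^+ 7 * D * e ^+ 5 * expR l + 2 * (M ^+ 2 * e
      ^+ 5 * expR l)).
      by lra.
    by rewrite /D3; ring.
  have := gronwall_curve_bound (tame_modnorm hX) bb0 c0 wd (fun y _ => erefl) fb qT.
  move=> /le_trans; apply.
  have -> : w 0 = 0 by rewrite /w v0u (tpos_neg0 q0) subrr.
  rewrite (modnorm0 (tame_modnorm hX)) add0r.
  have g1 : e ^+ 2 * q <= expR l.
    by rewrite (le_trans (tl q qT))// (le_trans _ (expR_ge1Dx l))// lerDr.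
  have g2 : expR (b3 * e ^+ 2 * q) <= expR (b3 * l) by rewrite ler_expR -mulrA ler_wpM2l ?tl.
  rewrite (mulrDl 2 b3 l) expRD (_ : expR (2 * l) = expR l * expR l); last by rewrite -expRD;
    congr expR; ring.
  rewrite (_ : D3 * e ^+ 3 * _ = (D3 * e ^+ 3 * expR l * expR l) * expR (b3 * l)); last by ring.
  apply: ler_pM; [by rewrite mulr_ge0 | exact: expR_ge0 | | exact: g2].
  rewrite (_ : D3 * e ^+ 5 * _ * _ = D3 * e ^+ 3 * expR l * (e ^+ 2 * q)); last by ring.
  by rewrite ler_wpM2l// mulr_ge0 ?expR_ge0// mulr_ge0// ltW.
have Xuv : X (u t - v t) <= D3 * e ^+ 3 * expR ((2 + b3) * l) + D * e ^+ 3 * expR l.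
  rewrite -{1}(tpos_tneg (u t)) (_ : _ - _ = w t + tneg (u t)); last by rewrite /w; ring.
  by apply: (tame_add hX); [exact: Xw | exact: Xq].
have h1 : lam * sobolev s (u t - v t) <= (D3 + D) * e ^+ 3 * expR ((2 + b3) * l).
  apply: le_trans (_ : X (u t - v t) <= _); first by rewrite lerDr wiener_ge0.
  apply: le_trans Xuv _; rewrite [(D3 + D) * _]mulrDl [leRHS]mulrDl lerD2l.
  rewrite ler_wpM2l ?mulr_ge0// ler_expR -{1}[l]mul1r ler_wpM2r//; lra.
(* Undoing the weight multiplies by [expR (b2 * l)], which accounts for [b2] in the exponent
   [b2 + 2 + b3]. *)
have h2 : sobolev s (u t - v t) = expR (b2 * l) * (lam * sobolev s (u t - v t)).
  by rewrite mulrA -expRD subrr expR0 mul1r.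
rewrite h2 (_ : (b2 + 2 + b3) * _ = b2 * l + (2 + b3) * l); last by rewrite /l; ring.
by rewrite expRD [leRHS]mulrCA ler_wpM2l ?expR_ge0.
Qed.

End Comparison.

(** * Fourier series of functions on the torus *)

Section ComplexLimits.
Context {R : realType}.
Implicit Types z w : nat -> R[i].

Definition ccvg z (l : R[i]) :=
  complex.Re (z n) @[n --> \oo] --> complex.Re l /\
  complex.Im (z n) @[n --> \oo] --> complex.Im l.

Lemma ReD (x y : R[i]) : complex.Re (x + y) = complex.Re x + complex.Re y.
Proof. by case: x y => ? ? []. Qed.
Lemma ImD (x y : R[i]) : complex.Im (x + y) = complex.Im x + complex.Im y.
Proof. by case: x y => ? ? []. Qed.
Lemma ReN (x : R[i]) : complex.Re (- x) = - complex.Re x.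
Proof. by case: x. Qed.
Lemma ImN (x : R[i]) : complex.Im (- x) = - complex.Im x.
Proof. by case: x. Qed.
Lemma ReM (x y : R[i]) :
  complex.Re (x * y) = complex.Re x * complex.Re y - complex.Im x * complex.Im y.
Proof. by case: x y => ? ? []. Qed.
Lemma ImM (x y : R[i]) :
  complex.Im (x * y) = complex.Re x * complex.Im y + complex.Im x * complex.Re y.
Proof. by case: x y => ? ? []. Qed.
Lemma Re_conj (x : R[i]) : complex.Re (x^*)%C = complex.Re x.
Proof. by case: x. Qed.
Lemma Im_conj (x : R[i]) : complex.Im (x^*)%C = - complex.Im x.
Proof. by case: x. Qed.

Lemma ccvg_cst l : ccvg (fun=> l) l.
Proof. by split; exact: cvg_cst. Qed.

Lemma ccvgD z w l m : ccvg z l -> ccvg w m -> ccvg (fun n => z n + w n) (l + m).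
Proof.
move=> [a b] [c d]; split; rewrite ?ReD ?ImD.
  by under eq_fun do rewrite ReD; exact: cvgD.
by under eq_fun do rewrite ImD; exact: cvgD.
Qed.

Lemma ccvgM z w l m : ccvg z l -> ccvg w m -> ccvg (fun n => z n * w n) (l * m).
Proof.
move=> [a b] [c d]; split; rewrite ?ReM ?ImM.
  by under eq_fun do rewrite ReM; apply: cvgB; exact: cvgM.
by under eq_fun do rewrite ImM; apply: cvgD; exact: cvgM.
Qed.

Lemma ccvg_conj z l : ccvg z l -> ccvg (fun n => (z n)^*%C) (l^*)%C.
Proof.
move=> [a b]; split; rewrite ?Re_conj ?Im_conj.
  by under eq_fun do rewrite Re_conj.
by under eq_fun do rewrite Im_conj; exact: cvgN.
Qed.

Lemma cmodE (x : R[i]) : cmod x = Num.sqrt (complex.Re x ^+ 2 + complex.Im x ^+ 2).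
Proof. by case: x. Qed.

Lemma ccvg_cmod z l : ccvg z l -> cmod (z n) @[n --> \oo] --> cmod l.
Proof.
move=> [a b]; rewrite cmodE; under eq_fun do rewrite cmodE.
have h : complex.Re (z n) ^+ 2 + complex.Im (z n) ^+ 2 @[n --> \oo] -->
    complex.Re l ^+ 2 + complex.Im l ^+ 2 by rewrite !expr2; apply: cvgD; exact: cvgM.
exact: cvg_comp h (@sqrt_continuous R _).
Qed.

Lemma ccvg_bound z l C : ccvg z l -> (forall n, cmod (z n) <= C) -> cmod l <= C.
Proof.
move=> /ccvg_cmod zl zC; apply: (cvgr_to_le zl).
by apply: nearW => n; exact: zC.
Qed.

Lemma ccvg_unique z l m : ccvg z l -> ccvg z m -> l = m.
Proof.
move=> [a b] [c d]; apply/eqP; rewrite eq_complex; apply/andP; split; apply/eqP.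
  exact: (cvg_unique _ a c).
exact: (cvg_unique _ b d).
Qed.

End ComplexLimits.

Section ComplexIntegral.
Context {R : realType}.
Local Notation mu := (@lebesgue_measure R).
Local Notation P := (@period R).
Implicit Types f g : R -> R[i].

Lemma measurable_period : measurable P.
Proof. exact: measurable_itv. Qed.
Hint Resolve measurable_period : core.

Lemma pi2_gt0 : 0 < 2 * pi :> R.
Proof. by rewrite mulr_gt0 ?pi_gt0. Qed.

Lemma period_measure : mu P = (2 * pi)%:E.
Proof.
by rewrite /period lebesgue_measure_itv /= lte_fin pi2_gt0 oppr0 adde0.
Qed.

Lemma integrable_cst_period (c : R) : mu.-integrable P (EFin \o cst c).
Proof.
apply: measurable_bounded_integrable => //; first by rewrite [X in (X < _)%E]period_measure ltry.
exists `|c|; split; first by rewrite num_real.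
by move=> M cM x _ /=; exact: ltW.
Qed.

Definition cmeasurable f :=
  measurable_fun [set: R] (fun x => complex.Re (f x)) /\ measurable_fun [set: R] (fun x =>
    complex.Im (f x)).

Lemma cmeasurable_cst z : cmeasurable (fun=> z).
Proof. by split; exact: measurable_cst. Qed.

Lemma cmeasurableD f g : cmeasurable f -> cmeasurable g ->
  cmeasurable (fun x => f x + g x).
Proof.
move=> [a b] [c d]; split.
  rewrite [X in measurable_fun _ X](_ : _ = (fun x => complex.Re (f x)) \+ (fun x =>
    complex.Re (g x))).
    exact: measurable_funD.
  by apply/funext => x; rewrite /= ReD.
rewrite [X in measurable_fun _ X](_ : _ = (fun x => complex.Im (f x)) \+ (fun x =>
  complex.Im (g x))).
  exact: measurable_funD.
by apply/funext => x; rewrite /= ImD.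
Qed.

Lemma cmeasurableM f g : cmeasurable f -> cmeasurable g ->
  cmeasurable (fun x => f x * g x).
Proof.
move=> [a b] [c d]; split.
  rewrite [X in measurable_fun _ X](_ : _ =
    (fun x => complex.Re (f x) * complex.Re (g x) - complex.Im (f x) * complex.Im (g x))).
    by apply: measurable_funB; exact: measurable_funM.
  by apply/funext => x; rewrite /= ReM.
rewrite [X in measurable_fun _ X](_ : _ =
  (fun x => complex.Re (f x) * complex.Im (g x) + complex.Im (f x) * complex.Re (g x))).
  by apply: measurable_funD; exact: measurable_funM.
by apply/funext => x; rewrite /= ImM.
Qed.

Lemma cmeasurable_conj f : cmeasurable f -> cmeasurable (fun x => (f x)^*%C).
Proof.
move=> [a b]; split.
  by under [X in measurable_fun _ X]eq_fun do rewrite /= Re_conj.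
under [X in measurable_fun _ X]eq_fun do rewrite /= Im_conj.
exact: measurableT_comp.
Qed.

Lemma cmeasurable_cmod f : cmeasurable f -> measurable_fun [set: R] (fun x => cmod (f x)).
Proof.
move=> [a b].
under [X in measurable_fun _ X]eq_fun do rewrite cmodE.
apply: measurableT_comp; first by apply: continuous_measurable_fun; exact: sqrt_continuous.
by apply: measurable_funD; apply: measurable_funX.
Qed.

Lemma cmeasurable_cvg (f_ : nat -> R -> R[i]) f : (forall n, cmeasurable (f_ n)) ->
  (forall x, ccvg (f_^~ x) (f x)) -> cmeasurable f.
Proof.
move=> mf fx; split.
  apply: (@measurable_fun_cvg _ _ _ _ (fun n => (fun x => complex.Re (f_ n x)))).
    by move=> n; exact: (mf n).1.
  by move=> x _; exact: (fx x).1.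
apply: (@measurable_fun_cvg _ _ _ _ (fun n => (fun x => complex.Im (f_ n x)))).
  by move=> n; exact: (mf n).2.
by move=> x _; exact: (fx x).2.
Qed.

Definition cintegrable f :=
  cmeasurable f /\ mu.-integrable P (EFin \o (fun x => cmod (f x))).

Lemma cintegrable_le f (g : R -> R) : cmeasurable f -> mu.-integrable P (EFin \o g) ->
  (forall x, P x -> cmod (f x) <= g x) -> cintegrable f.
Proof.
move=> mf ig fg; split=> //; apply: le_integrable ig => //.
  by apply/measurable_EFinP/measurable_funTS; exact: cmeasurable_cmod.
move=> x Px /=; rewrite lee_fin ger0_norm ?cmod_ge0//.
exact: le_trans (fg x Px) (ler_norm _).
Qed.

Lemma cintegrable_bounded f C : cmeasurable f -> (forall x, cmod (f x) <= C) -> cintegrable f.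
Proof. by move=> mf fC; apply: cintegrable_le (integrable_cst_period C) _ => // x _. Qed.

Lemma cintegrable_Re f : cintegrable f -> mu.-integrable P (EFin \o (fun x => complex.Re (f x))).
Proof.
move=> [[mr mi] i]; apply: le_integrable i => //.
  by apply/measurable_EFinP/measurable_funTS.
by move=> x _ /=; rewrite lee_fin (ger0_norm (cmod_ge0 _)) Re_le_cmod.
Qed.

Lemma cintegrable_Im f : cintegrable f -> mu.-integrable P (EFin \o (fun x => complex.Im (f x))).
Proof.
move=> [[mr mi] i]; apply: le_integrable i => //.
  by apply/measurable_EFinP/measurable_funTS.
by move=> x _ /=; rewrite lee_fin (ger0_norm (cmod_ge0 _)) Im_le_cmod.
Qed.

Lemma cintegrableD f g : cintegrable f -> cintegrable g ->
  cintegrable (fun x => f x + g x).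
Proof.
move=> [mf fi] [mg gi].
apply: (@cintegrable_le _ (fun x => cmod (f x) + cmod (g x))).
- exact: cmeasurableD.
- exact: integrableD fi gi.
- by move=> x _; exact: cmodD.
Qed.

Lemma cintegrableM f g C : cintegrable f -> cmeasurable g -> (forall x, cmod (g x) <= C) ->
  cintegrable (fun x => f x * g x).
Proof.
move=> [mf fi] mg gC.
apply: (@cintegrable_le _ (fun x => C * cmod (f x))).
- exact: cmeasurableM.
- exact: (integrableZl _ C fi).
- by move=> x _; rewrite cmodM mulrC ler_wpM2r ?cmod_ge0.
Qed.

Lemma cintegrableZ z f : cintegrable f -> cintegrable (fun x => z * f x).
Proof.
move=> fi; under [X in cintegrable X]eq_fun do rewrite mulrC.
apply: (@cintegrableM _ _ (cmod z)) => //; exact: cmeasurable_cst.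
Qed.

Lemma cintegrable_L2 f : L2_torus f -> cintegrable f.
Proof.
move=> [_ mr mi L2].
have mf : cmeasurable f by [].
apply: (@cintegrable_le _ (fun x => 1 + cmod (f x) ^+ 2)) => //.
  have i2 : mu.-integrable P (EFin \o (fun x => cmod (f x) ^+ 2)).
    apply/integrableP; split.
      by apply/measurable_EFinP/measurable_funTS/measurable_funX; exact: cmeasurable_cmod.
    under eq_integral do rewrite /= ger0_norm ?sqr_ge0//.
    exact: L2.
  exact: (integrableD _ (integrable_cst_period 1) i2).
by move=> x _; have := cmod_ge0 (f x); nra.
Qed.

Lemma cintegralD f g : cintegrable f -> cintegrable g ->
  cintegral P (fun x => f x + g x) = cintegral P f + cintegral P g.
Proof.
move=> fi gi; rewrite /cintegral; apply/eqP; rewrite eq_complex /=.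
under eq_Rintegral do rewrite ReD.
rewrite RintegralD ?eqxx//=; try exact: cintegrable_Re.
under eq_Rintegral do rewrite ImD.
by rewrite RintegralD//; exact: cintegrable_Im.
Qed.

Lemma cintegralZ z f : cintegrable f ->
  cintegral P (fun x => z * f x) = z * cintegral P f.
Proof.
move=> fi; have ir := cintegrable_Re fi; have ii := cintegrable_Im fi.
rewrite /cintegral; case: z => a b; apply/eqP; rewrite eq_complex /=.
apply/andP; split; apply/eqP.
  under eq_Rintegral do rewrite ReM /=.
  rewrite RintegralB//; last 2 first.
  - exact: (integrableZl _ a ir).
  - exact: (integrableZl _ b ii).
  by rewrite !RintegralZl.
under eq_Rintegral do rewrite ImM /=.
rewrite RintegralD//; last 2 first.
- exact: (integrableZl _ a ii).
- exact: (integrableZl _ b ir).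
by rewrite !RintegralZl.
Qed.

Lemma eq_cintegral f g : {in P, f =1 g} -> cintegral P f = cintegral P g.
Proof.
move=> fg; congr (_ +i* _); apply: eq_Rintegral => x Px; by rewrite fg.
Qed.

Lemma cintegrable0 : cintegrable (fun=> 0).
Proof.
by apply: (@cintegrable_bounded _ 0); [exact: cmeasurable_cst|move=> x; rewrite cmod0].
Qed.

Lemma cintegral0 : cintegral P (fun=> 0) = 0.
Proof. by have := cintegralZ 0 cintegrable0; rewrite !mul0r. Qed.

Lemma cintegral_sum (I : Type) (r : seq I) (F : I -> R -> R[i]) :
  (forall i, cintegrable (F i)) ->
  cintegrable (fun x => \sum_(i <- r) F i x) /\
  cintegral P (fun x => \sum_(i <- r) F i x) = \sum_(i <- r) cintegral P (F i).
Proof.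
move=> iF; elim: r => [|i r [ih1 ih2]].
  under eq_fun do rewrite big_nil; rewrite big_nil; split; [exact: cintegrable0|exact: cintegral0].
under eq_fun do rewrite big_cons; split; first exact: cintegrableD.
by rewrite cintegralD// big_cons ih2.
Qed.

Lemma cintegral_cvg (f_ : nat -> R -> R[i]) f (g : R -> R) :
  (forall n, cmeasurable (f_ n)) -> cmeasurable f ->
  mu.-integrable P (EFin \o g) ->
  {ae mu, forall x, P x -> ccvg (f_^~ x) (f x)} ->
  (forall n x, P x -> cmod (f_ n x) <= g x) ->
  ccvg (fun n => cintegral P (f_ n)) (cintegral P f).
Proof.
move=> mf_ mf ig ae_cvg fg.
have key (F : R[i] -> R) : (forall h, cmeasurable h -> measurable_fun [set: R] (F \o h)) ->
    (forall z w, ccvg z w -> F (z n) @[n --> \oo] --> F w) ->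
    (forall z, `|F z| <= cmod z) ->
    Rintegral mu P (fun x => F (f_ n x)) @[n --> \oo] --> Rintegral mu P (fun x => F (f x)).
  move=> mF cF Fc.
  have mF_ n : measurable_fun P (fun x => (F (f_ n x))%:E).
    by apply/measurable_EFinP; apply: measurable_funTS; exact: (mF _ (mf_ n)).
  have mFf : measurable_fun P (fun x => (F (f x))%:E).
    by apply/measurable_EFinP; apply: measurable_funTS; exact: (mF _ mf).
  have cvgF : {ae mu, forall x, P x -> (F (f_ n x))%:E @[n --> \oo] --> (F (f x))%:E}.
    apply: (@filterS _ _ (ae_filter_ringOfSetsType mu) _ _ _ ae_cvg) => x h Px;
      apply/fine_cvgP; split; first exact: nearW.
    exact: cF (h Px).
  have domF : {ae mu, forall x n, P x -> (`|(F (f_ n x))%:E| <= (EFin \o g) x)%E}.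
    by apply: aeW => x n Px /=; rewrite lee_fin (le_trans (Fc _))// fg.
  have [fi _ cvgi] := @dominated_convergence _ _ R mu P measurable_period
    (fun n x => (F (f_ n x))%:E) _ (EFin \o g) mF_ mFf cvgF ig domF.
  have fin : (\int[mu]_(x in P) (F (f x))%:E)%E \is a fin_num by exact: integrable_fin_num.
  by apply: fine_cvg; rewrite fineK.
split; apply: key => [h [a b]//|z w [a b]//|z].
- exact: Re_le_cmod.
- exact: Im_le_cmod.
Qed.

End ComplexIntegral.
#[export] Hint Resolve measurable_period : core.

Section TrigEvaluation.
Context {R : realType}.
Local Notation tp := (trigpoly R).
Local Notation mu := (@lebesgue_measure R).
Local Notation P := (@period R).
Implicit Types a b : tp.

Lemma cexpi_2piM (k : int) : cexpi (k%:~R * (2 * pi)) = 1 :> R[i].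
Proof.
have nat_case n : cexpi (n%:R * (2 * pi)) = 1 :> R[i].
  elim: n => [|n ih]; first by rewrite mul0r cexpi0.
  rewrite -addn1 natrD mulrDl cexpiD ih mul1r mul1r.
  by rewrite /cexpi mulr_natl cos2pi sin2pi.
case: k => n; first exact: nat_case.
by rewrite NegzE rmorphN mulNr -conj_cexpi nat_case conjc1.
Qed.

Lemma sin_2piM (k : int) : sin (k%:~R * (2 * pi)) = 0 :> R.
Proof. by have /(congr1 (@complex.Im R)) := cexpi_2piM k. Qed.

Lemma cos_2piM (k : int) : cos (k%:~R * (2 * pi)) = 1 :> R.
Proof. by have /(congr1 (@complex.Re R)) := cexpi_2piM k. Qed.

Lemma is_derive_lin (c x : R) : is_derive x 1 (fun r : R => c * r) c.
Proof. by apply: is_derive_eq; rewrite /GRing.scale /= mulr1. Qed.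

Lemma is_derive_cosM (c x : R) : is_derive x 1 (fun r => cos (c * r)) (- (c * sin (c * x))).
Proof.
have h := @is_derive1_comp R cos (fun r => c * r) x _ _ (is_derive_cos _) (is_derive_lin c x).
by apply: is_derive_eq h _; rewrite mulNr mulrC.
Qed.

Lemma is_derive_sinM (c x : R) : is_derive x 1 (fun r => sin (c * r)) (c * cos (c * x)).
Proof.
have h := @is_derive1_comp R sin (fun r => c * r) x _ _ (is_derive_sin _) (is_derive_lin c x).
by apply: is_derive_eq h _; rewrite mulrC.
Qed.

Lemma is_derive_continuous (F f : R -> R) : (forall x : R, is_derive x 1 F (f x)) ->
  continuous F.
Proof.
move=> dF x; apply/differentiable_continuous/derivable1_diffP.
by have [] := dF x.
Qed.

Lemma continuous_cosM (c : R) : continuous (fun x => cos (c * x)).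
Proof. exact: is_derive_continuous (is_derive_cosM c). Qed.

Lemma continuous_sinM (c : R) : continuous (fun x => sin (c * x)).
Proof. exact: is_derive_continuous (is_derive_sinM c). Qed.

Lemma Rintegral_derivative (F f : R -> R) (a b : R) : a < b ->
  (forall x : R, is_derive x 1 F (f x)) -> continuous f ->
  Rintegral mu `[a, b]%classic f = F b - F a.
Proof.
move=> ab dF cf; rewrite /Rintegral (@continuous_FTC2 _ f F)//.
- exact: continuous_subspaceT.
- have cF := is_derive_continuous dF; split.
  + by move=> x _; have [] := dF x.
  + exact: cvg_at_right_filter (cF a).
  + exact: cvg_at_left_filter (cF b).
- by move=> x _; rewrite derive1E; have [] := dF x.
Qed.

Lemma Rintegral_cosM (k : int) : k != 0 -> Rintegral mu P (fun x => cos (k%:~R * x)) = 0.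
Proof.
move=> k0; have kR : k%:~R != 0 :> R by rewrite intr_eq0.
have dF (x : R) : is_derive x 1 (fun x : R => k%:~R^-1 * sin (k%:~R * x)) (cos (k%:~R * x)).
  have h := is_deriveZ k%:~R^-1 (is_derive_sinM k%:~R x).
  by apply: is_derive_eq h _; rewrite /GRing.scale /= mulKf.
rewrite (Rintegral_derivative pi2_gt0 dF (@continuous_cosM _)).
by rewrite sin_2piM !mulr0 sin0 mulr0 subr0.
Qed.

Lemma Rintegral_sinM (k : int) : Rintegral mu P (fun x => sin (k%:~R * x)) = 0.
Proof.
have [->|k0] := eqVneq k 0.
  rewrite (@eq_Rintegral _ _ _ _ _ (cst 0)) => [|x _]; last by rewrite mul0r sin0.
  by rewrite Rintegral_cst ?mul0r//; exact: measurable_period.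
have kR : k%:~R != 0 :> R by rewrite intr_eq0.
have dF (x : R) : is_derive x 1 (fun x : R => - k%:~R^-1 * cos (k%:~R * x)) (sin (k%:~R * x)).
  have h := is_deriveZ (- k%:~R^-1) (is_derive_cosM k%:~R x).
  by apply: is_derive_eq h _; rewrite /GRing.scale /= mulrNN mulKf.
rewrite (Rintegral_derivative pi2_gt0 dF (@continuous_sinM _)).
by rewrite cos_2piM !mulr0 cos0 subrr.
Qed.

Lemma cintegral_cexpi (k : int) : cintegral P (fun x => cexpi (k%:~R * x)) =
  if k == 0 then (2 * pi)%:C else 0.
Proof.
rewrite /cintegral /= Rintegral_sinM; case: eqP => [->|/eqP k0]; last by rewrite Rintegral_cosM.
rewrite (@eq_Rintegral _ _ _ _ _ (cst 1)) => [|x _]; last by rewrite mul0r cos0.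
by rewrite Rintegral_cst ?[X in fine X]period_measure ?mul1r//; exact: measurable_period.
Qed.

Lemma cmeasurable_cexpi (c : R) : cmeasurable (fun x => cexpi (c * x)).
Proof.
split; apply: continuous_measurable_fun; [exact: continuous_cosM|exact: continuous_sinM].
Qed.

Lemma cintegrable_cexpi (c : R) : cintegrable (fun x => cexpi (c * x)).
Proof.
apply: (@cintegrable_bounded _ _ 1); first exact: cmeasurable_cexpi.
by move=> x; rewrite cmod_cexpi.
Qed.

Definition teval a (x : R) : R[i] := zsum (fun k => a k * cexpi (k%:~R * x)).

Lemma tevalE n a x : supported n a ->
  teval a x = \sum_(k <- intball n) a k * cexpi (k%:~R * x).
Proof. by move=> an; rewrite /teval (@zsumE _ n)// => k /an ->; rewrite mul0r. Qed.

Lemma tevalD a b x : teval (a + b) x = teval a x + teval b x.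
Proof.
rewrite /teval -zsumD; try exact: conv_finsupp.
by apply: eq_zsum => k; rewrite tpDE mulrDl.
Qed.

Lemma teval_cst z x : teval (tcst z) x = z.
Proof.
rewrite /teval (@zsum_delta _ 0); first by rewrite tcstE eqxx mul0r cexpi0 mulr1.
by move=> k /negPf k0; rewrite tcstE k0 mul0r.
Qed.

Lemma tevalM a b x : teval (a * b) x = teval a x * teval b x.
Proof.
have [n an] := tp_supp a; have [m bm] := tp_supp b.
rewrite /teval mulr_zsuml.
under eq_zsum do rewrite tpME mulr_zsuml.
rewrite (@zsum_exchange _ (n + m)); last first.
  move=> k l h; have [ln|ln] := ltnP n `|l|%N; first by rewrite an// !mul0r.
  by rewrite bm ?mulr0 ?mul0r//; lia.
apply: eq_zsum => l; rewrite (zsum_shift l) mulr_zsumr; apply: eq_zsum => k.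
by rewrite addrK intrD mulrDl cexpiD; ring.
Qed.

Lemma tevalN a x : teval (- a) x = - teval a x.
Proof. by rewrite -mulN1r -tcst1 -tcstN tevalM teval_cst mulN1r. Qed.

Lemma tevalB a b x : teval (a - b) x = teval a x - teval b x.
Proof. by rewrite tevalD tevalN. Qed.

Lemma teval_bar a x : teval (tbar a) x = ((teval a x)^*)%C.
Proof.
have [n an] := tp_supp a.
rewrite (tevalE _ an) conj_sum -(@zsumE _ n) => [|k /an ->]; last by rewrite mul0r conjc0.
rewrite /teval (zsum_opp (fun k => ((a k * _)^*)%C)); apply: eq_zsum => k.
rewrite tbarE rmorphM; congr (_ * _); rewrite [RHS]conj_cexpi.
by congr cexpi; rewrite rmorphN; ring.
Qed.

Lemma cmod_teval a x : cmod (teval a x) <= wiener a.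
Proof.
have [n an] := tp_supp a; rewrite (tevalE _ an) (wienerE an) (le_trans (cmod_sum _ _ _))//.
by apply: ler_sum => k _; rewrite cmodM cmod_cexpi mulr1.
Qed.

Lemma teval_sum_cintegrable a : cintegrable (teval a).
Proof.
have [n an] := tp_supp a; rewrite (funext (fun x => tevalE x an)).
by apply: (cintegral_sum _ _).1 => k; exact/cintegrableZ/cintegrable_cexpi.
Qed.

Lemma cmeasurable_teval a : cmeasurable (teval a).
Proof. by have [] := teval_sum_cintegrable a. Qed.

Lemma teval_cubic a x : teval (cubic_tp a) x = teval a x * (teval a x)^*%C * teval a x.
Proof. by rewrite /cubic_tp !tevalM teval_bar. Qed.

Lemma fourier_teval a k : fourier (teval a) k = a k.
Proof.
have [n an] := tp_supp a; rewrite /fourier.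
rewrite (_ : (fun x => _) = (fun x => \sum_(j <- intball n)
    a j * cexpi ((j - k)%:~R * x))); last first.
  apply/funext => x; rewrite (tevalE _ an) mulr_suml; apply: eq_bigr => j _.
  by rewrite -mulrA -cexpiD -mulrBl -rmorphB.
rewrite (cintegral_sum _ _).2; last by move=> j; exact/cintegrableZ/cintegrable_cexpi.
under eq_bigr => j _.
  rewrite cintegralZ ?cintegral_cexpi ?subr_eq0; last exact: cintegrable_cexpi.
  over.
rewrite -(@zsumE _ n) => [|j /an ->]; last by rewrite mul0r.
rewrite (@zsum_delta _ k) => [|j /negPf ->]; last by rewrite mulr0.
rewrite eqxx mulrCA -rmorphM /= mulVf ?mulr1//.
by rewrite gt_eqF// pi2_gt0.
Qed.

End TrigEvaluation.

(** * Uniqueness of the Fourier coefficients of integrable functions *)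

Section Bernoulli.
Context {R : realType}.
Implicit Types t : R.

Lemma bernoulli_ge t (n : nat) : 0 <= t -> 1 + n%:R * t <= (1 + t) ^+ n.
Proof.
move=> t0; elim: n => [|n ih]; first by rewrite mul0r addr0.
rewrite exprS -addn1 natrD; apply: le_trans (ler_wpM2l _ ih); last by rewrite addr_ge0.
have : 0 <= n%:R * t * t by rewrite !mulr_ge0.
by lra.
Qed.

Lemma bernoulli_le t (n : nat) : 0 <= t <= 1 -> 1 - n%:R * t <= (1 - t) ^+ n.
Proof.
move=> /andP[t0 t1]; elim: n => [|n ih]; first by rewrite mul0r subr0.
rewrite exprS -addn1 natrD; apply: le_trans (ler_wpM2l _ ih); last by rewrite subr_ge0.
have : 0 <= n%:R * t * t by rewrite !mulr_ge0.
by lra.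
Qed.

(* The double exponent turns the threshold y = 1/2 into a sharp cut-off. *)
Definition cutoff (n : nat) (y : R) := (1 - y ^+ n) ^+ (2 ^ n).

Lemma cutoff_itv n y : 0 <= y <= 1 -> 0 <= cutoff n y <= 1.
Proof.
move=> /andP[y0 y1]; have h0 : 0 <= y ^+ n by rewrite exprn_ge0.
have h1 : y ^+ n <= 1 by rewrite exprn_ile1.
by rewrite /cutoff exprn_ge0 ?subr_ge0//= exprn_ile1 ?subr_ge0// gerBl.
Qed.

(** Bernoulli's inequality gives [cutoff n y >= 1 - (2 y)^n]. *)
Lemma cutoff_cvg1 y : 0 <= y -> y < 2^-1 -> cutoff n y @[n --> \oo] --> (1 : R).
Proof.
move=> y0 y1; have y01 : 0 <= y <= 1 by rewrite y0/=; lra.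
have c0 : (2 * y) ^+ n @[n --> \oo] --> (0 : R).
  by apply: cvg_expr; rewrite ger0_norm ?mulr_ge0//; lra.
have c1 : 1 - (2 * y) ^+ n @[n --> \oo] --> (1 : R).
  by rewrite -[X in _ --> X]subr0; apply: cvgB => //; exact: cvg_cst.
have c2 : (1 : R) @[n --> \oo] --> (1 : R) by exact: cvg_cst.
apply: (squeeze_cvgr _ c1 c2).
apply: nearW => n; rewrite (andP (cutoff_itv n y01)).2 andbT.
rewrite exprMn -natrX; apply: bernoulli_le.
by rewrite exprn_ge0//= exprn_ile1//; case/andP: y01.
Qed.

(** Since [(1 - y^n) (1 + y^n) <= 1], the cutoff is at most the inverse of [(1 + y^n)^(2^n)], which
    is at least [(2 y)^n] by Bernoulli's inequality. *)
Lemma cutoff_cvg0 y : 2^-1 < y -> y <= 1 -> cutoff n y @[n --> \oo] --> (0 : R).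
Proof.
move=> y0 y1; have y01 : 0 <= y <= 1 by rewrite y1 andbT; lra.
have [yge0 _] := andP y01.
have c0 : ((2 * y)^-1) ^+ n @[n --> \oo] --> (0 : R).
  apply: cvg_expr; rewrite ger0_norm ?invr_ge0 ?mulr_ge0// invf_lt1 ?mulr_gt0//; lra.
have c2 : (0 : R) @[n --> \oo] --> (0 : R) by exact: cvg_cst.
apply: (squeeze_cvgr _ c2 c0).
apply: nearW => n; rewrite (andP (cutoff_itv n y01)).1/= exprVn.
have p0 : 0 < (2 * y) ^+ n by rewrite exprn_gt0//; lra.
rewrite -[leRHS]mul1r ler_pdivlMr//.
have t0 : 0 <= y ^+ n by rewrite exprn_ge0.
have t1 : y ^+ n <= 1 by rewrite exprn_ile1.
apply: (@le_trans _ _ (cutoff n y * (1 + y ^+ n) ^+ (2 ^ n))).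
  apply: ler_wpM2l; first by case/andP: (cutoff_itv n y01).
  have := bernoulli_ge (2 ^ n) t0; rewrite natrX -exprMn; lra.
rewrite /cutoff -exprMn exprn_ile1//.
  by rewrite mulr_ge0 ?subr_ge0// addr_ge0.
by have := sqr_ge0 (y ^+ n); nra.
Qed.

End Bernoulli.

Section FourierUniqueness.
Context {R : realType}.
Local Notation mu := (@lebesgue_measure R).
Local Notation P := (@period R).

Definition real_trig (g : R -> R) := exists p : trigpoly R, forall x, teval p x = (g x)%:C.

Lemma real_trig_cst c : real_trig (fun=> c).
Proof. by exists (tcst c%:C) => x; rewrite teval_cst. Qed.

Lemma real_trigD f g : real_trig f -> real_trig g -> real_trig (fun x => f x + g x).
Proof. by move=> [p pf] [q qg]; exists (p + q) => x; rewrite tevalD pf qg rmorphD. Qed.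

Lemma real_trigM f g : real_trig f -> real_trig g -> real_trig (fun x => f x * g x).
Proof. by move=> [p pf] [q qg]; exists (p * q) => x; rewrite tevalM pf qg rmorphM. Qed.

Lemma real_trigX f n : real_trig f -> real_trig (fun x => f x ^+ n).
Proof.
move=> tf; elim: n => [|n ih]; first exact: real_trig_cst.
by under eq_fun do rewrite exprS; exact: real_trigM.
Qed.

Lemma real_trig_cos c : real_trig (fun x => cos (x - c)).
Proof.
have mE j x : teval (tmono j) x = cexpi (j%:~R * x) :> R[i].
  rewrite /teval (@zsum_delta _ j) /= ?eqxx ?mul1r//.
  by move=> k /negPf kj; rewrite /= kj mul0r.
exists (tcst (2^-1)%:C * (tcst (cexpi (- c)) * tmono 1 + tcst (cexpi c) * tmono (- 1))) => x.
rewrite tevalM tevalD !tevalM !teval_cst !mE -!cexpiD mul1r mulN1r.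
rewrite (_ : c - x = - (x - c)); last by rewrite opprB.
rewrite [X in cexpi X + _]addrC -(conj_cexpi (x - c)) /cexpi.
apply/eqP; rewrite eq_complex /=; apply/andP; split; apply/eqP; lra.
Qed.

Lemma cintegral_teval (h : R -> R[i]) (p : trigpoly R) : cintegrable h ->
  (forall k, fourier h k = 0) -> cintegral P (fun x => h x * teval p x) = 0.
Proof.
move=> ih h0; have [n pn] := tp_supp p.
have ik c : cintegrable (fun x => h x * cexpi (c * x)).
  by apply: (@cintegrableM _ _ _ 1) => //; [exact: cmeasurable_cexpi|move=> x; rewrite cmod_cexpi].
rewrite (_ : (fun x => _) = (fun x => \sum_(k <- intball n)
    p k * (h x * cexpi (k%:~R * x)))); last first.
  by apply/funext => x; rewrite (tevalE _ pn) mulr_sumr; apply: eq_bigr => k _; rewrite mulrCA.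
rewrite (cintegral_sum _ _).2; last by move=> k; exact/cintegrableZ.
apply: big1 => k _; rewrite cintegralZ//.
have := h0 (- k); rewrite /fourier => /eqP; rewrite mulf_eq0 => /orP[|/eqP h1].
  by rewrite eq_complex /= eqxx andbT invr_eq0 gt_eqF// pi2_gt0.
rewrite (_ : (fun x => _) = (fun x => h x * cexpi (- ((- k)%:~R * x)))) ?h1 ?mulr0//.
by apply/funext => x; rewrite rmorphN mulNr opprK.
Qed.

Lemma ae_not_point (c : R) : {ae mu, forall x, x != c}.
Proof.
exists [set c]; split; [exact: measurable_set1|exact: lebesgue_measure_set1|].
by move=> x /= /negP; rewrite negbK => /eqP.
Qed.

Lemma sin_half_gt0 (x : R) : 0 < x < 2 * pi -> 0 < sin (x / 2).
Proof. by move=> /andP[x0 x1]; apply: sin_gt0_pi; lra. Qed.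

(** The indicator of [[0, b]] is almost everywhere the bounded limit of the trigonometric
    polynomials [cutoff n (y x)], and dominated convergence applies. *)
Lemma interval_moment0 (f : R -> R) (b : R) : measurable_fun [set: R] f ->
  mu.-integrable P (EFin \o f) ->
  (forall g, real_trig g -> Rintegral mu P (fun x => f x * g x) = 0) ->
  0 < b < 2 * pi -> Rintegral mu `[0, b]%classic f = 0.
Proof.
move=> mf fi f0 /andP[b0 b1].
(* A trigonometric polynomial of degree 1, equal to [1/2 - sin (x/2) sin ((b - x)/2) / 2]: below 1/2
   for [0 < x < b], above it for [b < x < 2 pi], with values in [0, 1]. *)
pose y x := 2^-1 - (cos (x - b / 2) - cos (b / 2)) / 4.
have yE x : y x = 2^-1 - sin (x / 2) * sin ((b - x) / 2) / 2.
  have e1 : x - b / 2 = x / 2 - (b - x) / 2 by lra.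
  have e2 : b / 2 = x / 2 + (b - x) / 2 by lra.
  by rewrite /y e1 cosB [in cos (b / 2)]e2 cosD; lra.
have trig_y : real_trig y.
  rewrite (_ : y = fun x => (2^-1 + cos (b / 2) / 4) + - 4^-1 * cos (x - b / 2)).
    apply: real_trigD; first exact: real_trig_cst.
    by apply: real_trigM; [exact: real_trig_cst|exact: real_trig_cos].
  by apply/funext => x; rewrite /y; lra.
have y01 x : 0 <= y x <= 1.
  by have := cos_le1 (x - b / 2); have := cos_geN1 (x - b / 2);
    have := cos_le1 (b / 2); have := cos_geN1 (b / 2); rewrite /y; lra.
have trig_h n : real_trig (fun x => cutoff n (y x)).
  rewrite /cutoff; apply: real_trigX.
  rewrite (_ : (fun x => _) = fun x => 1 + -1 * y x ^+ n); last by apply/funext => x;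
    rewrite mulN1r.
  apply: real_trigD; first exact: real_trig_cst.
  by apply: real_trigM; [exact: real_trig_cst|exact: real_trigX].
have mh n : measurable_fun [set: R] (fun x => f x * cutoff n (y x)).
  apply: measurable_funM => //; have [p ph] := trig_h n.
  have [+ _] := cmeasurable_teval p; congr measurable_fun.
  by apply/funext => x; rewrite ph.
have mb : measurable_fun [set: R] (f \_ `[0, b]%classic).
  apply/(measurable_restrictT _ _).1; first exact: measurable_itv.
  exact: measurable_funTS.
have := @cintegral_cvg _ (fun n x => (f x * cutoff n (y x))%:C)
  (fun x => ((f \_ `[0, b]%classic) x)%:C) (fun x => `|f x|).
move=> /(_ _ _ _ _ _)/wrap[].
- by move=> n; split; [exact: mh|exact: measurable_cst].
- by split; [exact: mb|exact: measurable_cst].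
- exact: integrable_norm fi.
- have aeF := ae_filter_ringOfSetsType mu.
  apply: filterS3 (ae_not_point 0) (ae_not_point b) (ae_not_point (2 * pi)).
  move=> x x0 xb x2; rewrite /period /= in_itv /= => /andP[x0' x2'].
  split; last exact: cvg_cst.
  rewrite /= patchE; case: ifPn; rewrite ?notin_setE ?inE/= in_itv/=.
    move=> /andP[_ xb']; rewrite -[X in _ --> X]mulr1; apply: cvgM; first exact: cvg_cst.
    apply: cutoff_cvg1; first by case/andP: (y01 x).
    rewrite yE; have s1 : 0 < sin (x / 2) by apply: sin_half_gt0; lra.
    have s2 : 0 < sin ((b - x) / 2) by apply: sin_half_gt0; lra.
    have := mulr_gt0 s1 s2; lra.
  move=> /negP; rewrite x0'/= -ltNge => xb'.
  rewrite -[X in _ --> X](mulr0 (f x)); apply: cvgM; first exact: cvg_cst.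
  apply: cutoff_cvg0; last by case/andP: (y01 x).
  rewrite yE; have s1 : 0 < sin (x / 2) by apply: sin_half_gt0; lra.
  have s2 : 0 < sin ((x - b) / 2) by apply: sin_half_gt0; lra.
  rewrite (_ : (b - x) / 2 = - ((x - b) / 2)) ?sinN; last lra.
  have := mulr_gt0 s1 s2; lra.
- move=> n x _; rewrite cmod_real normrM ler_piMr//.
  by have /andP[h0 h1] := cutoff_itv n (y01 x); rewrite ger0_norm.
move=> [+ _]; rewrite /cintegral /=.
have f0n n : Rintegral mu P (fun x => f x * cutoff n (y x)) = 0 by exact: f0 _ (trig_h n).
under eq_fun do rewrite f0n.
have c0 : (0 : R) @[_ --> \oo] --> (0 : R) by exact: cvg_cst.
move=> /(cvg_unique (@Rhausdorff R) c0) {c0} c0; move: (esym c0) => {c0}.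
rewrite -Rintegral_mkcondr (_ : P `&` `[0, b]%classic = `[0, b]%classic)// setIidr//.
by apply: subset_itvl; rewrite bnd_simp ltW.
Qed.

(** The integrals over [[0, b]] vanish for all [b] inside the period, and so does their derivative
    in [b], which is [f] almost everywhere by Lebesgue differentiation. *)
Lemma moments0_ae (f : R -> R) : measurable_fun [set: R] f ->
  mu.-integrable P (EFin \o f) ->
  (forall g, real_trig g -> Rintegral mu P (fun x => f x * g x) = 0) ->
  {ae mu, forall x, P x -> f x = 0}.
Proof.
move=> mf fi f0.
have ifP : mu.-integrable [set: R] (EFin \o (f \_ P)).
  by rewrite -restrict_EFin -integrable_mkcond//; exact: measurable_period.
have locf : locally_integrable [set: R] (f \_ P) by exact: integrable_locally.
have ify y : mu.-integrable [set` Interval (BLeft 0) (BRight y)] (EFin \o (f \_ P)).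
  exact: integrableS ifP.
have aeF := ae_filter_ringOfSetsType mu.
have := FTC1 ify locf; move=> ftc.
apply: filterS3 ftc (ae_not_point 0) (ae_not_point (2 * pi)) => x h x0 x2 Px.
move: (Px); rewrite /period /= in_itv /= => /andP[x0' x2'].
have x0pos : 0 < x by rewrite lt_neqAle eq_sym x0.
have x2lt : x < 2 * pi by rewrite lt_neqAle x2.
case: h => [|_]; first by rewrite /Order.lt /= ?x0'.
rewrite patchE mem_set// => <-.
rewrite derive1E (@near_eq_derive _ _ _ _ (cst 0)) ?derive_cst//.
have nx : \forall y \near x, y \in `]0, 2 * pi[.
  by apply: near_in_itvoo; rewrite in_itv/= x0pos.
apply: filterS nx => y; rewrite in_itv/= => y02.
rewrite -[RHS](interval_moment0 mf fi f0 y02); apply: eq_Rintegral => z.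
rewrite inE/= in_itv/= => /andP[z0 zy]; rewrite patchE mem_set// /period /= in_itv/= z0/=.
by case/andP: y02 => _ /ltW; exact: le_trans.
Qed.

Theorem fourier_eq0_ae (h : R -> R[i]) : cintegrable h -> (forall k, fourier h k = 0) ->
  {ae mu, forall x, P x -> h x = 0}.
Proof.
move=> ih h0; have [[mr mi] _] := ih.
have gh g : real_trig g -> Rintegral mu P (fun x => complex.Re (h x) * g x) = 0 /\
    Rintegral mu P (fun x => complex.Im (h x) * g x) = 0.
  move=> [p pg]; have /eqP := cintegral_teval p ih h0.
  rewrite /cintegral eq_complex /= => /andP[/eqP e1 /eqP e2]; split.
    by rewrite -[RHS]e1; apply: eq_Rintegral => x _; rewrite pg ReM /= mulr0 subr0.
  by rewrite -[RHS]e2; apply: eq_Rintegral => x _; rewrite pg ImM /= mulr0 add0r.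
have aeF := ae_filter_ringOfSetsType mu.
have aeR := moments0_ae mr (cintegrable_Re ih) (fun g tg => (gh g tg).1).
have aeI := moments0_ae mi (cintegrable_Im ih) (fun g tg => (gh g tg).2).
apply: filterS2 aeR aeI => x hr hi Px.
by apply/eqP; rewrite eq_complex /= hr// hi// eqxx.
Qed.

End FourierUniqueness.

Section FourierCoefficients.
Context {R : realType}.
Local Notation mu := (@lebesgue_measure R).
Local Notation P := (@period R).
Implicit Types f g : R -> R[i].

Lemma cintegrableMexp f c : cintegrable f -> cintegrable (fun x => f x * cexpi (- (c * x))).
Proof.
move=> fi; apply: (@cintegrableM _ _ _ 1) => //; last by move=> x; rewrite cmod_cexpi.
by under eq_fun do rewrite -mulNr; exact: cmeasurable_cexpi.
Qed.

Lemma fourierD f g k : cintegrable f -> cintegrable g ->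
  fourier (fun x => f x + g x) k = fourier f k + fourier g k.
Proof.
move=> fi gi; rewrite /fourier -mulrDr -cintegralD; try exact: cintegrableMexp.
by congr (_ * _); apply: eq_cintegral => x _; rewrite mulrDl.
Qed.

Lemma fourierN f k : cintegrable f -> fourier (fun x => - f x) k = - fourier f k.
Proof.
move=> fi; rewrite /fourier -mulrN -[- cintegral _ _]mulN1r
  -(cintegralZ (-1) (cintegrableMexp k%:~R fi)).
by congr (_ * _); apply: eq_cintegral => x _; rewrite mulN1r mulNr.
Qed.

Lemma cintegrableN f : cintegrable f -> cintegrable (fun x => - f x).
Proof. by move=> fi; under eq_fun do rewrite -mulN1r; exact: cintegrableZ. Qed.

Lemma fourierB f g k : cintegrable f -> cintegrable g ->
  fourier (f \- g) k = fourier f k - fourier g k.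
Proof. by move=> fi gi; rewrite fourierD ?fourierN//; exact: cintegrableN. Qed.

Lemma fourier_cvg (f_ : nat -> R -> R[i]) f (g : R -> R) k :
  (forall n, cmeasurable (f_ n)) -> cmeasurable f ->
  mu.-integrable P (EFin \o g) ->
  {ae mu, forall x, P x -> ccvg (f_^~ x) (f x)} ->
  (forall n x, P x -> cmod (f_ n x) <= g x) ->
  ccvg (fun n => fourier (f_ n) k) (fourier f k).
Proof.
move=> mf_ mf ig fx fg; apply: ccvgM; first exact: ccvg_cst.
have mexp : cmeasurable (fun x : R => cexpi (- (k%:~R * x))).
  by under eq_fun do rewrite -mulNr; exact: cmeasurable_cexpi.
have aeF := ae_filter_ringOfSetsType mu.
apply: (@cintegral_cvg _ _ _ g) => //.
- by move=> n; exact: cmeasurableM.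
- exact: cmeasurableM.
- by apply: filterS fx => x h Px; exact: ccvgM (h Px) (ccvg_cst _).
- by move=> n x Px; rewrite cmodM cmod_cexpi mulr1 fg.
Qed.

(** Dominated convergence for the constant sequence [f], with limit [g]. *)
Lemma fourier_ae f g k : cintegrable f -> cmeasurable g ->
  {ae mu, forall x, P x -> f x = g x} -> fourier f k = fourier g k.
Proof.
move=> [mf fi] mg fg; apply: (ccvg_unique (ccvg_cst (fourier f k))).
apply: (@fourier_cvg (fun=> f) g (fun x => cmod (f x))) => //.
have aeF := ae_filter_ringOfSetsType mu.
by apply: filterS fg => x h Px; rewrite h//; exact: ccvg_cst.
Qed.

Lemma cubicE f x : cubic f x = f x * ((f x)^*)%C * f x.
Proof. by rewrite /cubic sqr_normc. Qed.

Lemma cmeasurable_cubic f : cmeasurable f -> cmeasurable (cubic f).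
Proof.
move=> mf; rewrite (funext (cubicE f)); apply: cmeasurableM => //.
by apply: cmeasurableM => //; exact: cmeasurable_conj.
Qed.

End FourierCoefficients.

(** * Functions with summable Fourier coefficients *)

Section PartialSums.
Context {R : realType}.
Local Notation mu := (@lebesgue_measure R).
Local Notation P := (@period R).
Implicit Types (a : int -> R[i]).

Lemma trunc_finsupp n a : finsupp_int (fun k => if (`|k| <= n)%N then a k else 0).
Proof. by exists n => k kn; rewrite leqNgt kn. Qed.
Definition trunc n a : trigpoly R := Trigpoly (trunc_finsupp n a).

Lemma truncE n a k : trunc n a k = if (`|k| <= n)%N then a k else 0.
Proof. by []. Qed.

Lemma trunc_supported n a : supported n (trunc n a).
Proof. by move=> k kn; rewrite truncE leqNgt kn. Qed.

Lemma wiener_truncB n m a : (n <= m)%N ->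
  wiener (trunc m a - trunc n a) = wiener (trunc m a) - wiener (trunc n a).
Proof.
move=> nm; apply/eqP; rewrite eq_sym subr_eq; apply/eqP.
rewrite !wiener_zsum -zsumD; try exact: finsupp_cmod.
apply: eq_zsum => k; rewrite tpBE !truncE.
case: (leqP `|k|%N n) => kn; first by rewrite (leq_trans kn nm) subrr cmod0 add0r.
by rewrite subr0 cmod0 addr0.
Qed.

Lemma wiener_trunc_le n m a : (n <= m)%N -> wiener (trunc n a) <= wiener (trunc m a).
Proof. by move=> nm; rewrite -subr_ge0 -wiener_truncB// wiener_ge0. Qed.

Lemma cmod_teval_truncB n m a x : (n <= m)%N ->
  cmod (teval (trunc m a) x - teval (trunc n a) x) <=
  wiener (trunc m a) - wiener (trunc n a).
Proof. by move=> nm; rewrite -tevalB -wiener_truncB// cmod_teval. Qed.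

(* Adding the total variation [wiener (trunc n a)] makes real and imaginary parts monotone. *)
Lemma partial_sums_cvg a C : (forall n, wiener (trunc n a) <= C) ->
  forall x, exists l, ccvg (fun n => teval (trunc n a) x) l.
Proof.
move=> aC x; pose w n := wiener (trunc n a).
have cw : cvgn w.
  apply: nondecreasing_is_cvgn; first by move=> n m; exact: wiener_trunc_le.
  by exists C => _ [n _ <-]; exact: aC.
have key (F : R[i] -> R) : (forall y z, F (y - z) = F y - F z) ->
    (forall z, `|F z| <= cmod z) -> cvgn (fun n => F (teval (trunc n a) x)).
  move=> FB Fc; pose v n := F (teval (trunc n a) x) + w n.
  have cv : cvgn v.
    apply: nondecreasing_is_cvgn.
      move=> n m nm; have := cmod_teval_truncB a x nm.
      move/(le_trans (Fc _)); rewrite FB ler_norml /v /w => /andP[+ _]; lra.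
    exists (C + C) => _ [n _ <-]; apply: lerD; last exact: aC.
    by rewrite (le_trans (ler_norm _))// (le_trans (Fc _))// (le_trans (cmod_teval _ _)).
  rewrite (_ : (fun n => _) = v \- w); first exact: is_cvgB.
  by apply/funext => n; rewrite /v /= addrK.
have cR := key (@complex.Re R) (fun y z => etrans (ReD y (- z)) (congr1 _ (ReN z))) (@Re_le_cmod R).
have cI := key (@complex.Im R) (fun y z => etrans (ImD y (- z)) (congr1 _ (ImN z))) (@Im_le_cmod R).
exists (limn (fun n => complex.Re (teval (trunc n a) x)) +i*
        limn (fun n => complex.Im (teval (trunc n a) x))).
by split.
Qed.

(** The sum of the Fourier series has the coefficients of [f] by dominated convergence, hence agrees
    with [f] by uniqueness. *)
Lemma partial_sums_ae (f : R -> R[i]) C : cintegrable f ->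
  (forall n, wiener (trunc n (fourier f)) <= C) ->
  exists U : R -> R[i], [/\ forall x, ccvg (fun n => teval (trunc n (fourier f)) x) (U x),
    cmeasurable U & {ae mu, forall x, P x -> U x = f x}].
Proof.
move=> fi fC; set a := fourier f.
have /choice[U hU] := partial_sums_cvg fC.
have mU : cmeasurable U by apply: cmeasurable_cvg hU => n; exact: cmeasurable_teval.
have SC n x : cmod (teval (trunc n a) x) <= C by rewrite (le_trans (cmod_teval _ _))// fC.
have UC x : cmod (U x) <= C by apply: ccvg_bound (hU x) _.
have Ui : cintegrable U by exact: cintegrable_bounded UC.
have aeF := ae_filter_ringOfSetsType mu.
have fU k : fourier U k = a k.
  have h : ccvg (fun n => fourier (teval (trunc n a)) k) (fourier U k).
    apply: (@fourier_cvg _ _ _ (cst C)) => //.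
    - by move=> n; exact: cmeasurable_teval.
    - exact: integrable_cst_period.
    - by apply: nearW => x _; exact: hU.
  apply: ccvg_unique h _; split; apply: cvg_near_cst; near=> n;
    rewrite fourier_teval truncE ifT//; near: n; exact: nbhs_infty_ge.
exists U; split => //.
have := fourier_eq0_ae (cintegrableD Ui (cintegrableN fi)) _; move=> /(_ _)/wrap[].
  by move=> k; rewrite fourierD ?fourierN ?fU ?subrr//; exact: cintegrableN.
by apply: filterS => x h /h /eqP; rewrite subr_eq0 => /eqP.
Unshelve. all: by end_near. Qed.

(** The nonlinearity of a function is reached from trigonometric polynomials: the partial sums are
    bounded by [C] and converge to [f] almost everywhere, so dominated convergence applies to their
    cubics. *)
Lemma fourier_cubic_cvg (f : R -> R[i]) C k : cintegrable f ->
  (forall n, wiener (trunc n (fourier f)) <= C) ->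
  ccvg (fun n => cubic_tp (trunc n (fourier f)) k) (fourier (cubic f) k).
Proof.
move=> fi fC; have [U [hU mU Uf]] := partial_sums_ae fi fC; have [mf _] := fi.
have C0 : 0 <= C := le_trans (wiener_ge0 _) (fC 0).
have aeF := ae_filter_ringOfSetsType mu.
rewrite (_ : (fun n => _) = fun n => fourier (teval (cubic_tp (trunc n (fourier f)))) k).
  apply: (@fourier_cvg _ _ _ (cst (C * C * C))).
  - by move=> n; exact: cmeasurable_teval.
  - exact: cmeasurable_cubic.
  - exact: integrable_cst_period.
  - apply: filterS Uf => x h Px; rewrite cubicE -h//.
    under eq_fun do rewrite teval_cubic.
    by apply: ccvgM (hU x); apply: ccvgM (hU x) _; exact: ccvg_conj (hU x).
  - move=> n x _; rewrite teval_cubic !cmodM cmod_conj.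
    have h := le_trans (cmod_teval _ x) (fC n).
    by rewrite !ler_pM ?mulr_ge0 ?cmod_ge0.
by apply/funext => n; rewrite fourier_teval.
Qed.

Lemma ae_bounded_period (f : R -> R[i]) C : cintegrable f ->
  (forall n, wiener (trunc n (fourier f)) <= C) ->
  {ae mu, forall x, P x -> cmod (f x) <= C}.
Proof.
move=> fi fC; have [U [hU mU Uf]] := partial_sums_ae fi fC.
have aeF := ae_filter_ringOfSetsType mu.
apply: filterS Uf => x h Px; rewrite -h//; apply: ccvg_bound (hU x) _ => n.
by rewrite (le_trans (cmod_teval _ _)).
Qed.

End PartialSums.

(** * Translation invariance and the essential supremum *)

Section Translation.
Context {R : realType}.
Local Notation mu := (@lebesgue_measure R).
Local Notation P := (@period R).

Lemma measurable_translation (c : R) : measurable_fun [set: R] (fun x : R => x + c).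
Proof. exact: measurable_funD. Qed.

(** The push-forward of the measure agrees with it on half-open intervals, which determine it. *)
Lemma lebesgue_measure_translation (c : R) (A : set R) : measurable A ->
  mu ((fun x => x + c) @^-1` A) = mu A.
Proof.
move=> mA.
pose m : {measure set (measurableTypeR R) -> \bar R} :=
  @measure_function_pushforward__canonical__measure_function_Measure _ _
    (measurableTypeR R) (measurableTypeR R) R mu _ (measurable_translation c).
rewrite [RHS](@lebesgue_measure_unique _ m)// => _ [[a b] _ <-].
rewrite /m /= /pushforward (_ : _ @^-1` _ = `]a - c, b - c]%classic); last first.
  by apply/seteqP; split => x; rewrite /= !in_itv/= ltrBlDr lerBrDr.
by rewrite !lebesgue_measure_itv/= !lte_fin ltrD2r -!EFinB; congr (if _ then _%:E else _); ring.
Qed.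

Lemma ae_translation (c : R) (Q : R -> Prop) : {ae mu, forall x, Q x} ->
  {ae mu, forall x, Q (x + c)}.
Proof.
move=> [N [mN N0 hN]]; exists ((fun x => x + c) @^-1` N); split.
- by rewrite -[X in measurable X]setTI; exact: measurable_translation.
- by rewrite lebesgue_measure_translation.
- by move=> x /= h; apply: hN.
Qed.

(** The line is a countable union of translates of the period; the floor of [x / (2 * pi)] selects
    one that contains [x]. *)
Lemma ae_period_periodic (Q : R -> Prop) : (forall x, Q (x + 2 * pi) -> Q x) ->
  (forall x, Q x -> Q (x + 2 * pi)) ->
  {ae mu, forall x, P x -> Q x} -> {ae mu, forall x, Q x}.
Proof.
move=> Qm Qp aeQ.
have shift n x : Q (x + n%:R * (2 * pi)) <-> Q x.
  elim: n x => [|n ih] x; first by rewrite mul0r addr0.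
  rewrite -addn1 natrD mulrDl mul1r addrA; split; first by move=> /Qm /ih.
  by move=> /ih /Qp.
have all_n : {ae mu, forall x (n : nat), (P (x + n%:R * (2 * pi)) -> Q x) /\
    (P (x - n%:R * (2 * pi)) -> Q x)}.
  apply/ae_foralln => n; have aeF := ae_filter_ringOfSetsType mu.
  apply: filterS2 (ae_translation (n%:R * (2 * pi)) aeQ)
    (ae_translation (- (n%:R * (2 * pi))) aeQ) => x h1 h2.
  split=> [/h1 /shift//|/h2 h].
  by rewrite -(subrK (n%:R * (2 * pi)) x); apply/(shift n).
have aeF := ae_filter_ringOfSetsType mu.
apply: filterS all_n => x hx; have pi0 := @pi2_gt0 R.
have := floor_itv (x / (2 * pi)).
set j := Num.floor _ => /andP[j1 j2].
rewrite ler_pdivlMr// in j1; rewrite ltr_pdivrMr// intrD mulrDl mul1r in j2.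
have [h1 h2] := hx `|j|%N; rewrite /period /= !in_itv/= in h1 h2.
case: (leP 0 j) => j0.
  apply: h2; have -> : (`|j|%N)%:R = j%:~R :> R by rewrite -[in RHS](gez0_abs j0).
  by apply/andP; split; lra.
apply: h1; have -> : (`|j|%N)%:R = - j%:~R :> R.
  by rewrite -[in RHS](opprK j) -(ltz0_abs j0) rmorphN opprK.
by apply/andP; split; lra.
Qed.

Lemma Linfty_norm_le (f : R -> R[i]) C : L2_torus f ->
  (forall n, wiener (trunc n (fourier f)) <= C) -> (Linfty_norm f <= C%:E)%E.
Proof.
move=> L2 fC; have [fp _ _ _] := L2.
have muT : (0 < mu [set: R])%E.
  apply: (@lt_le_trans _ _ (mu P)); first by rewrite [ltRHS]period_measure lte_fin pi2_gt0.
  by apply: le_measure; rewrite ?inE//; exact: measurable_period.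
rewrite /Linfty_norm unlock muT; apply/ess_supP.
have aeC := ae_bounded_period (cintegrable_L2 L2) fC.
have aeF := ae_filter_ringOfSetsType mu.
apply: filterS (@ae_period_periodic (fun x => cmod (f x) <= C) _ _ aeC) => x.
- by rewrite /= lee_fin ger0_norm ?cmod_ge0.
- by rewrite fp.
- by rewrite fp.
Qed.

End Translation.

(** * Truncation of solutions *)

Section SobolevNorm.
Context {R : realType}.
Implicit Types (a : int -> R[i]) (f : R -> R[i]).

Definition sobolev_sum (s : R) n a : R :=
  \sum_(k <- intball n) (1 + k%:~R ^+ 2) `^ s * cmod (a k) ^+ 2.

Lemma sobolev_term_ge0 (s : R) a k : 0 <= (1 + k%:~R ^+ 2) `^ s * cmod (a k) ^+ 2.
Proof. by rewrite mulr_ge0 ?powR_ge0 ?sqr_ge0. Qed.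

Lemma sobolev_sum_ge0 s n a : 0 <= sobolev_sum s n a.
Proof. by apply: sumr_ge0 => k _; exact: sobolev_term_ge0. Qed.

Lemma sqr_sobw (s : R) k : sobw s k ^+ 2 = (1 + k%:~R ^+ 2) `^ s.
Proof. by rewrite /sobw -powR_mulrn ?powR_ge0// -powRrM divfK// pnatr_eq0. Qed.

Lemma sobolevE s n (b : trigpoly R) : supported n b ->
  sobolev s b = Num.sqrt (sobolev_sum s n b).
Proof.
move=> bn; rewrite /sobolev (ell2E (supported_mult _ bn)); congr Num.sqrt.
by apply: eq_bigr => k _; rewrite tmultE cmodM cmod_sobw exprMn sqr_sobw.
Qed.

Lemma sobolev_trunc s n a : sobolev s (trunc n a) = Num.sqrt (sobolev_sum s n a).
Proof.
rewrite (sobolevE s (@trunc_supported _ n a)); congr Num.sqrt; apply: eq_big_seq => k.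
by rewrite mem_intball truncE => ->.
Qed.

Lemma sobolev_trunc_le_Hnorm s n f : ((sobolev s (trunc n (fourier f)))%:E <= Hnorm s f)%E.
Proof.
rewrite sobolev_trunc -powR12_sqrt ?sobolev_sum_ge0// -poweR_EFin.
have le : ((sobolev_sum s n (fourier f))%:E <= \esum_(k in [set: int])
    ((1 + (k%:~R : R) ^+ 2) `^ s * (cmod (fourier f k)) ^+ 2)%R%:E)%E.
  apply: esum_ge; exists [set` intball n]; first by split=> //; exact: finite_seq.
  rewrite (fsbigE (intball n)) ?intball_uniq//; last by move=> k /= ->.
  rewrite -[leRHS]big_filter (_ : [seq _ <- _ | _] = intball n) ?sumEFin//.
  by apply/all_filterP/allP => k kn; exact: mem_set.
have s0 : (0 <= (sobolev_sum s n (fourier f))%:E)%E by rewrite lee_fin sobolev_sum_ge0.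
apply: (gt0_ler_poweR _ _ _ le) => //; rewrite in_itv/= leey andbT//.
exact: le_trans s0 le.
Qed.

Lemma le_sum_intball (x : int -> R) (l : seq int) : uniq l -> (forall k, 0 <= x k) ->
  exists n, \sum_(k <- l) x k <= \sum_(k <- intball n) x k.
Proof.
(* A crude radius: the sum of all [|k|] dominates each of them. *)
move=> ul x0; exists (\sum_(k <- l) `|k|%N)%N.
set n := (\sum_(k <- l) _)%N.
have pl : perm_eq l [seq k <- intball n | k \in l].
  apply: uniq_perm => //; first by rewrite filter_uniq// intball_uniq.
  move=> k; rewrite mem_filter mem_intball; case kl : (k \in l) => //=.
  by rewrite /n (big_rem k) ?leq_addr.
rewrite (perm_big _ pl) big_filter big_mkcond/=; apply: ler_sum => k _.
by case: ifP.
Qed.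

(** Converse to [sobolev_trunc_le_Hnorm]; together they trade the extended-real norm for bounds
    uniform over truncations. *)
Lemma Hnorm_le s f (c : R) : (forall n, sobolev s (trunc n (fourier f)) <= c) ->
  (Hnorm s f <= c%:E)%E.
Proof.
move=> fc; have c0 : 0 <= c := le_trans (sobolev_ge0 _ _) (fc 0).
have le : (\esum_(k in [set: int])
    ((1 + (k%:~R : R) ^+ 2) `^ s * (cmod (fourier f k)) ^+ 2)%R%:E <= (c ^+ 2)%:E)%E.
  apply: ub_ereal_sup => _ [X [finX _] <-].
  rewrite fsbig_finite// sumEFin lee_fin.
  have [n hn] := le_sum_intball (finmap.fset_uniq (fset_set X)) (sobolev_term_ge0 s (fourier f)).
  apply: le_trans hn _; have := fc n; rewrite sobolev_trunc => h.
  rewrite -[leLHS](sqr_sqrtr (sobolev_sum_ge0 _ _ _)).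
  by rewrite ler_pXn2r ?nnegrE ?sqrtr_ge0.
have s0 : (0 <= \esum_(k in [set: int])
    ((1 + (k%:~R : R) ^+ 2) `^ s * (cmod (fourier f k)) ^+ 2)%R%:E)%E.
  by apply: esum_ge0 => k _; rewrite lee_fin; exact: sobolev_term_ge0.
have c20 : (0 <= (c ^+ 2)%:E)%E by rewrite lee_fin sqr_ge0.
rewrite /Hnorm; apply: (@le_trans _ _ ((c ^+ 2)%:E `^ 2^-1)%E).
  by apply: (gt0_ler_poweR _ _ _ le); rewrite // in_itv; apply/andP; split=> //; exact: leey.
by rewrite poweR_EFin lee_fin powR12_sqrt ?sqr_ge0// sqrtr_sqr ger0_norm.
Qed.

Lemma truncB n a b : trunc n (fun k => a k - b k) = trunc n a - trunc n b.
Proof. by apply: tpP => k; rewrite tpBE !truncE; case: ifP; rewrite ?subr0. Qed.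

Lemma eq_trunc n a b : a =1 b -> trunc n a = trunc n b.
Proof. by move=> /funext ->. Qed.

Lemma sobolev_truncB_sqr s n m a : (n <= m)%N ->
  sobolev s (trunc m a - trunc n a) ^+ 2 = sobolev_sum s m a - sobolev_sum s n a.
Proof.
move=> nm; have sm := supportedD (@trunc_supported _ m a)
  (supportedN (supported_le nm (@trunc_supported _ n a))).
rewrite (sobolevE s sm) sqr_sqrtr ?sobolev_sum_ge0//.
have en := sobolevE s (supported_le nm (@trunc_supported _ n a)).
have -> : sobolev_sum s n a = sobolev_sum s m (trunc n a).
  have := congr1 (fun x => x ^+ 2) en; rewrite sobolev_trunc /=.
  by rewrite !sqr_sqrtr ?sobolev_sum_ge0.
rewrite /sobolev_sum -sumrB; apply: eq_big_seq => k; rewrite mem_intball => km.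
rewrite -mulrBr tpBE !truncE km; case: ifP => _; first by rewrite !subrr cmod0 expr0n.
by rewrite subr0 cmod0 expr0n subr0.
Qed.

(** The squared norms of the truncations increase and are bounded, and by orthogonality their
    increments are the squared norms of the differences. *)
Lemma sobolev_tail s a (M eta : R) : 0 < eta -> (forall n, sobolev s (trunc n a) <= M) ->
  exists n0, forall n m, (n0 <= n)%N -> (n <= m)%N -> sobolev s (trunc m a - trunc n a) <= eta.
Proof.
move=> eta0 aM; have M0 : 0 <= M := le_trans (sobolev_ge0 _ _) (aM 0).
pose S n := sobolev_sum s n a.
have Snd n m : (n <= m)%N -> S n <= S m.
  by move=> nm; rewrite -subr_ge0 -sobolev_truncB_sqr// sqr_ge0.
have Sb n : S n <= M ^+ 2.
  rewrite -[leLHS](sqr_sqrtr (sobolev_sum_ge0 _ _ _)) ler_pXn2r ?nnegrE ?sqrtr_ge0//.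
  by rewrite -sobolev_trunc.
have hs : has_sup (range S).
  by split; [exists (S 0%N); exists 0%N|exists (M ^+ 2) => _ [n _ <-]].
have [_ [n0 _ <-] h0] := sup_adherent (exprn_gt0 2 eta0) hs.
exists n0 => n m n0n nm; rewrite -(@ler_pXn2r _ 2)// ?nnegrE ?sobolev_ge0 ?(ltW eta0)//.
rewrite sobolev_truncB_sqr//.
have := sup_upper_bound hs; move/(_ (S m)) => h; have {}h : S m <= sup (range S) by apply: h;
  exists m.
have := Snd n0 n n0n; rewrite /S in h h0 *; lra.
Qed.

End SobolevNorm.

Section UniformTails.
Context {R : realType}.

(** Compactness of the segment turns thresholds that are locally uniform in time into a single
    one. *)
Lemma uniform_on_segment (T : R) (Q : nat -> R -> Prop) :
  (forall t, exists n0, exists2 d, 0 < d &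
    forall n r, (n0 <= n)%N -> `|r - t| < d -> Q n r) ->
  exists n0, forall t, 0 <= t <= T -> Q n0 t.
Proof.
move=> hQ; have /compact_near_coveringP cov := @segment_compact R 0 T.
have [|n0 _ h] := cov nat \oo Q _.
  move=> t _; have [n0 [d d0 h]] := hQ t.
  exists (ball t d, [set n | (n0 <= n)%N]) => /=.
    by split; [exact: nbhsx_ballx|exists n0].
  by move=> [r n] /= [rt n0n]; apply: h => //; rewrite distrC.
by exists n0 => t tT; apply: (h n0 (leqnn _)); rewrite /= in_itv.
Qed.

Variables (s : R) (u : R -> R -> R[i]).
Hypothesis cu : continuous_H s u.
Let A t := fourier (u t).

Lemma in_H_sobolev_bound f : in_H s f -> exists C, forall m, sobolev s (trunc m (fourier f)) <= C.
Proof.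
move=> [_ Hf]; exists (fine (Hnorm s f)) => m.
have h := sobolev_trunc_le_Hnorm s m f.
rewrite -lee_fin fineK// ge0_fin_numE//.
by apply: le_trans h; rewrite lee_fin sobolev_ge0.
Qed.

Lemma continuous_H_local t (eps : R) : 0 < eps -> exists2 d, 0 < d &
  forall r, `|r - t| < d -> forall m, sobolev s (trunc m (A r) - trunc m (A t)) <= eps.
Proof.
move=> eps0; have [inH cH] := cu.
have /fine_cvgP[[d1 /= d10 fin] /cvgrPdist_le /(_ _ eps0)[d2 /= d20 h]] := cH t.
exists (Num.min d1 d2) => [|r]; first by rewrite lt_min d10.
rewrite lt_min distrC => /andP[rd1 rd2] m.
have L2 q : cintegrable (u q) by apply: cintegrable_L2; have [] := inH q.
rewrite -truncB -(eq_trunc m (fun k => fourierB k (L2 r) (L2 t))).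
rewrite -lee_fin (le_trans (sobolev_trunc_le_Hnorm _ _ _))//.
rewrite -(fineK (fin r rd1)) lee_fin.
by have := h r rd2; rewrite /= sub0r normrN => /(le_trans (ler_norm _)).
Qed.

Lemma sobolev_continuous_bound T : exists M : R, forall t, 0 <= t <= T ->
  forall m, sobolev s (trunc m (A t)) <= M.
Proof.
have [|n0 h] := @uniform_on_segment T
  (fun n t => forall m, sobolev s (trunc m (A t)) <= n%:R); last by exists n0%:R.
move=> t; have [C hC] := in_H_sobolev_bound (cu.1 t).
have [d d0 hd] := continuous_H_local t ltr01.
exists (Num.truncn `|C + 1|).+1; exists d => // n r Cn rt m.
rewrite -[trunc m (A r)](subrK (trunc m (A t))) (le_trans (sobolevD _ _ _))//.
apply: le_trans (lerD (hd r rt m) (hC m)) _; rewrite addrC (le_trans (ler_norm _))//.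
by apply: le_trans (ltW (truncnS_gt _)) _; rewrite ler_nat.
Qed.

Lemma sobolev_uniform_tail T (eta : R) : 0 < eta -> exists n0, forall t, 0 <= t <= T ->
  forall n m, (n0 <= n)%N -> (n <= m)%N -> sobolev s (trunc m (A t) - trunc n (A t)) <= eta.
Proof.
move=> eta0; apply: (@uniform_on_segment T (fun n0 t => forall n m, (n0 <= n)%N ->
  (n <= m)%N -> sobolev s (trunc m (A t) - trunc n (A t)) <= eta)) => t.
have [C hC] := in_H_sobolev_bound (cu.1 t).
have e3 : 0 < eta / 3 by rewrite divr_gt0.
have [n0 hn0] := sobolev_tail e3 hC.
have [d d0 hd] := continuous_H_local t e3.
exists n0; exists d => // n1 r n01 rt n m n1n nm.
rewrite (_ : _ - _ = (trunc m (A r) - trunc m (A t)) + (trunc m (A t) - trunc n (A t)) +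
  - (trunc n (A r) - trunc n (A t))); last by rewrite addrA subrK opprB addrA subrK.
rewrite (le_trans (sobolevD _ _ _))//.
have h1 := hd r rt m.
have h3 := hn0 n m (leq_trans n01 n1n) nm.
have h4 := sobolevD s (trunc m (A r) - trunc m (A t)) (trunc m (A t) - trunc n (A t)).
have h5 : sobolev s (- (trunc n (A r) - trunc n (A t))) <= eta / 3.
  by apply: le_trans (hd r rt n); apply: sobolev_le => k; rewrite tpNE cmodN.
by apply: le_trans (lerD (le_trans h4 (lerD h1 h3)) h5) _; lra.
Qed.

End UniformTails.

(** * The error made by truncating the cubic term *)

Section TruncationError.
Context {R : realType}.
Local Notation tp := (trigpoly R).
Local Notation iC := (@Complex R 0 1).

Lemma wiener_sobolev (s : R) : 1 < s ->
  exists2 c, 0 < c & forall a : tp, wiener a <= c * sobolev s a.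
Proof.
move=> s1; have [c c0 hc] := @hankel_norm_sobolev R s s1.
exists (2 * c) => [|a]; first by rewrite mulr_gt0.
by rewrite (le_trans (wiener_le_hankel_norm a))// -mulrA ler_wpM2l.
Qed.

Lemma cubic_sobolev_lipschitz (s : R) : 1 < s -> exists2 K, 0 < K &
  forall (M x : R) (a b : tp), sobolev s a <= M -> sobolev s b <= M ->
    sobolev s (a - b) <= x -> sobolev s (cubic_tp a - cubic_tp b) <= K * M ^+ 2 * x.
Proof.
move=> s1; have [c c0 hc] := wiener_sobolev s1; have s0 : 0 <= s by lra.
have hX := tame_wiener_sobolev s0 (@ler01 R).
have L0 : 0 < c + 1 by lra.
exists (12 * (2 `^ s) ^+ 4 * (c + 1) ^+ 3).
  by rewrite mulr_gt0 ?mulr_gt0 ?exprn_gt0// powR_gt0.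
move=> M x a b aM bM abx.
have le d y : sobolev s d <= y -> wiener d + 1 * sobolev s d <= (c + 1) * y.
  move=> dy; apply: (@le_trans _ _ ((c + 1) * sobolev s d)); last by rewrite ler_wpM2l// ltW.
  by rewrite mulrDl lerD2r hc.
have := cubic_diff_le hX (le _ _ aM) (le _ _ bM) (le _ _ abx).
have := wiener_ge0 (cubic_tp a - cubic_tp b); move=> h1 h2.
have -> : 12 * (2 `^ s) ^+ 4 * (c + 1) ^+ 3 * M ^+ 2 * x =
  12 * (2 `^ s) ^+ 4 * ((c + 1) * M) ^+ 2 * ((c + 1) * x) by ring.
by apply: le_trans h2; rewrite mul1r lerDr.
Qed.

Lemma sobolev_sum_cvg (s : R) N (b_ : nat -> int -> R[i]) (b : int -> R[i]) :
  (forall k, ccvg (b_^~ k) (b k)) ->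
  sobolev_sum s N (b_ m) @[m --> \oo] --> sobolev_sum s N b.
Proof.
move=> hb; rewrite /sobolev_sum; elim: (intball N) => [|k l ih].
  by under eq_fun do rewrite big_nil; rewrite big_nil; exact: cvg_cst.
under eq_fun do rewrite big_cons; rewrite big_cons; apply: cvgD => //.
apply: cvgM; first exact: cvg_cst.
have h := ccvg_cmod (hb k).
by under eq_fun do rewrite expr2; rewrite expr2; exact: cvgM.
Qed.

Lemma sobolev_limit_le (s : R) N (b_ : nat -> tp) (b : tp) (C : R) m0 :
  (forall m, supported N (b_ m)) -> supported N b ->
  (forall k, ccvg (fun m => b_ m k) (b k)) ->
  (forall m, (m0 <= m)%N -> sobolev s (b_ m) <= C) -> sobolev s b <= C.
Proof.
move=> sb_ sb hb bC.
have h : sobolev s (b_ m) @[m --> \oo] --> sobolev s b.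
  have h1 := @sobolev_sum_cvg s N (fun m k => b_ m k) b hb.
  have h2 := cvg_comp _ _ h1 (@sqrt_continuous R _).
  rewrite (sobolevE s sb) (_ : (fun m => _) = fun m => Num.sqrt (sobolev_sum s N (b_ m)))//.
  by apply/funext => m; exact: sobolevE.
by apply: (cvgr_to_le h); exists m0.
Qed.

Lemma supported_cubic n (a : tp) : supported n a -> supported (3 * n) (cubic_tp a).
Proof.
move=> an; have := supportedM (supportedM an (supported_bar an)) an.
by apply: supported_le; lia.
Qed.

(** The commutator of truncation and nonlinearity. It reaches frequency [3 * n]: beyond [n] it
    cancels [cubic_tp], so that a curve of degree [n] can solve the equation with the full cubic
    term. *)
Definition truncation_error (n : nat) (f : R -> R[i]) : tp :=
  trunc n (fourier (cubic f)) - cubic_tp (trunc n (fourier f)).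

Lemma trunc_tp n (a : tp) : supported n a -> trunc n a = a.
Proof. by move=> an; apply: tpP => k; rewrite truncE; case: leqP => // /an. Qed.

Lemma cmod_trunc_le n (a : int -> R[i]) k : cmod (trunc n a k) <= cmod (a k).
Proof. by rewrite truncE; case: ifP; rewrite ?cmod0 ?cmod_ge0. Qed.

(** If the tails beyond [n1] are small and [n >= 3 * n1], the cubic of the truncation at [n1] is
    unaffected by truncation at [n]. The cubic map is Lipschitz on bounded sets of H^s, so the
    cubics of all finer truncations are close to it. *)
Lemma truncation_error_small (s T eps : R) (u : R -> R -> R[i]) : 1 < s ->
  continuous_H s u -> 0 < eps -> exists n0, forall n t, (n0 <= n)%N -> 0 <= t <= T ->
    sobolev s (truncation_error n (u t)) <= eps.
Proof.
move=> s1 cu eps0; have [K K0 hK] := cubic_sobolev_lipschitz s1.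
have [c c0 hc] := wiener_sobolev s1.
have [M hM] := sobolev_continuous_bound cu T.
pose eta := eps / (2 * K * M ^+ 2 + 1).
have D0 : 0 < 2 * K * M ^+ 2 + 1 by rewrite ltr_wpDl// mulr_ge0 ?sqr_ge0// mulr_ge0// ltW.
have eta0 : 0 < eta by rewrite divr_gt0.
have etaE : 2 * (K * M ^+ 2 * eta) <= eps.
  have h : eta * (2 * K * M ^+ 2 + 1) = eps by rewrite divfK// gt_eqF.
  have -> : 2 * (K * M ^+ 2 * eta) = eps - eta by rewrite -h; ring.
  by rewrite gerBl ltW.
have [n1 hn1] := sobolev_uniform_tail cu T eta0.
exists (3 * n1)%N => n t n1n tT; set a := fourier (u t).
have n1n' : (n1 <= n)%N by lia.
have lip p q : (n1 <= p)%N -> (p <= q)%N ->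
    sobolev s (cubic_tp (trunc q a) - cubic_tp (trunc p a)) <= K * M ^+ 2 * eta.
  by move=> n1p pq; apply: hK; [exact: hM|exact: hM|exact: hn1].
have ia : cintegrable (u t) by apply: cintegrable_L2; have [] := cu.1 t.
have aC m : wiener (trunc m a) <= c * M.
  by rewrite (le_trans (hc _))// ler_wpM2l ?(ltW c0)// hM.
(* The coefficients of the cubic of [u t] are limits of those for truncations at [m], and the
   Sobolev bound passes to the limit. *)
pose b_ m := trunc n (cubic_tp (trunc m a)) - cubic_tp (trunc n a).
have s3 : supported (3 * n) (cubic_tp (trunc n a)).
  by apply: supported_cubic; exact: trunc_supported.
have sN (d : int -> R[i]) : supported (3 * n) (trunc n d - cubic_tp (trunc n a)).
  apply: supportedD; last exact: supportedN.
  by apply: (@supported_le _ n); [lia|exact: trunc_supported].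
apply: (@sobolev_limit_le s (3 * n) b_ _ _ n) => //.
- by move=> m; exact: sN.
- exact: sN.
- move=> k; apply: ccvgD; last exact: ccvg_cst.
  rewrite /b_ /= ; case: ifP => _; last exact: ccvg_cst.
  exact: fourier_cubic_cvg aC.
move=> m nm; pose D := cubic_tp (trunc n a) - cubic_tp (trunc n1 a).
have -> : b_ m = trunc n (cubic_tp (trunc m a) - cubic_tp (trunc n a)) - (D - trunc n D).
  have e1 : trunc n (cubic_tp (trunc n1 a)) = cubic_tp (trunc n1 a).
    apply: trunc_tp; apply: (@supported_le _ (3 * n1)); first lia.
    by apply: supported_cubic; exact: trunc_supported.
  have tB (p q : tp) : trunc n (p - q) = trunc n p - trunc n q by exact: truncB.
  by rewrite /b_ /D !tB e1; ring.
have h1 : sobolev s (trunc n (cubic_tp (trunc m a) - cubic_tp (trunc n a))) <= K * M ^+ 2 * eta.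
  apply: le_trans (lip n m n1n' nm); apply: sobolev_le => k; exact: cmod_trunc_le.
have h2 : sobolev s (- (D - trunc n D)) <= K * M ^+ 2 * eta.
  apply: le_trans (lip n1 n (leqnn _) n1n'); apply: sobolev_le => k.
  rewrite tpNE cmodN tpBE truncE -/D; case: ifP => _; first by rewrite subrr cmod0 cmod_ge0.
  by rewrite subr0.
by apply: le_trans (sobolevD _ _ _) _; apply: le_trans (lerD h1 h2) _; lra.
Qed.

Lemma half_wave_truncation (u : R -> R -> R[i]) n T : half_wave_equation u ->
  hw_approx T (fun t => trunc n (fourier (u t))) (fun t => truncation_error n (u t)).
Proof.
move=> hu t _; have [ut dut eq_ut] := hu t.
have utE k : ut k = - iC * (mulabsD (fourier (u t)) k + fourier (cubic (u t)) k).
  rewrite -eq_ut addrC subrK mulrA mulNr.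
  have -> : iC * 'i%C = -1 by apply/eqP; rewrite eq_complex /=; apply/andP; split; apply/eqP; ring.
  by rewrite opprK mul1r.
exists (n + 3 * n)%N; split.
- by move=> r; apply: (@supported_le _ n); [lia|exact: trunc_supported].
- rewrite -addrA [_ + truncation_error _ _]addrC subrK.
  apply: (@supported_le _ n); first lia; move=> k kn.
  by rewrite tcstME tpDE /tabsD tmultE !truncE leqNgt kn /= mulr0 addr0 mulr0.
- move=> k; rewrite -addrA [_ + truncation_error _ _]addrC subrK.
  rewrite tcstME tpDE /tabsD tmultE !truncE.
  under [X in cderiv X]eq_fun do rewrite truncE.
  case: ifP => _; last by rewrite mulr0 addr0 mulr0; exact: cderiv_cst.
  by have := dut k; rewrite utE.
Qed.

Lemma szego_truncation (v : R -> R -> R[i]) n T : szego_equation v ->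
  szego_approx T (fun t => trunc n (fourier (v t))) (fun t => tpos (truncation_error n (v t))).
Proof.
move=> hv t _; have [vt dvt eq_vt] := hv t.
have vtE k : vt k = - iC * (mulD (fourier (v t)) k + Pi_plus (fourier (cubic (v t))) k).
  rewrite -eq_vt addrC subrK mulrA mulNr.
  have -> : iC * 'i%C = -1 by apply/eqP; rewrite eq_complex /=; apply/andP; split; apply/eqP; ring.
  by rewrite opprK mul1r.
have rhsE k : (- tcst iC * tD (trunc n (fourier (v t))) + - tcst iC *
    (tpos (cubic_tp (trunc n (fourier (v t)))) + tpos (truncation_error n (v t)))) k =
    trunc n vt k.
  rewrite -mulrDr -tcstN tcstME tpDE /tD tmultE tpDE !tposE tpBE !truncE vtE /mulD /Pi_plus.
  by do 2! case: ifP => _; ring.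
exists n; split.
- by move=> r; exact: trunc_supported.
- by move=> k kn; rewrite rhsE truncE leqNgt kn.
- move=> k; rewrite rhsE truncE.
  under [X in cderiv X]eq_fun do rewrite truncE.
  by case: ifP => _; [exact: dvt|exact: cderiv_cst].
Qed.

End TruncationError.

(** * From truncations to solutions *)

Section Solutions.
Context {R : realType}.

Lemma Hardy_tpos n (f : R -> R[i]) : Hardy f -> tpos (trunc n (fourier f)) = trunc n (fourier f).
Proof.
move=> hf; apply: tpP => k; rewrite tposE truncE.
by case: ifP => k0; case: ifP => // _; rewrite -hf /Pi_plus k0.
Qed.

Lemma Hardy_tneg n (f : R -> R[i]) : Hardy f -> tneg (trunc n (fourier f)) = 0.
Proof.
move=> hf; apply: (@addrI _ (tpos (trunc n (fourier f)))).
by rewrite tpos_tneg addr0 Hardy_tpos.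
Qed.

Lemma fourier_initial s (u0 : R -> R[i]) (u : R -> R -> R[i]) : in_H s u0 -> continuous_H s u ->
  u 0 = u0 %[ae lebesgue_measure in [set: R]] -> fourier (u 0) = fourier u0.
Proof.
move=> [L2 _] [inH _] ae0; apply/funext => k; apply: fourier_ae.
- by apply: cintegrable_L2; have [] := inH 0.
- by have [] := cintegrable_L2 L2.
- have aeF := ae_filter_ringOfSetsType (@lebesgue_measure R).
  by apply: filterS ae0 => x h _; exact: h.
Qed.

Lemma sobolev_tpos_le (s : R) (r : trigpoly R) : sobolev s (tpos r) <= sobolev s r.
Proof. by apply: sobolev_mult_le => k; case: ifP; rewrite ?cmod0 ?cmod1. Qed.

Lemma wiener_trunc_bound n0 (a : int -> R[i]) C :
  (forall n, (n0 <= n)%N -> wiener (trunc n a) <= C) -> forall n, wiener (trunc n a) <= C.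
Proof.
move=> h n; apply: le_trans (h _ (leq_maxl n0 n)); exact: wiener_trunc_le (leq_maxr _ _).
Qed.

Lemma sobolev_trunc_bound n0 (s : R) (a : int -> R[i]) C :
  (forall n, (n0 <= n)%N -> sobolev s (trunc n a) <= C) -> forall n, sobolev s (trunc n a) <= C.
Proof.
move=> h n; apply: le_trans (h _ (leq_maxl n0 n)); apply: sobolev_le => k.
rewrite !truncE; case: ifP => kn; last by rewrite cmod0 cmod_ge0.
by rewrite (leq_trans kn (leq_maxr _ _)).
Qed.

(** The threshold [n0] may depend on the solution and on [T], whereas [e0], [c] and [M] depend on
    [s] alone; this lets the degree tend to infinity in the conclusions. *)
Lemma half_wave_truncated_bounds (s : R) : 1 < s ->
  exists e0 c M, [/\ 0 < e0 < 1, 0 < c <= 1, 1 <= M &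
    forall (eps T : R) (u0 : R -> R[i]) (u : R -> R -> R[i]), 0 < eps <= e0 -> eps ^+ 3 * T <= c ->
      in_H s u0 -> Hardy u0 -> Hnorm s u0 = eps%:E -> half_wave_solution s u0 u ->
      exists n0, forall n t, (n0 <= n)%N -> 0 <= t <= T ->
        [/\ sobolev s (truncation_error n (u t)) <= eps ^+ 5,
          wiener (trunc n (fourier (u t))) <= 2 * M * eps &
          wiener (tneg (trunc n (fourier (u t)))) <= eps ^+ 2]].
Proof.
move=> s1; have [e0 [c [M [e01 c01 M1 h]]]] := half_wave_long_time s1.
exists e0, c, M; split => // eps T u0 u eps0 epsT inH hardy hn [cu hu iu].
have [eps_gt0 _] := andP eps0.
(* The tolerance [eps ^+ 5] matches the forcing that remains after the normal form. *)
have [n0 hn0] := truncation_error_small T s1 cu (exprn_gt0 5 eps_gt0).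
exists n0 => n t n0n tT.
have E0 := fourier_initial inH cu iu.
have i0 : sobolev s (trunc n (fourier (u 0))) <= eps.
  by rewrite -lee_fin E0 -hn sobolev_trunc_le_Hnorm.
have ineg : tneg (trunc n (fourier (u 0))) = 0 by rewrite E0 Hardy_tneg.
have err q : 0 <= q <= T -> sobolev s (truncation_error n (u q)) <= eps ^+ 5 by exact: hn0.
have [h1 h2] := h _ _ _ _ eps0 epsT (@half_wave_truncation _ _ n T hu) err i0 ineg t tT.
split=> //; first exact: err.
by rewrite (le_trans (wiener_le_hankel_norm _))// -mulrA ler_wpM2l.
Qed.

End Solutions.

Theorem theorem1p1 (R : realType) (s : R) (hs : 1 < s) :
  exists2 eps0 : R, 0 < eps0 < 1 &
    (forall alpha : R, 0 < alpha ->
      exists c C : R, [/\ 0 < c < 1, 0 < C &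
        forall (eps : R) (u0 : R -> complex R) (u v : R -> R -> complex R),
          0 < eps <= eps0 ->
          in_H s u0 -> Hardy u0 -> Hnorm s u0 = eps%:E ->
          half_wave_solution s u0 u -> szego_solution s u0 v ->
          forall t : R, 0 <= t <= c / eps ^+ 2 * ln (1 / eps) ->
            (Hnorm s (u t \- v t)%R <= (C * eps `^ (3 - alpha))%R%:E)%E])
    /\
    (exists c C : R, [/\ 0 < c, 0 < C &
        forall (eps : R) (u0 : R -> complex R) (u : R -> R -> complex R),
          0 < eps <= eps0 ->
          in_H s u0 -> Hardy u0 -> Hnorm s u0 = eps%:E ->
          half_wave_solution s u0 u ->
          forall t : R, 0 <= t <= c / eps ^+ 3 ->
            (Linfty_norm (u t) <= (C * eps)%R%:E)%E]).
Proof.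
have [e0 [c [M [e01 c01 M1 hu_bounds]]]] := half_wave_truncated_bounds hs.
have [c0 c1] := andP c01; have [e00 e0lt1] := andP e01.
exists e0 => //; split; last first.
  exists c, (2 * M); split => //; first lra.
  move=> eps u0 u eps0 inH hardy hn hu t tT; have [eps_gt0 _] := andP eps0.
  have e3 : 0 < eps ^+ 3 by rewrite exprn_gt0.
  have epsT : eps ^+ 3 * (c / eps ^+ 3) <= c by rewrite mulrC divfK// gt_eqF.
  have [n0 h] := hu_bounds _ _ _ _ eps0 epsT inH hardy hn hu.
  have [[inHu _] _ _] := hu; apply: Linfty_norm_le; first by have [] := inHu t.
  by apply: (@wiener_trunc_bound _ n0) => n n0n; have [] := h n t n0n tT.
move=> alpha alpha0.
have [B1 B11 hszego] := szego_wiener hs.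
pose B := 2 * M + B1.
have B1' : 1 <= B by rewrite /B; lra.
have [CC [A [CC0 A0 hclose]]] := half_wave_szego_close hs B1'.
(* [c] keeps [T] within the long-time regime, 1/2 makes [ca < 1], and [alpha / A] gives
   [A * ca <= alpha], so that [expR (A * (eps ^+ 2 * T))] is at most [eps ^ (- alpha)]. *)
pose ca := Num.min c (Num.min 2^-1 (alpha / A)).
have ca0 : 0 < ca by rewrite !lt_min c0 invr_gt0 ltr0n divr_gt0.
have ca_c : ca <= c by rewrite ge_min lexx.
have ca_half : ca <= 2^-1 by rewrite !ge_min lexx !orbT.
have ca_A : A * ca <= alpha.
  by rewrite mulrC -ler_pdivlMr// !ge_min lexx !orbT.
exists ca, CC; split => //.
  by rewrite ca0 (le_lt_trans ca_half)// invf_lt1 ?ltr1n.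
move=> eps u0 u v eps0 inH hardy hn hu hv t.
set T := ca / eps ^+ 2 * _ => tT; have [eps_gt0 eps_le] := andP eps0.
have eps1 : eps <= 1 by lra.
have eps01 : 0 < eps <= 1 by rewrite eps_gt0.
have e2 : 0 < eps ^+ 2 by rewrite exprn_gt0.
have TE : eps ^+ 2 * T = ca * - ln eps.
  by rewrite /T mulrCA mulrA div1r lnV ?posrE// divfK// gt_eqF.
have ln0 : ln eps <= 0 by rewrite ln_le0.
(* [ln y <= y] at [y = 1 / eps]: the logarithmic time is shorter than [c / eps^3], where the
   long-time bounds hold. *)
have epsln : eps * - ln eps <= 1.
  have : ln eps^-1 <= eps^-1 by apply: ltW; apply: ln_sublinear; rewrite invr_gt0.
  by rewrite lnV ?posrE// => h; rewrite -(mulfV (lt0r_neq0 eps_gt0)) ler_wpM2l// ltW.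
have epsT : eps ^+ 3 * T <= c.
  rewrite exprS -mulrA TE mulrCA; apply: le_trans ca_c.
  by rewrite -[leRHS]mulr1 ler_wpM2l// ltW.
have epsT1 : eps ^+ 3 * T <= 1 := le_trans epsT c1.
have [cv hardyv szv iv] := hv; have [cu hwu iu] := hu.
have [n0 hn0] := hu_bounds _ _ _ _ eps0 epsT inH hardy hn hu.
have [n1 hn1] := truncation_error_small T hs cv (exprn_gt0 5 eps_gt0).
have L2 w : in_H s w -> cintegrable w by move=> [L2w _]; exact: cintegrable_L2.
have finalE : CC * eps ^+ 3 * expR (A * (eps ^+ 2 * T)) <= CC * eps `^ (3 - alpha).
  rewrite -mulrA ler_wpM2l ?(ltW CC0)// powRD ?(gt_eqF eps_gt0) ?implybT//.
  rewrite powR_mulrn ?(ltW eps_gt0)// ler_wpM2l ?exprn_ge0 ?(ltW eps_gt0)//.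
  rewrite /powR gt_eqF// ler_expR TE mulrA mulNr -mulrN ler_wpM2r//.
  by rewrite oppr_ge0.
apply: (@le_trans _ _ (CC * eps ^+ 3 * expR (A * (eps ^+ 2 * T)))%:E); last by rewrite lee_fin.
(* Only truncations beyond both thresholds are estimated; the coarser ones follow by
   monotonicity. *)
apply: Hnorm_le; apply: (@sobolev_trunc_bound _ (maxn n0 n1)) => n.
rewrite geq_max => /andP[n0n n1n].
rewrite (eq_trunc n (fun k => fourierB k (L2 _ (cu.1 t)) (L2 _ (cv.1 t)))) truncB.
have E0 := fourier_initial inH cu iu; have E0' := fourier_initial inH cv iv.
have i0 : sobolev s (trunc n (fourier u0)) <= eps.
  by rewrite -lee_fin -hn sobolev_trunc_le_Hnorm.
have errv q : 0 <= q <= T -> sobolev s (tpos (truncation_error n (v q))) <= eps ^+ 5.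
  by move=> qT; rewrite (le_trans (sobolev_tpos_le _ _))// hn1.
have vpos q : tpos (trunc n (fourier (v q))) = trunc n (fourier (v q)) by exact: Hardy_tpos.
have sv := @szego_truncation _ _ n T szv.
have wv := hszego _ _ _ _ eps01 epsT1 sv vpos errv; rewrite E0' in wv.
apply: (hclose _ _ _ _ _ _ eps01 epsT1 (@half_wave_truncation _ _ n T hwu) sv) => //.
- by move=> q qT; split; [have [] := hn0 n q n0n qT|exact: errv].
- move=> q qT; have [_ h2 h3] := hn0 n q n0n qT; split=> //.
    by apply: le_trans h2 _; rewrite ler_wpM2r ?(ltW eps_gt0)// /B; lra.
  by apply: le_trans (wv i0 q qT) _; rewrite ler_wpM2r ?(ltW eps_gt0)// /B; lra.
- by rewrite E0.
- by rewrite E0 Hardy_tneg.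
- by rewrite E0 E0'.
Qed.
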